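(* Let $X$ be a reduced pure dimensional complex space. The graded subsheaf $\beta_X^{\bullet}$ of the graded coherent differential sheaf $L_X^{\bullet}$ is coherent, stable by exterior product and stable by the de Rham differential.
   Context: $S(X)$ is the singular set of $X$; $\Omega_X^{\bullet}$ is the graded sheaf of holomorphic (Kähler) differential forms. $L_X^q$ is the sheaf of meromorphic $q$-forms on $X$ which become holomorphic on any desingularization of $X$, i.e. $L_X^q=\tau_*\Omega^q_{\tilde X}$ for any desingularization $\tau:\tilde X\to X$; it is coherent, and $L_X^\bullet$ is stable by exterior product and by the de Rham differential $d$. $\alpha_X^q\subset L_X^q$ is the coherent subsheaf of sections $\sigma$ which locally on $X$ can be written, on the complement of $S(X)$, as a finite sum $\sigma=\sum_j\rho_j\,\omega_j$ with $\omega_j$ holomorphic $q$-forms (sections of $\Omega_X^q$) and $\rho_j$ functions that are $\mathscr C^\infty$ on the complement of $S(X)$ and bounded near $S(X)$. Put $\alpha_X^\bullet[0]:=\alpha_X^\bullet$ and for $p,q\ge0$ $$\alpha_X^q[p+1]:=\sum_{r=0}^{q}\alpha_X^r[p]\wedge\alpha_X^{q-r}[p]+\sum_{r=0}^{q-1}\alpha_X^r[p]\wedge d\big(\alpha_X^{q-r-1}[p]\big)\subset L_X^q .$$ The sequence $(\alpha_X^\bullet[p])_{p\ge 0}$ is increasing, and $\beta_X^{\bullet}:=\bigcup_{p\ge0}\alpha_X^\bullet[p]$. *)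

(* Defs.v *)
From HB Require Import structures.
From mathcomp Require Import all_boot all_order all_algebra all_fingroup.
From mathcomp Require Import all_classical all_reals all_analysis.
From mathcomp Require Import complex.
Set Implicit Arguments.
Unset Strict Implicit.
Unset Printing Implicit Defensive.
Import Order.TTheory GRing.Theory Num.Theory.
Import numFieldNormedType.Exports.
Local Open Scope classical_set_scope.
Local Open Scope ring_scope.

(* R[i] packaged as a numClosedFieldType, so that it receives the norm topology
   of numeric fields. *)
Definition Cx (R : realType) : numClosedFieldType := R[i]%C.
Definition ofR (R : realType) (t : R) : Cx R := (t%:C)%C.

Section Functions.
Variables (R : realType) (n : nat).
Implicit Types (W : set 'rV[Cx R]_n) (f : 'rV[Cx R]_n -> Cx R).

(* l is the derivative of f at z along v, with respect to a real parameter. *)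
Definition is_dirderiv f (v z : 'rV[Cx R]_n) (l : Cx R) : Prop :=
  (fun t : R => (ofR t)^-1 * (f (z + ofR t *: v) - f z)) @ 0^' --> l.

(* Real C^k functions on an open subset W of C^n = R^(2n). *)
Fixpoint Ck (k : nat) W f : Prop :=
  (forall z, W z -> {for z, continuous f}) /\
  if k is k'.+1 then
    forall v, exists g, (forall z, W z -> is_dirderiv f v z (g z)) /\ Ck k' W g
  else True.

Definition Cinfty W f : Prop := forall k, Ck k W f.

(* Smooth functions satisfying the Cauchy-Riemann equations: the real
   differential is C-linear. *)
Definition holomorphic W f : Prop :=
  Cinfty W f /\
  forall z v l, W z -> is_dirderiv f v z l -> is_dirderiv f ('i *: v) z ('i * l).

Definition analytic_subset W (A : set 'rV[Cx R]_n) : Prop :=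
  exists m (F : 'I_m -> 'rV[Cx R]_n -> Cx R),
    (forall i, holomorphic W (F i)) /\
    A = [set z | W z /\ forall i, F i z = 0].

End Functions.

(* phi identifies the open subspace U of T, together with the sheaf of functions
   whose germs at x are given by (hol x), with the locally closed subset A of C^n
   endowed with the functions that are locally restrictions of holomorphic
   functions of the ambient space. *)
Definition local_chart (R : realType) (T : topologicalType)
    (hol : T -> (T -> Cx R) -> Prop) (U : set T) (n : nat)
    (A : set 'rV[Cx R]_n) (phi : T -> 'rV[Cx R]_n) : Prop :=
  [/\ open U, set_bij U A phi,
      forall V, V `<=` U ->
        (open V <-> exists2 W, open W & V = U `&` phi @^-1` W) &
      forall x f, U x ->
        (hol x f <-> exists W F, [/\ open W, W (phi x), holomorphic W F &
           \forall y \near x, f y = F (phi y)])].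

(* The structure sheaf of a reduced complex space is a sheaf of C-valued
   functions; it is given by the predicate (hol_at x f), "f is holomorphic in a
   neighbourhood of x". Values of f far from x are irrelevant. *)
Record complexSpace (R : realType) := ComplexSpace {
  carrier :> topologicalType;
  hol_at : carrier -> (carrier -> Cx R) -> Prop;
  carrier_hausdorff : hausdorff_space carrier;
  local_models : forall x : carrier, exists U n W A (phi : carrier -> 'rV[Cx R]_n),
    [/\ U x, open W, analytic_subset W A & local_chart hol_at U A phi]
}.

Section Space.
Variables (R : realType) (X : complexSpace R).
Implicit Types (U V W : set X) (x y : X) (f g h rho : X -> Cx R).

Definition holo U f : Prop := forall x, U x -> hol_at x f.

Definition manifold_chart x d U (phi : X -> 'rV[Cx R]_d) : Prop :=
  U x /\ exists2 A, open A & local_chart (@hol_at R X) U A phi.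

Definition regular_of_dim d : set X :=
  [set x | exists U (phi : X -> 'rV[Cx R]_d), manifold_chart x U phi].

Definition reg : set X := [set x | exists d, regular_of_dim d x].

Definition sing : set X := ~` reg.

(* The irreducible components of a reduced complex space are the closures of the
   connected components of its regular locus. *)
Definition pure_dimensional : Prop :=
  exists d, forall x, reg x -> regular_of_dim d x.

Definition smooth_at x rho : Prop :=
  exists d U (phi : X -> 'rV[Cx R]_d) (W : set 'rV[Cx R]_d) psi,
    [/\ manifold_chart x U phi, open W, W (phi x), Cinfty W psi &
        \forall y \near x, rho y = psi (phi y)].

(* Tangent vectors at x, as derivations of the local ring at x. *)
Definition derivation x (D : (X -> Cx R) -> Cx R) : Prop :=
  [/\ forall f g, hol_at x f -> hol_at x g ->
        (\forall y \near x, f y = g y) -> D f = D g,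
      forall c f g, hol_at x f -> hol_at x g ->
        D (fun y => c * f y + g y) = c * D f + D g &
      forall f g, hol_at x f -> hol_at x g ->
        D (fun y => f y * g y) = f x * D g + g x * D f].

(* Differential q-forms on the regular locus. A raw form is a total function;
   only its values at regular points x, on q-tuples of derivations at x, are
   meaningful: see eqform. The sheaves below are torsion free, so their sections
   over U are determined by the corresponding forms on the regular part of U. *)
Definition form (q : nat) := X -> ('I_q -> (X -> Cx R) -> Cx R) -> Cx R.

Definition eqform_at q x (s t : form q) : Prop :=
  reg x -> forall D, (forall i, derivation x (D i)) -> s x D = t x D.

Definition eqform q U (s t : form q) : Prop := forall x, U x -> eqform_at x s t.

Definition lincomb q m (c : 'I_m -> X -> Cx R) (s : 'I_m -> form q) : form q :=
  fun x D => \sum_(i < m) c i x * s i x D.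

Definition wedge r s q (E : (r + s)%N = q) (a : form r) (b : form s) : form q :=
  fun x D => ((r`! * s`!)%:R)^-1 *
    \sum_(p : 'S_(r + s)) (-1) ^+ p
      * a x (fun i => D (cast_ord E (p (lshift s i))))
      * b x (fun j => D (cast_ord E (p (rshift r j)))).

(* (f, (g_1, .., g_q)) stands for f dg_1 /\ .. /\ dg_q, and a sequence of such
   items for their sum. *)
Definition kexpr (q : nat) := seq ((X -> Cx R) * q.-tuple (X -> Cx R)).

Definition kform q (e : kexpr q) : form q := fun x D =>
  \sum_(u <- e) u.1 x * \det (\matrix_(i < q, j < q) D i (tnth u.2 j)).

Definition kholo_at q x (e : kexpr q) : Prop :=
  forall u, u \in e -> hol_at x u.1 /\ forall j, hol_at x (tnth u.2 j).

Definition represents_at q x (s : form q) (e : kexpr q) : Prop :=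
  kholo_at x e /\ \forall y \near x, eqform_at y s (kform e).

(* d (sum f dg_1 /\ .. /\ dg_q) = sum df /\ dg_1 /\ .. /\ dg_q *)
Definition kdiff q (e : kexpr q) : kexpr q.+1 :=
  [seq (fun=> 1, cons_tuple u.1 u.2) | u <- e].

(* The de Rham differential, computed at x from any representation of s in a
   neighbourhood of x. *)
Definition dR q (s : form q) : form q.+1 := fun x =>
  kform (kdiff (xget [::] [set e | represents_at x s e])) x.

(* The form on the regular part of U is induced by a section of the sheaf
   of Kaehler forms over U. *)
Definition kahler_at q x (s : form q) : Prop := exists e, represents_at x s e.
Definition kahler q U (s : form q) : Prop := forall x, U x -> kahler_at x s.

(* h s is induced by a Kaehler form, for some nonzerodivisor h of the local ring
   at x: near x the germs of h do not vanish. *)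
Definition meromorphic_at q x (s : form q) : Prop :=
  exists h, [/\ hol_at x h,
    \forall y \near x, ~ (\forall z \near y, h z = 0) &
    kahler_at x ((fun y D => h y * s y D) : form q)].

(* Subsheaves: (F U s) says that s is a section of F over the open set U. *)
Definition subsheaf (q : nat) := set X -> set (form q).
Definition graded_subsheaf := forall q, subsheaf q.

Definition is_submodule q (F : subsheaf q) : Prop :=
  [/\ forall U s t, open U -> eqform U s t -> F U s -> F U t,
      forall U V s, open U -> open V -> V `<=` U -> F U s -> F V s,
      forall U s, open U ->
        (forall x, U x -> exists V, [/\ open V, V x, V `<=` U & F V s]) -> F U s,
      forall U, open U -> F U (fun _ _ => 0) &
      forall U c s t, open U -> holo U c -> F U s -> F U t ->
        F U (fun x D => c x * s x D + t x D)].

(* F restricted to the open set U is locally generated by finitely many sections;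
   S, eqon and comb are the type of raw sections, their equality over an open set
   and their linear combinations. *)
Definition finite_type (S : Type) (eqon : set X -> S -> S -> Prop)
    (comb : forall m, ('I_m -> X -> Cx R) -> ('I_m -> S) -> S)
    (F : set X -> set S) (U : set X) : Prop :=
  forall x, U x -> exists V m (s : 'I_m -> S),
    [/\ open V, V x, V `<=` U, forall i, F V (s i) &
      forall W t, open W -> W `<=` V -> F W t ->
      forall y, W y -> exists W' (c : 'I_m -> X -> Cx R),
        [/\ open W', W' y, W' `<=` W, forall i, holo W' (c i) &
            eqon W' t (comb m c s)]].

Definition relations q m (s : 'I_m -> form q) (W : set X)
    : set ('I_m -> X -> Cx R) :=
  [set c | (forall i, holo W (c i)) /\ eqform W (lincomb c s) (fun _ _ => 0)].

Definition eqvec m W (c c' : 'I_m -> X -> Cx R) : Prop :=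
  forall i x, W x -> c i x = c' i x.

Definition combvec m k (a : 'I_k -> X -> Cx R) (t : 'I_k -> 'I_m -> X -> Cx R)
    : 'I_m -> X -> Cx R := fun i x => \sum_(j < k) a j x * t j i x.

(* Coherent sheaves of modules over the structure sheaf. *)
Definition coherent q (F : subsheaf q) : Prop :=
  [/\ is_submodule F,
      finite_type (@eqform q) (@lincomb q) F setT &
      forall U m (s : 'I_m -> form q), open U -> (forall i, F U (s i)) ->
        finite_type (@eqvec m) (@combvec m) (relations s) U].

Definition included (F G : graded_subsheaf) : Prop :=
  forall q U s, open U -> F q U s -> G q U s.

Definition wedge_stable (F : graded_subsheaf) : Prop :=
  forall r s U a b, open U -> F r U a -> F s U b ->
    F (r + s)%N U (wedge (erefl (r + s)%N) a b).

Definition d_stable (F : graded_subsheaf) : Prop :=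
  forall q U s, open U -> F q U s -> F q.+1 U (dR s).

End Space.

Arguments reg {R} X.
Arguments sing {R} X.

Section Desingularization.
Variables (R : realType) (Y X : complexSpace R).

Definition holomorphic_map_at (tau : Y -> X) (y : Y) : Prop :=
  {for y, continuous tau} /\
  forall f, hol_at (tau y) f -> hol_at y (f \o tau).

Definition pullback q (tau : Y -> X) (s : form X q) : form Y q :=
  fun y D => s (tau y) (fun i f => D i (f \o tau)).

End Desingularization.

(* A proper modification by a complex manifold, biholomorphic over the regular
   locus. *)
Definition desingularization (R : realType) (Y X : complexSpace R)
    (tau : Y -> X) : Prop :=
  [/\ reg Y = setT,
      forall y, holomorphic_map_at tau y,
      forall K, compact K -> compact (tau @^-1` K),
      dense (tau @^-1` (reg X)) &
      exists kappa : X -> Y,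
        [/\ forall x, reg X x -> tau (kappa x) = x,
            forall y, reg X (tau y) -> kappa (tau y) = y &
            forall x, reg X x -> holomorphic_map_at kappa x]].

Section Sheaves.
Variables (R : realType) (X : complexSpace R).

(* Meromorphic forms, holomorphic on the regular locus, whose pullback by any
   desingularization extends holomorphically. *)
Definition Lsheaf : graded_subsheaf X := fun q U s =>
  [/\ forall x, U x -> meromorphic_at x s,
      kahler (U `&` reg X) s &
      forall (Y : complexSpace R) (tau : Y -> X), desingularization tau ->
        exists2 eta : form Y q, kahler (tau @^-1` U) eta &
          eqform (tau @^-1` (U `&` reg X)) eta (pullback tau s)].

Definition bounded_near_sing (V : set X) (rho : X -> Cx R) : Prop :=
  forall x, (V `&` sing X) x -> exists M : R,
    \forall y \near x, reg X y -> `|rho y| <= ofR M.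

Definition alpha : graded_subsheaf X := fun q U s =>
  Lsheaf U s /\
  forall x, U x -> exists V m (rho : 'I_m -> X -> Cx R) (omega : 'I_m -> form X q),
    [/\ open V, V x, V `<=` U,
        forall j, kahler V (omega j) /\ bounded_near_sing V (rho j) /\
                  (forall y, (V `&` reg X) y -> smooth_at y (rho j)) &
        eqform V s (lincomb rho omega)].

(* t is of the form a /\ b or a /\ db with a and b sections of F over V. *)
Definition elementary_product (F : graded_subsheaf X) q (V : set X)
    (t : form X q) : Prop :=
  (exists r s (E : (r + s)%N = q) (a : form X r) (b : form X s),
     [/\ F r V a, F s V b & t = wedge E a b]) \/
  (exists r s (E : (r + s.+1)%N = q) (a : form X r) (b : form X s),
     [/\ F r V a, F s V b & t = wedge E a (dR b)]).

Definition next_step (F : graded_subsheaf X) : graded_subsheaf X := fun q U s =>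
  forall x, U x -> exists V m (t : 'I_m -> form X q),
    [/\ open V, V x, V `<=` U, forall j, elementary_product F V (t j) &
        eqform V s (fun y D => \sum_(j < m) t j y D)].

Definition alpha_iter (p : nat) : graded_subsheaf X := iter p next_step alpha.

(* The union is taken in the category of sheaves, hence locally. *)
Definition beta : graded_subsheaf X := fun q U s =>
  forall x, U x -> exists V p,
    [/\ open V, V x, V `<=` U & alpha_iter p V s].

End Sheaves.

Arguments Lsheaf {R} X.
Arguments alpha {R} X.
Arguments beta {R} X.

(* Main.v *)
Require Import Defs.
From HB Require Import structures.
From mathcomp Require Import all_boot all_order all_algebra all_fingroup.
From mathcomp Require Import all_classical all_reals all_analysis.
From mathcomp Require Import complex ring lra zify.
Set Implicit Arguments.
Unset Strict Implicit.
Unset Printing Implicit Defensive.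
Import Order.TTheory GRing.Theory Num.Theory.
Import numFieldNormedType.Exports.
Local Open Scope classical_set_scope.
Local Open Scope ring_scope.

(* Expanding the recursion that defines beta, its sections are locally sums of words, i.e. of
   products of letters, a letter being a section b of alpha or its differential db.  A letter of
   degree 0 is a section of alpha^0: it is holomorphic on the regular part and bounded near the
   singular part, so it may be absorbed into the coefficients rho_j of any section of alpha.
   Hence words of length at most q + 1 already give all of beta^q, and this sheaf is of finite
   type because every alpha^r is: the Leibniz rule d(c g) = c dg + dc /\ g, together with
   dc /\ g in alpha, shows that products of generators of alpha and of their differentials
   generate.  Relations between sections of beta are relations between sections of L, so beta
   inherits coherence.  Stability under products and d follows from associativity and from the
   Leibniz rule for words.  The differential of a raw form is computed from an arbitrary Kaehler
   representation; that it does not depend on it rests on Hadamard's lemma (every derivation at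
   a regular point is a directional derivative in a chart) and on the symmetry of second
   derivatives. *)

(** * Complex-valued functions of a real variable *)

(** An increasing union of coherent subsheaves need not be coherent. The bound on word length
    depends on the degree alone, neither on the point nor on the level of the filtration, so in each
    degree the union is a single word sheaf. Two features shape the analysis. Smoothness is given by
    iterated derivatives along real directions, so complex linearity in the direction, symmetry of
    second derivatives and Hadamard's lemma all go back to the mean value theorem and to integrals
    over [0, 1]. Both are applied to real and imaginary parts separately, hence the factors of two
    in the estimates. Forms are compared only on derivations at regular points. There a section of L
    is locally a sum of terms f dg_1 /\ .. /\ dg_q, and [wedge] and [dR] become operations on such
    expressions, whose identities are identities of determinants. At singular points only side
    conditions have to be carried along: meromorphy, extension to desingularizations, boundedness of
    the coefficients. *)

Lemma cvg_congr (T : Type) (U : topologicalType) (F : set_system T)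
    {FF : Filter F} (f g : T -> U) (l : U) :
  (\forall x \near F, f x = g x) -> f @ F --> l -> g @ F --> l.
Proof. by move=> fg; apply: cvg_trans; exact: near_eq_cvg. Qed.

(* Stated over an abstract ring because [ring] does not cope with the concrete [Cx R]. *)
Lemma product_quotient (K : comNzRingType) (k a b c d : K) :
  c * (k * (b - d)) + b * (k * (a - c)) = k * (a * b - c * d).
Proof. by ring. Qed.

Section ComplexValues.
Variable R : realType.
Implicit Types (t s : R) (l c z : Cx R).

Definition re (z : Cx R) : R := complex.Re z.
Definition im (z : Cx R) : R := complex.Im z.

Lemma reD : {morph re : x y / x + y}. Proof. by move=> [? ?] [? ?]. Qed.
Lemma imD : {morph im : x y / x + y}. Proof. by move=> [? ?] [? ?]. Qed.
Lemma reB : {morph re : x y / x - y}. Proof. by move=> [? ?] [? ?]. Qed.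
Lemma imB : {morph im : x y / x - y}. Proof. by move=> [? ?] [? ?]. Qed.
Lemma re_ofRM t z : re (ofR t * z) = t * re z.
Proof. by case: z => a b; rewrite /re /= mul0r subr0. Qed.
Lemma im_ofRM t z : im (ofR t * z) = t * im z.
Proof. by case: z => a b; rewrite /im /= mul0r addr0. Qed.

Lemma ofRD : {morph @ofR R : x y / x + y}. Proof. exact: (rmorphD (real_complex R)). Qed.
Lemma ofRB : {morph @ofR R : x y / x - y}. Proof. exact: (rmorphB (real_complex R)). Qed.
Lemma ofRM : {morph @ofR R : x y / x * y}. Proof. exact: (rmorphM (real_complex R)). Qed.
Lemma ofRN : {morph @ofR R : x / - x}. Proof. exact: (rmorphN (real_complex R)). Qed.
Lemma ofRV : {morph @ofR R : x / x^-1}. Proof. exact: (fmorphV (real_complex R)). Qed.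
Lemma ofR0 : ofR (0 : R) = 0. Proof. by []. Qed.
Lemma ofR1 : ofR (1 : R) = 1. Proof. by []. Qed.
Lemma ofR_eq0 t : (ofR t == 0) = (t == 0). Proof. exact: (fmorph_eq0 (real_complex R)). Qed.
Lemma ofR_le t s : (ofR t <= ofR s) = (t <= s). Proof. exact: lecR. Qed.
Lemma ofR_lt t s : (ofR t < ofR s) = (t < s). Proof. exact: ltcR. Qed.
Lemma ofR_ge0 t : (0 <= ofR t) = (0 <= t). Proof. exact: ofR_le. Qed.
Lemma normr_ofR t : `|ofR t| = ofR `|t|.
Proof. by rewrite normc_def /= expr0n /= addr0 sqrtr_sqr. Qed.

Lemma reimE z : z = ofR (re z) + 'i * ofR (im z).
Proof. exact: complexE. Qed.

Lemma re_le_norm z : ofR `|re z| <= `|z|.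
Proof. exact: normc_ge_Re. Qed.
Lemma im_le_norm z : ofR `|im z| <= `|z|.
Proof.
rewrite -[leRHS]mulr1 -(normCi (Cx R)) -normrM; apply: le_trans (re_le_norm _).
by rewrite /re ReiNIm normrN.
Qed.
Lemma norm_le_reim z : `|z| <= ofR (`|re z| + `|im z|).
Proof.
rewrite {1}[z]reimE (le_trans (ler_normD _ _))// normrM (normCi (Cx R)) mul1r.
by rewrite !normr_ofR ofRD.
Qed.

Lemma gt0_ofR (e : Cx R) : 0 < e -> exists2 r : R, 0 < r & e = ofR r.
Proof.
case: e => a b; rewrite ltcE /= => /andP[/eqP -> a0]; by exists a.
Qed.

Lemma cvg_re T (F : set_system T) {FF : Filter F} (f : T -> Cx R) l :
  f @ F --> l -> (re \o f) @ F --> re l.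
Proof.
move=> /cvgrPdist_lt fl; apply/cvgrPdist_lt => e e0.
have {}/fl : 0 < ofR e by rewrite ofR_lt.
apply: filterS => x /= H; rewrite -ofR_lt -reB.
exact: le_lt_trans (re_le_norm _) H.
Qed.
Lemma cvg_im T (F : set_system T) {FF : Filter F} (f : T -> Cx R) l :
  f @ F --> l -> (im \o f) @ F --> im l.
Proof.
move=> /cvgrPdist_lt fl; apply/cvgrPdist_lt => e e0.
have {}/fl : 0 < ofR e by rewrite ofR_lt.
apply: filterS => x /= H; rewrite -ofR_lt -imB.
exact: le_lt_trans (im_le_norm _) H.
Qed.
Lemma cvg_ofR T (F : set_system T) {FF : Filter F} (f : T -> R) (l : R) :
  f @ F --> l -> (@ofR R \o f) @ F --> ofR l.
Proof.
move=> /cvgrPdist_lt fl; apply/cvgrPdist_lt => e /gt0_ofR[r r0 ->].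
move/(_ _ r0): fl; apply: filterS => x /= H.
by rewrite -ofRB normr_ofR ofR_lt.
Qed.

#[local] Opaque Cx.

Lemma cvgC_add T (F : set_system T) {FF : Filter F} (f g : T -> Cx R) (a b : Cx R) :
  f @ F --> a -> g @ F --> b -> (fun x => f x + g x) @ F --> a + b.
Proof. exact: cvgD. Qed.
Lemma cvgC_mul T (F : set_system T) {FF : Filter F} (f g : T -> Cx R) (a b : Cx R) :
  f @ F --> a -> g @ F --> b -> (fun x => f x * g x) @ F --> a * b.
Proof. exact: cvgM. Qed.

(** The quotient has the shape used in [is_dirderiv], so that a directional derivative is a [pder]
    along a line. *)
Definition pder (f : R -> Cx R) t l : Prop :=
  (fun h => (ofR h)^-1 * (f (t + h) - f t)) @ 0^' --> l.

Lemma pder_re f t l : pder f t l -> is_derive t 1 (re \o f) (re l).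
Proof.
move=> /cvg_re H.
have {}H : (fun h => h^-1 *: (((re \o f) \o shift t) (h *: 1) - (re \o f) t)) @ 0^' --> re l.
  apply: (cvg_congr _ H); near=> h.
  by rewrite /= -ofRV re_ofRM reB -[h *: 1]/(h * 1) mulr1 (addrC t).
split; first exact: cvgP H.
exact/cvg_lim.
Unshelve. all: by end_near. Qed.

Lemma pder_im f t l : pder f t l -> is_derive t 1 (im \o f) (im l).
Proof.
move=> /cvg_im H.
have {}H : (fun h => h^-1 *: (((im \o f) \o shift t) (h *: 1) - (im \o f) t)) @ 0^' --> im l.
  apply: (cvg_congr _ H); near=> h.
  by rewrite /= -ofRV im_ofRM imB -[h *: 1]/(h * 1) mulr1 (addrC t).
split; first exact: cvgP H.
exact/cvg_lim.
Unshelve. all: by end_near. Qed.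

Lemma pder_unique f t l l' : pder f t l -> pder f t l' -> l = l'.
Proof. by move=> H1 H2; apply: (cvg_unique _ H1 H2). Qed.

Lemma near_neq0 : \forall h \near (0 : R)^', h != 0.
Proof. exact: nbhs_dnbhs_neq. Qed.

Lemma pder_eq f g t l : (\forall s \near t, f s = g s) -> pder f t l -> pder g t l.
Proof.
move=> fg; apply: cvg_congr.
have ft := nbhs_singleton fg.
have : \forall h \near (0 : R)^', f (t + h) = g (t + h).
  by apply: nbhs_dnbhs; move: fg => /nbhs0P.
by apply: filterS => h ->; rewrite ft.
Qed.

Lemma pderD f g t l m : pder f t l -> pder g t m -> pder (fun s => f s + g s) t (l + m).
Proof.
move=> Hf Hg; apply: (cvg_congr _ (cvgC_add Hf Hg)); near=> h.
by rewrite /= -mulrDr addrACA -opprD.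
Unshelve. all: by end_near. Qed.

Lemma pder_cst c t : pder (fun=> c) t 0.
Proof.
rewrite /pder (_ : (fun h => _) = fun=> 0); first exact: cvg_cst.
by apply/funext => h; rewrite subrr mulr0.
Qed.

Lemma cont_shiftP (f : R -> Cx R) t :
  (fun h => f (t + h)) @ 0^' --> f t <-> {for t, continuous f}.
Proof.
have -> : {for t, continuous f} = {for 0, continuous (f \o shift t)}.
  by rewrite forE [in RHS]forE /continuous_at /= add0r cvg_comp_shift add0r.
have -> : (fun h => f (t + h)) = f \o shift t by apply/funext => h /=; rewrite addrC.
by rewrite continuous_withinNx /= add0r.
Qed.

Lemma pder_cont f t l : pder f t l -> {for t, continuous f}.
Proof.
move=> H; apply/(cont_shiftP f t).
have h0 : (fun h => ofR h) @ (0 : R)^' --> (0 : Cx R).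
  by apply: (@cvg_ofR _ _ _ (fun h : R => h) 0); apply: nbhs_dnbhs.
have H2 : (fun h => ofR h * ((ofR h)^-1 * (f (t + h) - f t)) + f t) @ 0^' --> 0 * l + f t.
  exact: (cvgC_add (cvgC_mul h0 H) (cvg_cst _)).
rewrite mul0r add0r in H2.
apply: (cvg_congr _ H2); near=> h.
rewrite /= mulrA divff ?ofR_eq0; last by near: h; exact: near_neq0.
by rewrite mul1r subrK.
Unshelve. all: by end_near. Qed.

Lemma pderM f g t l m : pder f t l -> pder g t m ->
  pder (fun s => f s * g s) t (f t * m + g t * l).
Proof.
move=> Hf Hg.
have /(cont_shiftP g t) gt := pder_cont Hg.
have H2 : (fun h => f t * ((ofR h)^-1 * (g (t + h) - g t))
    + g (t + h) * ((ofR h)^-1 * (f (t + h) - f t))) @ 0^' --> f t * m + g t * l.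
  exact: (cvgC_add (cvgC_mul (cvg_cst _) Hg) (cvgC_mul gt Hf)).
apply: (cvg_congr _ H2); near=> h.
set a := f (t + h); set b := g (t + h).
exact: product_quotient.
Unshelve. all: by end_near. Qed.

Lemma pderZ c f t l : pder f t l -> pder (fun s => c * f s) t (c * l).
Proof. by move=> H; have := pderM (pder_cst c t) H; rewrite mulr0 addr0. Qed.

Lemma pder_scale f t a l : pder f (a * t) l -> pder (fun s => f (a * s)) t (ofR a * l).
Proof.
have [->|a0] := eqVneq a 0.
  move=> _; rewrite ofR0 mul0r.
  apply: (pder_eq (f := fun=> f 0)); last exact: pder_cst.
  by near=> s; rewrite mul0r.
move=> H.
have ha : (fun h => a * h) @ (0 : R)^' --> (0 : R)^'.
  move=> A [e /= e0 eA]; exists (e / `|a|); first by rewrite /= divr_gt0// normr_gt0.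
  move=> h /=; rewrite sub0r normrN => he h0; apply: eA => /=; last by rewrite mulf_neq0.
  by rewrite sub0r normrN normrM mulrC -ltr_pdivlMr ?normr_gt0.
have H2 : (fun h => ofR a * ((ofR (a * h))^-1 * (f (a * t + a * h) - f (a * t)))) @ 0^' --> ofR a * l.
  exact: (cvgC_mul (cvg_cst _) (cvg_comp _ _ ha H)).
apply: (cvg_congr _ H2); near=> h.
rewrite -(mulrDr a) mulrA ofRM; congr (_ * _).
have h0 : ofR h != 0 by rewrite ofR_eq0; near: h; exact: near_neq0.
by rewrite invfM mulrA divff ?mul1r ?ofR_eq0.
Unshelve. all: by end_near. Qed.

(** The mean value theorem fails for complex values. It is applied to the real and the imaginary
    part, which gives two different intermediate points and hence [e + e]. *)
Lemma pder_increment (f f' : R -> Cx R) l (e : R) :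
  (forall t, 0 <= t <= 1 -> pder f t (f' t)) ->
  (forall t, 0 <= t <= 1 -> `|f' t - l| <= ofR e) ->
  `|f 1 - f 0 - l| <= ofR (e + e).
Proof.
move=> df fl; apply: le_trans (norm_le_reim _) _; rewrite ofR_le.
have oo t : t \in `]0, 1[%R -> 0 <= t <= 1.
  by rewrite in_itv /= => /andP[/ltW -> /ltW ->].
have [c c01 Hc] : exists2 c, c \in `]0, 1[%R & (re \o f) 1 - (re \o f) 0 = re (f' c) * (1 - 0).
  apply: (@MVT R (re \o f) (re \o f')) => //.
    by move=> t /oo/df/pder_re.
  apply: derivable_within_continuous => t; rewrite in_itv /= => /df/pder_re H.
  exact: ex_derive.
have [d d01 Hd] : exists2 d, d \in `]0, 1[%R & (im \o f) 1 - (im \o f) 0 = im (f' d) * (1 - 0).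
  apply: (@MVT R (im \o f) (im \o f')) => //.
    by move=> t /oo/df/pder_im.
  apply: derivable_within_continuous => t; rewrite in_itv /= => /df/pder_im H.
  exact: ex_derive.
rewrite !reB !imB; move: Hc Hd => /= -> ->; rewrite subr0 !mulr1 -reB -imB.
apply: lerD; rewrite -ofR_le.
  by apply: le_trans (re_le_norm _) _; exact: fl (oo _ c01).
by apply: le_trans (im_le_norm _) _; exact: fl (oo _ d01).
Qed.

End ComplexValues.
Arguments re {R} z.
Arguments im {R} z.

Lemma complex_mul_rule (K : comNzRingType) (i a b p q : K) : i * i = -1 ->
  a * p + - b * q + i * (a * q + b * p) = (a + i * b) * (p + i * q).
Proof.
move=> ii; have -> : (a + i * b) * (p + i * q) = a * p + (i * i) * (b * q) + i * (a * q + b * p).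
  by ring.
by rewrite ii; ring.
Qed.

(** * Integration of complex functions over the unit interval *)

Section UnitIntegral.
Variable R : realType.
Implicit Types (f g : R -> Cx R) (c : Cx R).
Local Notation mu := (@lebesgue_measure R).

(** Continuity is two-sided even at 0 and 1; the integrands met below satisfy this because their
    segments lie in an open set. *)
Definition ucont f : Prop := forall t : R, 0 <= t <= 1 -> {for t, continuous f}.

Definition runit (f : R -> R) : R := \int[mu]_(t in `[0, 1]) f t.

Definition cint f : Cx R := ofR (runit (re \o f)) + 'i * ofR (runit (im \o f)).

Lemma unit_integrable (f : R -> R) :
  (forall t, 0 <= t <= 1 -> {for t, continuous f}) -> mu.-integrable `[0, 1] (EFin \o f).
Proof.
move=> cf; apply: continuous_compact_integrable; first exact: segment_compact.
apply: continuous_in_subspaceT => t; rewrite inE /= in_itv /=; exact: cf.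
Qed.

Lemma runitD (f g : R -> R) :
  (forall t, 0 <= t <= 1 -> {for t, continuous f}) ->
  (forall t, 0 <= t <= 1 -> {for t, continuous g}) ->
  runit (fun t => f t + g t) = runit f + runit g.
Proof. by move=> cf cg; apply: RintegralD => //; exact: unit_integrable. Qed.

Lemma runitZ (r : R) (f : R -> R) :
  (forall t, 0 <= t <= 1 -> {for t, continuous f}) -> runit (fun t => r * f t) = r * runit f.
Proof. by move=> cf; apply: RintegralZl => //; exact: unit_integrable. Qed.

Lemma eq_runit (f g : R -> R) : (forall t, 0 <= t <= 1 -> f t = g t) -> runit f = runit g.
Proof. by move=> fg; apply: eq_Rintegral => t; rewrite inE /= in_itv /= => /fg. Qed.

Lemma runit_cst (r : R) : runit (fun=> r) = r.
Proof.
have m1 : mu `[0, 1] = 1%E.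
  by rewrite lebesgue_measure_itv /= lte_fin ltr01 -EFinD subr0.
rewrite /runit Rintegral_cst; last exact: measurable_itv.
by rewrite [X in fine X]m1 mulr1.
Qed.

Lemma runit_le (f : R -> R) M :
  (forall t, 0 <= t <= 1 -> {for t, continuous f}) ->
  (forall t, 0 <= t <= 1 -> `|f t| <= M) -> `|runit f| <= M.
Proof.
move=> cf fM; rewrite -[leRHS]runit_cst ler_norml -[- runit _]mulN1r -runitZ; last first.
  by move=> t _; exact: cst_continuous.
apply/andP; split; apply: le_Rintegral => //; try exact: unit_integrable.
- by apply: unit_integrable => t _; exact: cst_continuous.
- by move=> t /=; rewrite in_itv /= mulN1r => /fM; rewrite ler_norml => /andP[].
- by apply: unit_integrable => t _; exact: cst_continuous.
- by move=> t /=; rewrite in_itv /= => /fM; rewrite ler_norml => /andP[].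
Qed.

Lemma runit_ftc (F f : R -> R) :
  (forall t : R, 0 <= t <= 1 -> is_derive t 1 F (f t)) ->
  (forall t, 0 <= t <= 1 -> {for t, continuous f}) ->
  runit f = F 1 - F 0.
Proof.
move=> dF cf.
have cF t : 0 <= t <= 1 -> {for t, continuous F}.
  by move=> /dF H; apply/differentiable_continuous/derivable1_diffP; exact: ex_derive.
have oo t : t \in `]0, 1[%R -> 0 <= t <= 1.
  by rewrite in_itv /= => /andP[/ltW -> /ltW ->].
rewrite /runit /Rintegral (@continuous_FTC2 R f F) ?ltr01//=.
- apply: continuous_in_subspaceT => t; rewrite inE /= in_itv /=; exact: cf.
- split; first by move=> t /oo/dF H; exact: ex_derive.
  + by apply: cvg_at_right_filter; apply: cF; rewrite lexx ler01.
  + by apply: cvg_at_left_filter; apply: cF; rewrite lexx ler01.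
- by move=> t /oo/dF H; rewrite derive1E derive_val.
Qed.

Lemma ucont_re f : ucont f -> forall t, 0 <= t <= 1 -> {for t, continuous (re \o f)}.
Proof. by move=> cf t /cf; exact: cvg_re. Qed.
Lemma ucont_im f : ucont f -> forall t, 0 <= t <= 1 -> {for t, continuous (im \o f)}.
Proof. by move=> cf t /cf; exact: cvg_im. Qed.

Lemma ucontZ c f : ucont f -> ucont (fun t => c * f t).
Proof. by move=> cf t /cf H; apply: cvgC_mul H; exact: cvg_cst. Qed.

Lemma ucontD f g : ucont f -> ucont g -> ucont (fun t => f t + g t).
Proof. by move=> cf cg t t01; apply: cvgC_add; [exact: cf|exact: cg]. Qed.

Lemma ucont_sum (I : Type) (r : seq I) (f : I -> R -> Cx R) : (forall i, ucont (f i)) ->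
  ucont (fun t => \sum_(i <- r) f i t).
Proof.
move=> cf; elim: r => [|i s IH].
  have -> : (fun t => \sum_(i <- [::]) f i t) = fun=> 0.
    by apply/funext => u; rewrite big_nil.
  by move=> t _; exact: cst_continuous.
have -> : (fun t => \sum_(i <- i :: s) f i t) = fun t => f i t + \sum_(i <- s) f i t.
  by apply/funext => u; rewrite big_cons.
exact: (@ucontD (f i) _ (cf i) IH).
Qed.

Lemma eq_cint f g : (forall t, 0 <= t <= 1 -> f t = g t) -> cint f = cint g.
Proof.
by move=> fg; rewrite /cint; congr (ofR _ + _ * ofR _); apply: eq_runit => t /fg /= ->.
Qed.

Lemma cintD f g : ucont f -> ucont g -> cint (fun t => f t + g t) = cint f + cint g.
Proof.
move=> cf cg; rewrite /cint.
rewrite (@eq_runit _ (fun t => (re \o f) t + (re \o g) t)); last by move=> t _; rewrite /= reD.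
rewrite (@eq_runit (im \o _) (fun t => (im \o f) t + (im \o g) t)); last by move=> t _; rewrite /= imD.
rewrite !runitD; [|exact: ucont_im..|exact: ucont_re|exact: ucont_re].
by rewrite !ofRD mulrDr addrACA.
Qed.

Lemma cintZ c f : ucont f -> cint (fun t => c * f t) = c * cint f.
Proof.
move=> cf; rewrite /cint.
have reM (x y : Cx R) : re (x * y) = re x * re y + (- im x) * im y.
  by case: x y => a b [p q]; rewrite /re /im /= mulNr.
have imM (x y : Cx R) : im (x * y) = re x * im y + im x * re y.
  by case: x y => a b [p q]; rewrite /re /im /=.
have cZ r (h : R -> R) : (forall t, 0 <= t <= 1 -> {for t, continuous h}) ->
    forall t, 0 <= t <= 1 -> {for t, continuous (fun t => r * h t)}.
  by move=> ch t /ch H; apply: cvgM => //; exact: cvg_cst.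
have [cr ci] := (ucont_re cf, ucont_im cf).
rewrite (@eq_runit _ (fun t => re c * (re \o f) t + - im c * (im \o f) t)); last by move=> t _; rewrite /= reM.
rewrite (@eq_runit (im \o _) (fun t => re c * (im \o f) t + im c * (re \o f) t)); last by move=> t _; rewrite /= imM.
rewrite !runitD; [|exact: cZ..].
rewrite (runitZ (re c) cr) (runitZ (- im c) ci) (runitZ (re c) ci) (runitZ (im c) cr).
rewrite [c in RHS]reimE !ofRD !ofRM ofRN.
have ii : 'i * 'i = -1 :> Cx R by rewrite -expr2 sqrCi.
set a := ofR (re c); set b := ofR (im c); set p := ofR _; set q := ofR _.
exact: complex_mul_rule.
Qed.

Lemma cint_cst c : cint (fun=> c) = c.
Proof. by rewrite /cint !runit_cst -reimE. Qed.

(** The constant is not sharp: the two real integrals are bounded separately. Only epsilon estimates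
    use it. *)
Lemma cint_le f M : ucont f -> (forall t, 0 <= t <= 1 -> `|f t| <= ofR M) ->
  `|cint f| <= ofR (M + M).
Proof.
move=> cf fM; rewrite (le_trans (ler_normD _ _))// normrM (normCi (Cx R)) mul1r.
rewrite !normr_ofR ofRD lerD// ofR_le; apply: runit_le.
- exact: ucont_re.
- by move=> t /fM H; rewrite -ofR_le (le_trans (re_le_norm _)).
- exact: ucont_im.
- by move=> t /fM H; rewrite -ofR_le (le_trans (im_le_norm _)).
Qed.

Lemma le_cint_diff f g (e : R) : ucont f -> ucont g ->
  (forall t, 0 <= t <= 1 -> `|f t - g t| <= ofR e) -> `|cint f - cint g| <= ofR (e + e).
Proof.
move=> cf cg fg.
have cN : ucont (fun t => -1 * g t) by exact: ucontZ.
rewrite -[- cint g]mulN1r -(@cintZ (-1) g cg) -(@cintD f _ cf cN); apply: cint_le.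
  exact: (@ucontD f _ cf cN).
by move=> t t01; rewrite mulN1r; exact: fg.
Qed.

Lemma cint_ftc F f : (forall t, 0 <= t <= 1 -> pder F t (f t)) -> ucont f ->
  cint f = F 1 - F 0.
Proof.
move=> dF cf; rewrite /cint.
have -> : runit (re \o f) = (re \o F) 1 - (re \o F) 0.
  by apply: runit_ftc; [move=> t /dF; exact: pder_re|exact: ucont_re].
have -> : runit (im \o f) = (im \o F) 1 - (im \o F) 0.
  by apply: runit_ftc; [move=> t /dF; exact: pder_im|exact: ucont_im].
by rewrite /= -reB -imB -reimE.
Qed.

Lemma cint_sum (I : Type) (r : seq I) (f : I -> R -> Cx R) : (forall i, ucont (f i)) ->
  cint (fun t => \sum_(i <- r) f i t) = \sum_(i <- r) cint (f i).
Proof.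
move=> cf; elim: r => [|i r IH].
  by rewrite big_nil -[RHS]cint_cst; apply: eq_cint => t _; rewrite big_nil.
rewrite big_cons -IH -(@cintD (f i) _ (cf i) (@ucont_sum _ r f cf)).
by apply: eq_cint => t _; rewrite big_cons.
Qed.

End UnitIntegral.

(* Unification on quotients and limits diverges when it unfolds [Cx R] to pairs of reals. *)
#[local] Opaque Cx ofR.

#[global] Instance nbhs_row_filter (R : realType) n (z : 'rV[Cx R]_n) :
  ProperFilter (nbhs z).
Proof. exact: nbhs_pfilter. Qed.

(** * Smooth and holomorphic functions on C^n *)

Section DirectionalDerivatives.
Variables (R : realType) (n : nat).
Local Notation V := 'rV[Cx R]_n.
Implicit Types (W : set V) (f g : V -> Cx R) (v w z : V) (l : Cx R).

Lemma dirderiv_path f v z t l :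
  is_dirderiv f v (z + ofR t *: v) l -> pder (fun s => f (z + ofR s *: v)) t l.
Proof.
apply: cvg_congr; near=> h.
by rewrite -addrA -scalerDl -ofRD.
Unshelve. all: by end_near. Qed.

Lemma dirderiv_pder f v z l :
  is_dirderiv f v z l <-> pder (fun s => f (z + ofR s *: v)) 0 l.
Proof.
split=> [H|]; first by apply: dirderiv_path; rewrite ofR0 scale0r addr0.
by apply: cvg_congr; near=> h; rewrite add0r ofR0 scale0r addr0.
Unshelve. all: by end_near. Qed.

Lemma dirderiv_unique f v z l l' :
  is_dirderiv f v z l -> is_dirderiv f v z l' -> l = l'.
Proof. by move=> /dirderiv_pder H /dirderiv_pder; apply: pder_unique. Qed.

Lemma norm_ofR_ex (U : normedModType (Cx R)) (v : U) : exists2 r : R, 0 <= r & `|v| = ofR r.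
Proof.
have := normr_ge0 v; rewrite le_eqVlt => /predU1P[<-|/gt0_ofR[r r0 ->]].
  by exists 0.
by exists r => //; exact: ltW.
Qed.

(** Makes the mean value theorem available on short segments in the direction v, uniformly in their
    base point y. *)
Lemma segment_near (P : set V) v z : (\forall y \near z, P y) ->
  \forall y \near z & t \near (0 : R), forall s, 0 <= s <= 1 -> P (y + ofR (s * t) *: v).
Proof.
move=> /nbhs_ballP[e /= /gt0_ofR[r r0 ->]] zP.
have [m m0 vm] := norm_ofR_ex v.
have r20 : 0 < r / 2 by rewrite divr_gt0.
have Bz : \forall y \near z, `|z - y| < ofR (r / 2).
  by have := @nbhsx_ballx _ V z (ofR (r / 2)); rewrite -ball_normE; apply; rewrite ofR_lt.
have Bt : \forall t \near (0 : R), `|t| < r / 2 / (m + 1).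
  by apply: nbhs0_lt; rewrite divr_gt0//; lra.
near=> y t => s /andP[s0 s1]; apply: zP; rewrite -ball_normE /=.
have yz : `|z - y| < ofR (r / 2).
  by near: y.
have tv : `|t| < r / 2 / (m + 1).
  by near: t.
rewrite opprD addrA (le_lt_trans (ler_normB _ _))// normrZ normr_ofR vm -ofRM.
rewrite [r]splitr ofRD ltrD// ofR_lt.
rewrite normrM (ger0_norm s0); move: tv; rewrite ltr_pdivlMr; last lra.
apply: le_lt_trans; apply: ler_pM; rewrite ?mulr_ge0//; last lra.
by rewrite -[leRHS]mul1r ler_wpM2r.
Unshelve. all: by end_near. Qed.

Lemma cvg_line v z : (fun t : R => z + ofR t *: v) @ 0^' --> z.
Proof.
have H : (fun t : R => z + ofR t *: v) @ 0^' --> z + (0 : Cx R) *: v.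
  apply: cvgD; first exact: cvg_cst.
  apply: cvgZ; last exact: cvg_cst.
  by apply: (@cvg_ofR _ _ _ _ (fun h : R => h) 0); apply: nbhs_dnbhs.
by rewrite scale0r addr0 in H.
Qed.

Lemma dirderiv_segment W f v g y t s : open W -> (forall y, W y -> is_dirderiv f v y (g y)) ->
  W (y + ofR (s * t) *: v) ->
  pder (fun s => f (y + ofR (s * t) *: v)) s (ofR t * g (y + ofR (s * t) *: v)).
Proof.
move=> oW dW Wy.
have -> : (fun s => f (y + ofR (s * t) *: v)) = (fun s => f (y + ofR (t * s) *: v)).
  by apply/funext => u; rewrite mulrC.
apply: (@pder_scale R (fun s => f (y + ofR s *: v))); apply: dirderiv_path.
by rewrite (mulrC t); exact: dW.
Qed.

(** Continuity of the derivative at z makes the first order expansion uniform in the base point y.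
    This uniformity is what additivity in the direction, second differences and differentiation
    under the integral require. *)
Lemma dirderiv_uniform W f v g z (e : R) : open W -> W z ->
  (forall y, W y -> is_dirderiv f v y (g y)) -> {for z, continuous g} -> 0 < e ->
  \forall y \near z & t \near (0 : R),
    `|f (y + ofR t *: v) - f y - ofR t * g z| <= ofR (e * `|t|).
Proof.
move=> oW Wz dW cg e0; have e20 : 0 < e / 2 by rewrite divr_gt0.
have Pz : \forall y \near z, W y /\ `|g y - g z| <= ofR (e / 2).
  near=> y; split; first by near: y; exact: open_nbhs_nbhs.
  rewrite distrC; near: y; move/cvgrPdist_le: cg; apply; by rewrite ofR_lt.
have := segment_near v Pz; apply: filterS => -[y t] /= H.
pose p (s : R) := f (y + ofR (s * t) *: v).
have := @pder_increment R p (fun s => ofR t * g (y + ofR (s * t) *: v)) (ofR t * g z) (e / 2 * `|t|).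
rewrite /p mul1r mul0r scale0r addr0 -mulrDl -splitr; apply=> s s01.
  by apply: dirderiv_segment oW dW _; have [] := H s s01.
rewrite -mulrBr normrM normr_ofR (ofRM (e / 2)) [leRHS]mulrC ler_wpM2l ?ofR_ge0//.
by have [] := H s s01.
Unshelve. all: by end_near. Qed.

Lemma dirderiv_uniform_cvg W f v g z (y : R -> V) : open W -> W z ->
  (forall y, W y -> is_dirderiv f v y (g y)) -> {for z, continuous g} ->
  y @ 0^' --> z ->
  (fun t => (ofR t)^-1 * (f (y t + ofR t *: v) - f (y t))) @ 0^' --> g z.
Proof.
move=> oW Wz dW cg yz; apply/cvgrPdist_le => _ /gt0_ofR[e e0 ->].
have [[A B] /= [zA B0] AB] := dirderiv_uniform oW Wz dW cg e0.
have t0 := nbhs_dnbhs B0; have yA : \forall t \near 0^', A (y t) := yz _ zA.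
near=> t.
have tn0 : t != 0 by near: t; exact: near_neq0.
have /= := AB (y t, t) (conj (near yA t _) (near t0 t _)).
move=> /(_ ltac:(by []) ltac:(by [])).
rewrite distrC -(ler_pM2l (x := `|ofR t|^-1)); last by rewrite invr_gt0 normr_gt0 ofR_eq0.
rewrite -normfV -normrM mulrBr mulKf ?ofR_eq0// => /le_trans; apply.
rewrite normfV normr_ofR -ofRV -ofRM ofR_le mulrCA mulVf ?normr_eq0// mulr1 //.
Unshelve. all: by end_near. Qed.

(** The increment along v + w is split at z + t w. The part along v has a moving base point, so the
    derivative along v must be continuous; along w its existence at z is enough. *)
Lemma dirderivD W f v w g z l : open W -> W z ->
  (forall y, W y -> is_dirderiv f v y (g y)) -> {for z, continuous g} ->
  is_dirderiv f w z l -> is_dirderiv f (v + w) z (g z + l).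
Proof.
move=> oW Wz dW cg dw.
have H : (fun t => (ofR t)^-1 * (f (z + ofR t *: w + ofR t *: v) - f (z + ofR t *: w))
   + (ofR t)^-1 * (f (z + ofR t *: w) - f z)) @ 0^' --> g z + l.
  apply: cvgD dw; apply: dirderiv_uniform_cvg oW Wz dW cg _; exact: cvg_line.
apply: (cvg_congr _ H); near=> t.
by rewrite -mulrDr addrA subrK scalerDr -addrA (addrC (_ *: w)).
Unshelve. all: by end_near. Qed.

Lemma dirderivZ f (a : R) v z l : is_dirderiv f v z l ->
  is_dirderiv f (ofR a *: v) z (ofR a * l).
Proof.
move=> /dirderiv_pder H; apply/dirderiv_pder.
rewrite -[0](mulr0 a) in H; have := pder_scale H.
apply: pder_eq; near=> s; by rewrite scalerA -ofRM mulrC.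
Unshelve. all: by end_near. Qed.

(** For fixed t the mean value estimate is applied in s to f(z + t w + s t v) - f(z + s t v). Its
    derivative t (g(z + t w + s t v) - g(z + s t v)) is close to t^2 h(z) by the uniform expansion
    of g along w. The difference quotient is symmetric in v and w, whence the symmetry of second
    derivatives. *)
Lemma second_difference W f v w g h z : open W -> W z ->
  (forall y, W y -> is_dirderiv f v y (g y)) ->
  (forall y, W y -> is_dirderiv g w y (h y)) -> {for z, continuous h} ->
  (fun t => (ofR (t ^+ 2))^-1 * (f (z + ofR t *: v + ofR t *: w) - f (z + ofR t *: v)
      - f (z + ofR t *: w) + f z)) @ 0^' --> h z.
Proof.
move=> oW Wz df dg ch; apply/cvgrPdist_le => _ /gt0_ofR[e e0 ->].
have e20 : 0 < e / 2 by rewrite divr_gt0.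
have [[A B] /= [zA B0] AB] := dirderiv_uniform oW Wz dg ch e20.
have [[A1 B1] /= [zA1 B10] AB1] := segment_near v (zA : \forall y \near z, A y).
have [[A2 B2] /= [zA2 B20] AB2] := segment_near v (open_nbhs_nbhs (conj oW Wz)).
have A2z : A2 z by exact: nbhs_singleton.
have A1z : A1 z by exact: nbhs_singleton.
have tB := nbhs_dnbhs B0; have tB1 := nbhs_dnbhs B10; have tB2 := nbhs_dnbhs B20.
have zw : \forall t \near (0 : R)^', A2 (z + ofR t *: w) := cvg_line w zA2.
near=> t.
have tn0 : t != 0 by near: t; exact: near_neq0.
have [Bt [B1t [B2t A2t]]] : B t /\ B1 t /\ B2 t /\ A2 (z + ofR t *: w).
  split; [exact: (near tB t)|split; [exact: (near tB1 t)|split]].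
    exact: (near tB2 t).
  exact: (near zw t).
pose p (s : R) := f (z + ofR t *: w + ofR (s * t) *: v) + (-1) * f (z + ofR (s * t) *: v).
pose dp (s : R) := ofR t * g (z + ofR t *: w + ofR (s * t) *: v) + (-1) * (ofR t * g (z + ofR (s * t) *: v)).
have := @pder_increment R p dp (ofR (t ^+ 2) * h z) (e / 2 * `|t| ^+ 2).
rewrite -mulrDl -splitr => Hp.
have {}Hp : `|p 1 - p 0 - ofR (t ^+ 2) * h z| <= ofR (e * `|t| ^+ 2).
  apply: Hp => s s01.
    apply: pderD; first apply: dirderiv_segment oW df _.
      exact: (AB2 (_, _)).
    apply: pderZ; apply: dirderiv_segment oW df _.
    by apply: (AB2 (z, t)).
  have /= := AB (z + ofR (s * t) *: v, t) (conj (AB1 (_, _) _ s s01) Bt).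
  move=> /(_ (conj A1z B1t)) H.
  rewrite /dp mulN1r expr2 (ofRM t t) -mulrA -!mulrBr normrM normr_ofR.
  rewrite (addrAC z (ofR t *: w)).
  rewrite (_ : e / 2 * `|t| ^+ 2 = `|t| * (e / 2 * `|t|)) ?expr2; last by rewrite mulrCA.
  by rewrite (ofRM `|t|) ler_wpM2l ?ofR_ge0.
rewrite distrC -(ler_pM2l (x := `|ofR (t ^+ 2)|)); last by rewrite normr_gt0 ofR_eq0 expf_neq0.
rewrite -normrM mulrBr mulVKf; last by rewrite ofR_eq0 expf_neq0.
rewrite normr_ofR -ofRM normrX (mulrC _ e); apply: le_trans Hp.
rewrite /p !mul1r !mul0r ofR0 !scale0r !addr0 !mulN1r opprD opprK le_eqVlt; apply/orP; left.
apply/eqP; congr `|_ - _|.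
by rewrite [RHS]addrA (addrAC z (ofR t *: w)).
Unshelve. all: by end_near. Qed.

Lemma dirderivC W f v w gv gw hvw hwv z : open W -> W z ->
  (forall y, W y -> is_dirderiv f v y (gv y)) ->
  (forall y, W y -> is_dirderiv f w y (gw y)) ->
  (forall y, W y -> is_dirderiv gv w y (hvw y)) ->
  (forall y, W y -> is_dirderiv gw v y (hwv y)) ->
  {for z, continuous hvw} -> {for z, continuous hwv} -> hvw z = hwv z.
Proof.
move=> oW Wz dv dw dvw dwv c1 c2.
have H1 := second_difference oW Wz dv dvw c1.
have H2 := second_difference oW Wz dw dwv c2.
apply: (cvg_unique _ H1).
  exact: norm_hausdorff.
apply: (cvg_congr _ (H2 : _ @ 0^' --> _)); near=> t.
by rewrite (addrAC z) -!addrA (addrCA (- _) (- _)).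
Unshelve. all: by end_near. Qed.

End DirectionalDerivatives.

(** * Calculus of C^k and holomorphic functions *)

Section SmoothFunctions.
Variables (R : realType) (n : nat).
Local Notation V := 'rV[Cx R]_n.
Implicit Types (W : set V) (f g : V -> Cx R) (v w z : V) (l : Cx R).

Lemma dirderiv_congr W f g v z l : open W -> W z -> (forall y, W y -> f y = g y) ->
  is_dirderiv f v z l -> is_dirderiv g v z l.
Proof.
move=> oW Wz fg; apply: cvg_congr.
have Wl : \forall t \near (0 : R)^', W (z + ofR t *: v).
  by have := cvg_line v (open_nbhs_nbhs (conj oW Wz)).
by near=> t; rewrite !fg//; exact: (near Wl t).
Unshelve. all: by end_near. Qed.

Lemma dirderiv_add f g v z l m : is_dirderiv f v z l -> is_dirderiv g v z m ->
  is_dirderiv (fun y => f y + g y) v z (l + m).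
Proof. by move=> /dirderiv_pder Hf /dirderiv_pder Hg; apply/dirderiv_pder; exact: pderD. Qed.

Lemma dirderiv_mul f g v z l m : is_dirderiv f v z l -> is_dirderiv g v z m ->
  is_dirderiv (fun y => f y * g y) v z (f z * m + g z * l).
Proof.
move=> /dirderiv_pder Hf /dirderiv_pder Hg; apply/dirderiv_pder.
by have := pderM Hf Hg; rewrite ofR0 !scale0r !addr0.
Qed.

Lemma dirderiv_cst (c : Cx R) v z : is_dirderiv (fun=> c) v z 0.
Proof. by apply/dirderiv_pder; exact: pder_cst. Qed.

Lemma dirderiv_coord j v z : is_dirderiv (fun y => y 0 j) v z (v 0 j).
Proof.
apply: (cvg_congr _ (cvg_cst (v 0 j) : _ @ (0 : R)^' --> _)); near=> t.
rewrite !mxE addrAC subrr add0r mulKf// ofR_eq0.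
by near: t; exact: near_neq0.
Unshelve. all: by end_near. Qed.

Lemma Ck0P W f : Ck 0 W f <-> forall z, W z -> {for z, continuous f}.
Proof. by split=> [[]//|H]; split. Qed.

Lemma CkSP k W f : Ck k.+1 W f <-> (forall z, W z -> {for z, continuous f}) /\
  forall v, exists g, (forall z, W z -> is_dirderiv f v z (g z)) /\ Ck k W g.
Proof. exact: iff_refl. Qed.

Lemma Ck_cont k W f z : Ck k W f -> W z -> {for z, continuous f}.
Proof. by case: k => [|k] [H _]; exact: H. Qed.

Lemma Ck_sub k W W' f : W' `<=` W -> Ck k W f -> Ck k W' f.
Proof.
move=> sW; elim: k f => [|k IH] f.
  by move=> /Ck0P cf; apply/Ck0P => z /sW; exact: cf.
move=> /CkSP[cf df]; apply/CkSP; split=> [z /sW|v]; first exact: cf.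
by have [g [dg Hg]] := df v; exists g; split=> [z /sW|]; [exact: dg|exact: IH].
Qed.

Lemma CkW k W f : Ck k.+1 W f -> Ck k W f.
Proof.
elim: k f => [|k IH] f /CkSP[cf df]; first exact/Ck0P.
apply/CkSP; split=> [|v]; first exact: cf.
by have [g [dg Hg]] := df v; exists g; split; [exact: dg|exact: IH].
Qed.

Lemma Ck_congr k W f g : open W -> (forall y, W y -> f y = g y) -> Ck k W f -> Ck k W g.
Proof.
move=> oW fg.
have cong : (forall z, W z -> {for z, continuous f}) -> forall z, W z -> {for z, continuous g}.
  move=> cf z Wz; rewrite /prop_for /continuous_at -fg//.
  apply: (cvg_congr _ (cf z Wz : f @ z --> f z)).
  near=> y; apply: fg; near: y; exact: open_nbhs_nbhs.
case: k => [|k].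
  by move=> /Ck0P cf; apply/Ck0P; exact: cong.
move=> /CkSP[cf df]; apply/CkSP; split; first exact: cong.
move=> v; have [h [dh Hh]] := df v; exists h; split; last exact: Hh.
by move=> z Wz; exact: dirderiv_congr oW Wz fg (dh z Wz).
Unshelve. all: by end_near. Qed.

Lemma Ck_cst k W (c : Cx R) : Ck k W (fun=> c).
Proof.
elim: k c => [|k IH] c; first by apply/Ck0P => z _; exact: cst_continuous.
apply/CkSP; split=> [z _|v]; first exact: cst_continuous.
by exists (fun=> 0); split=> [z _|]; [exact: dirderiv_cst|exact: IH].
Qed.

Lemma cont_add (f g : V -> Cx R) z : {for z, continuous f} -> {for z, continuous g} ->
  {for z, continuous (fun y => f y + g y)}.
Proof. move=> cf cg; exact: cvgC_add cf cg. Qed.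

Lemma cont_mul (f g : V -> Cx R) z : {for z, continuous f} -> {for z, continuous g} ->
  {for z, continuous (fun y => f y * g y)}.
Proof. move=> cf cg; exact: cvgC_mul cf cg. Qed.

Lemma Ck_add k W f g : Ck k W f -> Ck k W g -> Ck k W (fun y => f y + g y).
Proof.
elim: k f g => [|k IH] f g.
  by move=> /Ck0P cf /Ck0P cg; apply/Ck0P => z Wz; apply: cont_add; [exact: cf|exact: cg].
move=> /CkSP[cf df] /CkSP[cg dg]; apply/CkSP; split=> [z Wz|v].
  by apply: cont_add; [exact: cf|exact: cg].
have [f' [df' Hf']] := df v; have [g' [dg' Hg']] := dg v.
exists (fun y => f' y + g' y); split; last exact: IH.
by move=> z Wz; apply: dirderiv_add; [exact: df'|exact: dg'].
Qed.

Lemma Ck_mul k W f g : Ck k W f -> Ck k W g -> Ck k W (fun y => f y * g y).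
Proof.
elim: k f g => [|k IH] f g.
  by move=> /Ck0P cf /Ck0P cg; apply/Ck0P => z Wz; apply: cont_mul; [exact: cf|exact: cg].
move=> Hf Hg; have /CkSP[cf df] := Hf; have /CkSP[cg dg] := Hg.
apply/CkSP; split=> [z Wz|v]; first by apply: cont_mul; [exact: cf|exact: cg].
have [f' [df' Hf']] := df v; have [g' [dg' Hg']] := dg v.
exists (fun y => f y * g' y + g y * f' y); split.
  by move=> z Wz; apply: dirderiv_mul; [exact: df'|exact: dg'].
by apply: Ck_add; apply: IH; [exact: CkW|exact: Hg'|exact: CkW|exact: Hf'].
Qed.

Lemma Ck_coord k W j : Ck k W (fun y => y 0 j).
Proof.
case: k => [|k]; first by apply/Ck0P => z _; exact: coord_continuous.
apply/CkSP; split=> [z _|v]; first exact: coord_continuous.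
by exists (fun=> v 0 j); split=> [z _|]; [exact: dirderiv_coord|exact: Ck_cst].
Qed.

(** The value is the default 0 wherever no derivative exists. *)
Definition dird f v : V -> Cx R := fun z => xget 0 [set l | is_dirderiv f v z l].

Lemma dirdE f v z l : is_dirderiv f v z l -> dird f v z = l.
Proof.
move=> H; rewrite /dird; case: xgetP => [m _ Hm|/(_ l)//].
exact: dirderiv_unique Hm H.
Qed.

Lemma Cinfty_dirderiv W f v z : Cinfty W f -> W z -> is_dirderiv f v z (dird f v z).
Proof.
move=> /(_ 1%N)[_ /(_ v)[g [dg _]]] Wz.
by rewrite (dirdE (dg z Wz)); exact: dg.
Qed.

Lemma Cinfty_dird W f v : open W -> Cinfty W f -> Cinfty W (dird f v).
Proof.
move=> oW Hf k; have [_ /(_ v)[g [dg Hg]]] := Hf k.+1.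
by apply: (Ck_congr oW _ Hg) => z Wz; rewrite (dirdE (dg z Wz)).
Qed.

Lemma Cinfty_cont W f z : Cinfty W f -> W z -> {for z, continuous f}.
Proof. by move=> /(_ 0%N); exact: Ck_cont. Qed.

Lemma dirdC W f v w z : open W -> Cinfty W f -> W z ->
  dird (dird f v) w z = dird (dird f w) v z.
Proof.
move=> oW Hf Wz.
have D u := Cinfty_dird u oW Hf.
apply: (dirderivC oW Wz (f := f) (v := v) (w := w) (gv := dird f v) (gw := dird f w)).
- by move=> y Wy; exact: Cinfty_dirderiv Hf Wy.
- by move=> y Wy; exact: Cinfty_dirderiv Hf Wy.
- by move=> y Wy; exact: Cinfty_dirderiv (D v) Wy.
- by move=> y Wy; exact: Cinfty_dirderiv (D w) Wy.
- exact: Cinfty_cont (Cinfty_dird _ oW (D v)) Wz.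
- exact: Cinfty_cont (Cinfty_dird _ oW (D w)) Wz.
Qed.

Lemma holomorphicP W f : open W -> Cinfty W f ->
  (forall z v, W z -> is_dirderiv f ('i *: v) z ('i * dird f v z)) -> holomorphic W f.
Proof. by move=> oW Hf CR; split=> [|z v l Wz H]; [exact: Hf|rewrite -(dirdE H); exact: CR]. Qed.

Lemma holomorphic_cst W (c : Cx R) : holomorphic W (fun=> c).
Proof.
split=> [k|z v l Wz]; first exact: Ck_cst.
move=> /(dirderiv_unique (dirderiv_cst c v z)) <-; rewrite mulr0.
exact: dirderiv_cst.
Qed.

Lemma holomorphic_coord W j : holomorphic W (fun y => y 0 j).
Proof.
split=> [k|z v l Wz]; first exact: Ck_coord.
move=> H; rewrite -(dirderiv_unique (@dirderiv_coord j v z) H).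
by have := @dirderiv_coord j ('i *: v) z; rewrite mxE.
Qed.

Lemma holomorphic_add W f g : holomorphic W f -> holomorphic W g ->
  holomorphic W (fun y => f y + g y).
Proof.
move=> [Hf CRf] [Hg CRg]; split=> [k|z v l Wz]; first exact: Ck_add.
have df := Cinfty_dirderiv (v := v) Hf Wz; have dg := Cinfty_dirderiv (v := v) Hg Wz.
move=> /(dirderiv_unique (dirderiv_add df dg)) <-; rewrite mulrDr.
by apply: dirderiv_add; [exact: CRf|exact: CRg].
Qed.

Lemma holomorphic_mul W f g : holomorphic W f -> holomorphic W g ->
  holomorphic W (fun y => f y * g y).
Proof.
move=> [Hf CRf] [Hg CRg]; split=> [k|z v l Wz]; first exact: Ck_mul.
have df := Cinfty_dirderiv (v := v) Hf Wz; have dg := Cinfty_dirderiv (v := v) Hg Wz.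
move=> /(dirderiv_unique (dirderiv_mul df dg)) <-.
have := dirderiv_mul (CRf _ _ _ Wz df) (CRg _ _ _ Wz dg).
by rewrite mulrDr 2!(mulrCA 'i).
Qed.

Lemma holomorphic_sub W W' f : W' `<=` W -> holomorphic W f -> holomorphic W' f.
Proof.
move=> sW [Hf CR]; split=> [k|z v l /sW]; first exact: Ck_sub sW (Hf k).
exact: CR.
Qed.

(** The Cauchy-Riemann equation for f holds on all of W and may be differentiated along v;
    exchanging the order of derivatives turns it into the equation for [dird f v]. *)
Lemma holomorphic_dird W f v : open W -> holomorphic W f -> holomorphic W (dird f v).
Proof.
move=> oW [Hf CR]; apply: (holomorphicP oW); first exact: Cinfty_dird.
move=> z w Wz.
have := Cinfty_dirderiv (v := 'i *: w) (Cinfty_dird v oW Hf) Wz.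
rewrite (@dirdC W f v ('i *: w) z oW Hf Wz) (@dirdC W f v w z oW Hf Wz).
have -> : dird (dird f ('i *: w)) v z = 'i * dird (dird f w) v z; last by [].
apply: dirdE; apply: (dirderiv_congr oW Wz (f := fun y => 'i * dird f w y)).
  by move=> y Wy; rewrite (dirdE (CR _ _ _ Wy (Cinfty_dirderiv (v := w) Hf Wy))).
have := dirderiv_mul (dirderiv_cst 'i v z) (Cinfty_dirderiv (v := v) (Cinfty_dird w oW Hf) Wz).
by rewrite mulr0 addr0.
Qed.

Lemma holomorphic_dirderivD W f v w z : open W -> holomorphic W f -> W z ->
  dird f (v + w) z = dird f v z + dird f w z.
Proof.
move=> oW [Hf _] Wz; apply: dirdE; apply: (dirderivD oW Wz).
- by move=> y Wy; exact: Cinfty_dirderiv Hf Wy.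
- exact: Cinfty_cont (Cinfty_dird v oW Hf) Wz.
- exact: Cinfty_dirderiv Hf Wz.
Qed.

(** Real multiples come from rescaling the parameter and the factor 'i from the Cauchy-Riemann
    equations; additivity joins the two parts of c. *)
Lemma holomorphic_dirderivZ W f (c : Cx R) v z : open W -> holomorphic W f -> W z ->
  dird f (c *: v) z = c * dird f v z.
Proof.
move=> oW hf Wz; have [Hf CR] := hf.
rewrite [c in LHS]reimE scalerDl (holomorphic_dirderivD _ _ oW hf Wz) -scalerA.
have d u : is_dirderiv f u z (dird f u z) := Cinfty_dirderiv Hf Wz.
have dZ a : is_dirderiv f (ofR a *: v) z (ofR a * dird f v z) := dirderivZ (a := a) (d v).
rewrite (dirdE (dZ (re c))) (dirdE (CR _ _ _ Wz (dZ (im c)))).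
by rewrite mulrA -mulrDl -reimE.
Qed.

Lemma holomorphic_dird_sum W f v z : open W -> holomorphic W f -> W z ->
  dird f v z = \sum_j v 0 j * dird f (delta_mx 0 j) z.
Proof.
move=> oW hf Wz; rewrite {1}[v]row_sum_delta.
elim/big_rec2: _ => [|j a u _ <-].
  by rewrite -(scale0r (0 : V)) (holomorphic_dirderivZ _ _ oW hf Wz) mul0r.
by rewrite (holomorphic_dirderivD _ _ oW hf Wz) (holomorphic_dirderivZ _ _ oW hf Wz).
Qed.

End SmoothFunctions.

(** * Hadamard's lemma *)

Section Hadamard.
Variables (R : realType) (n : nat).
Local Notation V := 'rV[Cx R]_n.
Variables (z0 : V) (B : set V).
Hypothesis oB : open B.
Hypothesis starB : forall z t, B z -> 0 <= t <= 1 -> B (z0 + ofR t *: (z - z0)).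
Implicit Types (h g : V -> Cx R) (z v : V).

Let p (t : R) z : V := z0 + ofR t *: (z - z0).

(* The exponent m makes the family stable under differentiation: each derivative of
   h (z0 + t (z - z0)) with respect to z produces a factor t. *)
Definition ray_int (m : nat) h : V -> Cx R :=
  fun z => cint (fun t => ofR (t ^+ m) * h (p t z)).

Lemma cvg_p (t : R) z : (fun tz : R * V => p tz.1 tz.2) @ (nbhs t, nbhs z) --> p t z.
Proof.
apply: cvgD; first exact: cvg_cst.
apply: cvgZ; first by apply: cvg_ofR; exact: cvg_fst.
by apply: cvgB; [exact: cvg_snd|exact: cvg_cst].
Qed.

Lemma cont_p z (t : R) : {for t, continuous (fun t => p t z)}.
Proof.
apply: cvgD; first exact: cvg_cst.
apply: cvgZ; last exact: cvg_cst.
by apply: cvg_ofR; exact: cvg_id.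
Qed.

Lemma ucont_ray m h z : (forall y, B y -> {for y, continuous h}) -> B z ->
  ucont (fun t => ofR (t ^+ m) * h (p t z)).
Proof.
move=> ch Bz t t01; apply: cvgC_mul.
  by apply: cvg_ofR; exact: exprn_continuous.
by apply: continuous_comp; [exact: cont_p|apply: ch; exact: starB].
Qed.

Lemma norm_expr_le (t : R) m (c : Cx R) : 0 <= t <= 1 -> `|ofR (t ^+ m) * c| <= `|c|.
Proof.
move=> /andP[t0 t1]; rewrite normrM normr_ofR -[leRHS]mul1r ler_wpM2r//.
by rewrite -ofR1 ofR_le ger0_norm ?exprn_ge0// exprn_ile1.
Qed.

(** Compactness of [0, 1], in the form of a near covering property, makes h(p t y) close to h(p t z)
    uniformly in t. *)
Lemma ray_int_cont m h z : (forall y, B y -> {for y, continuous h}) -> B z ->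
  {for z, continuous (ray_int m h)}.
Proof.
move=> ch Bz; have : ray_int m h @ z --> ray_int m h z; last by [].
apply/cvgrPdist_le => _ /gt0_ofR[e e0 ->].
have e20 : 0 < e / 2 by rewrite divr_gt0.
have e40 : 0 < e / 2 / 2 by rewrite divr_gt0.
have /compact_near_coveringP cov := @segment_compact R 0 1.
have : \forall y \near z, `[(0 : R), 1] `<=` (fun t => `|h (p t z) - h (p t y)| <= ofR (e / 2)).
  apply: (cov V (nbhs z) (fun y t => `|h (p t z) - h (p t y)| <= ofR (e / 2))).
  move=> t; rewrite /= in_itv /= => t01.
  have /cvgrPdist_le/(_ (ofR (e / 2 / 2))) := ch _ (starB Bz t01).
  rewrite ofR_lt => /(_ e40) Hn.
  have [[T Y] /= [tT zY] TY] := cvg_p Hn.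
  have tz : \forall t' \near t, `|h (p t z) - h (p t' z)| <= ofR (e / 2 / 2) := cont_p Hn.
  near=> t' y.
  rewrite /=; have Hz : `|h (p t z) - h (p t' z)| <= ofR (e / 2 / 2) by near: t'.
  have Tt : T t' by near: t'.
  have Yy : Y y by near: y.
  rewrite -(subrKA (h (p t z))) [e / 2]splitr ofRD.
  apply: le_trans (ler_normD _ _) _; apply: lerD; first by rewrite distrC.
  exact: (TY (t', y)).
apply: filter_app; near=> y => Hy; have By : B y by near: y; exact: open_nbhs_nbhs.
rewrite /ray_int [e]splitr; apply: le_cint_diff; try exact: ucont_ray.
move=> t t01; rewrite -mulrBr; apply: le_trans (norm_expr_le _ _ t01) _.
by apply: Hy; rewrite /= in_itv.
Unshelve. all: by end_near. Qed.

(** Differentiation under the integral sign: moving z by s v moves the point [p t z] by t s v, and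
    compactness makes the first order expansion of h uniform in t. *)
Lemma ray_int_dirderiv m h g v z :
  (forall y, B y -> {for y, continuous h}) ->
  (forall y, B y -> is_dirderiv h v y (g y)) ->
  (forall y, B y -> {for y, continuous g}) -> B z ->
  is_dirderiv (ray_int m h) v z (ray_int m.+1 g z).
Proof.
move=> ch dh cg Bz; apply/cvgrPdist_le => _ /gt0_ofR[e e0 ->].
have e20 : 0 < e / 2 by rewrite divr_gt0.
have e40 : 0 < e / 2 / 2 by rewrite divr_gt0.
have /compact_near_coveringP cov := @segment_compact R 0 1.
(* The error is kept proportional to t s, so that dividing by s leaves a bound independent of s. *)
pose P (s t : R) := `|h (p t z + ofR (t * s) *: v) - h (p t z) - ofR (t * s) * g (p t z)|
   <= ofR (e / 2 * `|t * s|).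
have H : \forall s \near (0 : R), `[(0 : R), 1] `<=` P s.
  apply: (cov R (nbhs (0 : R)) P) => t; rewrite /= in_itv /= => t01.
  have Bp := starB Bz t01.
  have := dirderiv_uniform oB Bp dh (cg _ Bp) e40.
  move=> [[A C] /= [A1 C1] AC].
  have /cvgrPdist_le/(_ (ofR (e / 2 / 2))) := cg _ Bp.
  rewrite ofR_lt => /(_ e40) Hn.
  have tA : \forall t' \near t, A (p t' z) := cont_p A1.
  have tg : \forall t' \near t, `|g (p t z) - g (p t' z)| <= ofR (e / 2 / 2) := cont_p Hn.
  have tsC : \forall t' \near t & s \near (0 : R), C (t' * s).
    have Hts : (fun ts : R * R => ts.1 * ts.2) @ (nbhs t, nbhs (0 : R)) --> t * 0.
      by apply: cvgM; [exact: cvg_fst|exact: cvg_snd].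
    by rewrite mulr0 in Hts; exact: Hts.
  have [[T S] /= [tT sS] TS] := tsC.
  near=> t' s.
  have Ap : A (p t' z) by near: t'.
  have Tt : T t' by near: t'.
  have Ss : S s by near: s.
  have Cts : C (t' * s) by exact: (TS (t', s)).
  have /= Hu := AC (_, _) (conj Ap Cts).
  have Hg : `|g (p t z) - g (p t' z)| <= ofR (e / 2 / 2) by near: t'.
  rewrite /P -(subrKA (ofR (t' * s) * g (p t z))) [e / 2]splitr mulrDl ofRD.
  apply: le_trans (ler_normD _ _) _; apply: lerD; first exact: Hu.
  rewrite -mulrBr normrM normr_ofR; rewrite mulrC (ofRM (e / 2 / 2)).
  by apply: ler_wpM2r; [rewrite ofR_ge0|exact: Hg].
have Hz : \forall s \near (0 : R)^', B (z + ofR s *: v) := cvg_line v (open_nbhs_nbhs (conj oB Bz)).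
have H' : \forall s \near (0 : R)^', `[(0 : R), 1] `<=` P s by exact: nbhs_dnbhs.
near=> s.
have s0 : s != 0 by near: s; exact: near_neq0.
have Bs : B (z + ofR s *: v) by near: s.
have Ps : `[(0 : R), 1] `<=` P s by near: s.
rewrite distrC -(ler_pM2l (x := `|ofR s|)); last by rewrite normr_gt0 ofR_eq0.
rewrite -normrM mulrBr mulVKf ?ofR_eq0// normr_ofR -ofRM [`|s| * e]mulrC [e]splitr mulrDl.
rewrite -addrA -opprD.
have c1 := ucont_ray (m := m) ch Bs.
have c2 := ucont_ray (m := m) ch Bz.
have c3 : ucont (fun t => ofR s * (ofR (t ^+ m.+1) * g (p t z))).
  by apply: ucontZ; exact: (ucont_ray (m := m.+1) cg Bz).
rewrite /ray_int -cintZ; last exact: ucont_ray.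
have := @le_cint_diff R _ _ (e / 2 * `|s|) c1 (@ucontD R _ _ c2 c3).
rewrite (@cintD R _ _ c2 c3); apply.
move=> t t01; have := Ps t; rewrite /= in_itv /= => /(_ t01); rewrite /P => Pt.
have -> : p t (z + ofR s *: v) = p t z + ofR (t * s) *: v.
  by rewrite /p addrAC scalerDr scalerA -ofRM addrA.
have -> : ofR (t ^+ m) * h (p t z + ofR (t * s) *: v) -
  (ofR (t ^+ m) * h (p t z) + ofR s * (ofR (t ^+ m.+1) * g (p t z))) =
  ofR (t ^+ m) * (h (p t z + ofR (t * s) *: v) - h (p t z) - ofR (t * s) * g (p t z)).
  rewrite opprD addrA !mulrBr; congr (_ - _).
  by rewrite exprSr !ofRM !mulrA (mulrC (ofR s)) -!mulrA (mulrCA (ofR s)).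
apply: le_trans (norm_expr_le _ _ t01) _; apply: le_trans Pt _.
move/andP: t01 => [t0 t1]; rewrite ofR_le; apply: ler_wpM2l; first exact: ltW.
by rewrite normrM (ger0_norm t0) -[leRHS]mul1r ler_wpM2r.
Unshelve. all: by end_near. Qed.

Lemma ray_int_Ck k m h : Ck k B h -> Ck k B (ray_int m h).
Proof.
elim: k m h => [|k IH] m h.
  by move=> /Ck0P ch; apply/Ck0P => z; exact: ray_int_cont.
move=> /CkSP[ch dh]; apply/CkSP; split=> [z|v]; first exact: ray_int_cont.
have [g [dg Hg]] := dh v; exists (ray_int m.+1 g); split; last exact: IH.
move=> z; apply: ray_int_dirderiv; [exact: ch|exact: dg|].
by move=> y; exact: Ck_cont Hg.
Qed.

Lemma ray_int_holomorphic m h : holomorphic B h -> holomorphic B (ray_int m h).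
Proof.
move=> hol_h; have [Hh CR] := hol_h.
have ch y : B y -> {for y, continuous h} by exact: Cinfty_cont.
have dI v z : B z -> is_dirderiv (ray_int m h) v z (ray_int m.+1 (dird h v) z).
  apply: ray_int_dirderiv; first exact: ch.
    by move=> y By; exact: Cinfty_dirderiv Hh By.
  by move=> y By; exact: Cinfty_cont (Cinfty_dird v oB Hh) By.
apply: (holomorphicP oB) => [k|z v Bz]; first exact: ray_int_Ck.
rewrite (dirdE (dI v z Bz)).
have -> : 'i * ray_int m.+1 (dird h v) z = ray_int m.+1 (dird h ('i *: v)) z; last exact: dI.
rewrite /ray_int -cintZ; last first.
  by apply: ucont_ray Bz => y By; exact: Cinfty_cont (Cinfty_dird v oB Hh) By.
apply: eq_cint => t t01; rewrite mulrCA; congr (_ * _).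
have Bp := starB Bz t01.
by rewrite (dirdE (CR _ _ _ Bp (Cinfty_dirderiv (v := v) Hh Bp))).
Qed.

(** This is the fundamental theorem of calculus along the ray from z0 to z, with the speed z - z0
    expanded in the standard basis. *)
Lemma ray_decomposition F z : holomorphic B F -> B z0 -> B z ->
  F z = F z0 + \sum_j (z 0 j - z0 0 j) * ray_int 0 (dird F (delta_mx 0 j)) z.
Proof.
move=> hF Bz0 Bz; have [HF _] := hF.
have cD j y : B y -> {for y, continuous (dird F (delta_mx 0 j))}.
  by move=> By; exact: Cinfty_cont (Cinfty_dird _ oB HF) By.
pose f t := \sum_j (z - z0) 0 j * (ofR (t ^+ 0) * dird F (delta_mx 0 j) (p t z)).
have cf j : ucont (fun t => (z - z0) 0 j * (ofR (t ^+ 0) * dird F (delta_mx 0 j) (p t z))).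
  by apply: ucontZ; exact: (ucont_ray (m := 0) (cD j) Bz).
have -> : \sum_j (z 0 j - z0 0 j) * ray_int 0 (dird F (delta_mx 0 j)) z = cint f.
  rewrite /f (@cint_sum R _ _ _ cf); apply: eq_bigr => j _; rewrite (@cintZ R _ _ (ucont_ray (m := 0) (cD j) Bz)) !mxE.
  exact: erefl.
have -> : cint f = F (p 1 z) - F (p 0 z).
  apply: (@cint_ftc _ (fun t => F (p t z))); last first.
    exact: (@ucont_sum R _ _ _ cf).
  move=> t t01; have Bp := starB Bz t01; apply: dirderiv_path.
  have -> : f t = dird F (z - z0) (p t z); last exact: Cinfty_dirderiv HF Bp.
  rewrite (holomorphic_dird_sum _ oB hF Bp); apply: eq_bigr => j _.
  by rewrite expr0 ofR1 mul1r.
by rewrite /p ofR1 ofR0 scale0r scale1r addr0 addrCA subrr addr0 addrCA subrr addr0.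
Qed.

Lemma ray_int_center h : ray_int 0 h z0 = h z0.
Proof.
rewrite /ray_int -[RHS]cint_cst; apply: eq_cint => t _.
by rewrite expr0 ofR1 mul1r /p subrr scaler0 addr0.
Qed.

End Hadamard.

(** A ball serves as a neighbourhood that is star-shaped about z0. The value of [G j] at z0 is
    recorded because it is all that a derivation at z0 sees of [G j]. *)
Lemma hadamard (R : realType) n (W : set 'rV[Cx R]_n) F z0 :
  open W -> W z0 -> holomorphic W F ->
  exists (B : set 'rV[Cx R]_n) (G : 'I_n -> 'rV[Cx R]_n -> Cx R),
    [/\ open B, B z0, forall j, holomorphic B (G j) /\ G j z0 = dird F (delta_mx 0 j) z0 &
      forall z, B z -> F z = F z0 + \sum_j (z 0 j - z0 0 j) * G j z].
Proof.
move=> oW Wz0 hF.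
have /nbhs_ballP[e /= e0 BW] : nbhs z0 W by exact: open_nbhs_nbhs.
have oB : open (ball z0 e) by exact: ball_open.
have Bz0 : ball z0 e z0 by exact: ballxx.
have star z t : ball z0 e z -> 0 <= t <= 1 -> ball z0 e (z0 + ofR t *: (z - z0)).
  rewrite -ball_normE /= => Bz /andP[t0 t1].
  rewrite opprD addrA subrr add0r normrN normrZ normr_ofR distrC.
  apply: le_lt_trans Bz; rewrite -[leRHS]mul1r ler_wpM2r// -ofR1 ofR_le.
  by rewrite ger0_norm.
have hFB := holomorphic_sub BW hF.
exists (ball z0 e), (fun j => ray_int z0 0 (dird F (delta_mx 0 j))); split; [exact: oB|exact: Bz0| |].
  move=> j; split; last exact: ray_int_center.
  by apply: (ray_int_holomorphic oB star); exact: holomorphic_dird.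
by move=> z Bz; exact: (ray_decomposition oB star).
Qed.

(** * Germs of holomorphic functions and tangent frames *)

Section Charts.
Variables (R : realType) (X : complexSpace R).
Implicit Types (x y : X) (f g h : X -> Cx R).

Section OneChart.
Variables (U : set X) (n : nat) (A : set 'rV[Cx R]_n) (phi : X -> 'rV[Cx R]_n).
Hypothesis chart : local_chart (@hol_at R X) U A phi.

Lemma chart_nbhs x W : U x -> open W -> W (phi x) -> \forall y \near x, U y /\ W (phi y).
Proof.
move=> Ux oW Wx; have [oU _ top _] := chart.
have oV : open (U `&` phi @^-1` W).
  by apply/(top _ (@subIsetl _ _ _)); exists W.
by apply: (open_nbhs_nbhs (conj oV _)); split.
Qed.

Lemma chart_holP x f : U x ->
  hol_at x f <-> exists W F, [/\ open W, W (phi x), holomorphic W F &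
           \forall y \near x, f y = F (phi y)].
Proof. by have [_ _ _ H] := chart; exact: H. Qed.

Lemma chart_hol x f W F : U x -> open W -> W (phi x) -> holomorphic W F ->
  (\forall y \near x, f y = F (phi y)) -> hol_at x f.
Proof. by move=> Ux oW Wx hF fF; apply/(chart_holP _ Ux); exists W, F; split. Qed.

Lemma chart_hol_near x f : U x -> hol_at x f -> \forall y \near x, hol_at y f.
Proof.
move=> Ux /(chart_holP _ Ux)[W [F [oW Wx hF fF]]].
have nU := chart_nbhs Ux oW Wx.
have nn : \forall y \near x, \forall z \near y, f z = F (phi z) by exact: near_join.
near=> y.
have [Uy Wy] : U y /\ W (phi y) by near: y.
by apply/(chart_holP _ Uy); exists W, F; split => //; near: y.
Unshelve. all: by end_near. Qed.

Lemma chart_hol_cst x c : U x -> hol_at x (fun=> c).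
Proof.
move=> Ux; apply: (@chart_hol x _ setT (fun=> c) Ux); first exact: openT.
- by [].
- exact: holomorphic_cst.
- exact: nearW.
Qed.

Lemma chart_hol_add x f g : U x -> hol_at x f -> hol_at x g -> hol_at x (fun y => f y + g y).
Proof.
move=> Ux /(chart_holP _ Ux)[W [F [oW Wx hF fF]]] /(chart_holP _ Ux)[W' [G [oW' Wx' hG gG]]].
have hFG : holomorphic (W `&` W') (fun z => F z + G z).
  by apply: holomorphic_add; [apply: holomorphic_sub hF => ? []|apply: holomorphic_sub hG => ? []].
apply: (@chart_hol x _ (W `&` W') _ Ux _ _ hFG); first exact: openI.
  by split.
by apply: filterS2 fF gG => y -> ->.
Qed.

Lemma chart_hol_mul x f g : U x -> hol_at x f -> hol_at x g -> hol_at x (fun y => f y * g y).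
Proof.
move=> Ux /(chart_holP _ Ux)[W [F [oW Wx hF fF]]] /(chart_holP _ Ux)[W' [G [oW' Wx' hG gG]]].
have hFG : holomorphic (W `&` W') (fun z => F z * G z).
  by apply: holomorphic_mul; [apply: holomorphic_sub hF => ? []|apply: holomorphic_sub hG => ? []].
apply: (@chart_hol x _ (W `&` W') _ Ux _ _ hFG); first exact: openI.
  by split.
by apply: filterS2 fF gG => y -> ->.
Qed.

Lemma chart_hol_eq x f g : U x -> (\forall y \near x, f y = g y) -> hol_at x f -> hol_at x g.
Proof.
move=> Ux fg /(chart_holP _ Ux)[W [F [oW Wx hF fF]]].
apply: (@chart_hol x _ W F Ux oW Wx hF).
by apply: filterS2 fg fF => y <-.
Qed.

Lemma chart_phi_cont x : U x -> {for x, continuous phi}.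
Proof.
move=> Ux B /= Bx; have := chart_nbhs Ux (open_interior B) (nbhs_singleton (nbhs_interior Bx)).
by apply: filterS => y [_ /interior_subset].
Qed.

Lemma chart_hol_cont x f : U x -> hol_at x f -> {for x, continuous f}.
Proof.
move=> Ux /(chart_holP _ Ux)[W [F [oW Wx hF fF]]].
have cF : {for phi x, continuous F} by have [H _] := hF; exact: Cinfty_cont H Wx.
have : (F \o phi) @ x --> F (phi x) by apply: continuous_comp cF; exact: chart_phi_cont.
rewrite -(nbhs_singleton fF); apply: cvg_congr.
by apply: filterS fF => y ->.
Qed.

Lemma chart_hol_phi x j : U x -> hol_at x (fun y => phi y 0 j).
Proof.
move=> Ux; apply: (@chart_hol x _ setT (fun z => z 0 j) Ux); first exact: openT.
- by [].
- exact: holomorphic_coord.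
- exact: nearW.
Qed.

Lemma chart_hol_comp x F W : U x -> open W -> W (phi x) -> holomorphic W F ->
  hol_at x (fun y => F (phi y)).
Proof. by move=> Ux oW Wx hF; apply: (chart_hol Ux oW Wx hF); exact: nearW. Qed.

Hypothesis oA : open A.

(** Here openness of A matters: every point near [phi x] is the image of a point near x, so the germ
    of a function on X determines its holomorphic representative on C^n. At a singular point it does
    not. *)
Lemma chart_lift x (P : set X) : U x -> (\forall y \near x, P y) ->
  \forall z \near phi x, exists y, [/\ U y, P y & phi y = z].
Proof.
move=> Ux Px; have [oU [fA _ surj] top _] := chart.
have oV : open (U `&` interior P) by apply: openI => //; exact: open_interior.
have /(top _ (@subIsetl _ _ _))[W oW VW] := oV.
have Wx : W (phi x).
  have : (U `&` interior P) x by split => //; exact: nbhs_interior.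
  by rewrite VW => -[].
have Ax : A (phi x) by exact: fA.
near=> z.
have Wz : W z by near: z; exact: open_nbhs_nbhs.
have : A z by near: z; exact: open_nbhs_nbhs.
move=> /surj[y Uy yz]; exists y; split=> //.
have : (U `&` phi @^-1` W) y by split => //=; rewrite yz.
by rewrite -VW => -[_ /interior_subset].
Unshelve. all: by end_near. Qed.

(** The derivative is that of any local representative F; as A is open, they all give the same
    value. Non-holomorphic germs get 0. *)
Definition chart_der (v : 'rV[Cx R]_n) x f : Cx R :=
  xget 0 [set l | exists W F, [/\ open W, W (phi x), holomorphic W F,
           \forall y \near x, f y = F (phi y) & l = dird F v (phi x)]].

Lemma chart_derE v x f W F : U x -> open W -> W (phi x) -> holomorphic W F ->
  (\forall y \near x, f y = F (phi y)) -> chart_der v x f = dird F v (phi x).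
Proof.
move=> Ux oW Wx hF fF; rewrite /chart_der; case: xgetP => [l _|]; last first.
  by move=> /(_ (dird F v (phi x)))[]; exists W, F.
move=> [W' [F' [oW' Wx' hF' fF' ->]]]; symmetry; apply: dirdE.
have FF' : \forall z \near phi x, F' z = F z.
  have : \forall y \near x, F' (phi y) = F (phi y) by apply: filterS2 fF fF' => y -> ->.
  move=> /(chart_lift Ux); apply: filterS => z [y [_ e <-]]; exact: e.
have oI : open (interior [set z | F' z = F z]) by exact: open_interior.
apply: (dirderiv_congr oI (f := F')).
- exact: (nbhs_singleton (nbhs_interior FF')).
- by move=> z /interior_subset.
by have [H _] := hF'; exact: Cinfty_dirderiv H Wx'.
Qed.

Lemma chart_der_derivation v x : U x -> derivation x (chart_der v x).
Proof.
move=> Ux; split.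
- move=> f g hf hg fg; have /(chart_holP _ Ux)[W [F [oW Wx hF fF]]] := hf.
  rewrite (chart_derE v Ux oW Wx hF fF) (chart_derE v Ux oW Wx hF)//.
  by apply: filterS2 fg fF => y ->.
- move=> c f g /(chart_holP _ Ux)[W [F [oW Wx hF fF]]] /(chart_holP _ Ux)[W' [G [oW' Wx' hG gG]]].
  have oI := openI oW oW'; have Ix : (W `&` W') (phi x) by [].
  have hFI : holomorphic (W `&` W') F by apply: holomorphic_sub hF => ? [].
  have hGI : holomorphic (W `&` W') G by apply: holomorphic_sub hG => ? [].
  rewrite (chart_derE v Ux oI Ix hFI fF) (chart_derE v Ux oI Ix hGI gG).
  have hcF : holomorphic (W `&` W') (fun u => c * F u).
    by apply: holomorphic_mul hFI; exact: holomorphic_cst.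
  rewrite (chart_derE v Ux oI Ix (holomorphic_add hcF hGI)); last first.
    by apply: filterS2 fF gG => y -> ->.
  have dF := Cinfty_dirderiv (v := v) hFI.1 Ix.
  have dG := Cinfty_dirderiv (v := v) hGI.1 Ix.
  apply: dirdE; apply: dirderiv_add dG.
  have dc : is_dirderiv (fun=> c) v (phi x) 0 by exact: dirderiv_cst.
  by have := dirderiv_mul dc dF; rewrite mulr0 addr0.
- move=> f g /(chart_holP _ Ux)[W [F [oW Wx hF fF]]] /(chart_holP _ Ux)[W' [G [oW' Wx' hG gG]]].
  have oI := openI oW oW'; have Ix : (W `&` W') (phi x) by [].
  have hFI : holomorphic (W `&` W') F by apply: holomorphic_sub hF => ? [].
  have hGI : holomorphic (W `&` W') G by apply: holomorphic_sub hG => ? [].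
  rewrite (chart_derE v Ux oI Ix hFI fF) (chart_derE v Ux oI Ix hGI gG).
  rewrite (chart_derE v Ux oI Ix (holomorphic_mul hFI hGI)); last first.
    by apply: filterS2 fF gG => y -> ->.
  have dF := Cinfty_dirderiv (v := v) hFI.1 Ix.
  have dG := Cinfty_dirderiv (v := v) hGI.1 Ix.
  rewrite (nbhs_singleton fF) (nbhs_singleton gG).
  by apply: dirdE; exact: dirderiv_mul dF dG.
Qed.

Lemma chart_der_near v x f W F : U x -> open W -> W (phi x) -> holomorphic W F ->
  (\forall y \near x, f y = F (phi y)) ->
  \forall y \near x, chart_der v y f = dird F v (phi y).
Proof.
move=> Ux oW Wx hF fF; have nU := chart_nbhs Ux oW Wx.
have nn : \forall y \near x, \forall z \near y, f z = F (phi z) by exact: near_join.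
near=> y.
have [Uy Wy] : U y /\ W (phi y) by near: y.
by apply: (chart_derE v Uy oW Wy hF); near: y.
Unshelve. all: by end_near. Qed.

Lemma chart_der_hol v x f : U x -> hol_at x f -> hol_at x (fun y => chart_der v y f).
Proof.
move=> Ux /(chart_holP _ Ux)[W [F [oW Wx hF fF]]].
apply: (@chart_hol x _ W (dird F v) Ux oW Wx); first exact: holomorphic_dird.
exact: chart_der_near oW Wx hF fF.
Qed.

Lemma chart_derC v w x f : U x -> hol_at x f ->
  chart_der v x (fun y => chart_der w y f) = chart_der w x (fun y => chart_der v y f).
Proof.
move=> Ux /(chart_holP _ Ux)[W [F [oW Wx hF fF]]].
rewrite (chart_derE v Ux oW Wx (holomorphic_dird w oW hF)); last exact: chart_der_near oW Wx hF fF.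
rewrite (chart_derE w Ux oW Wx (holomorphic_dird v oW hF)); last exact: chart_der_near oW Wx hF fF.
have [H _] := hF; exact: dirdC oW H Wx.
Qed.

End OneChart.

Lemma hol_near x f : hol_at x f -> \forall y \near x, hol_at y f.
Proof. by have [U [n [W [A [phi [Ux _ _ c]]]]]] := local_models x; exact: chart_hol_near c _ _ Ux. Qed.
Lemma hol_cst x c : hol_at x (fun _ : X => c).
Proof. by have [U [n [W [A [phi [Ux _ _ ch]]]]]] := local_models x; exact: chart_hol_cst ch _ c Ux. Qed.
Lemma hol_add x f g : hol_at x f -> hol_at x g -> hol_at x (fun y => f y + g y).
Proof. by have [U [n [W [A [phi [Ux _ _ ch]]]]]] := local_models x; exact: chart_hol_add ch _ _ _ Ux. Qed.
Lemma hol_mul x f g : hol_at x f -> hol_at x g -> hol_at x (fun y => f y * g y).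
Proof. by have [U [n [W [A [phi [Ux _ _ ch]]]]]] := local_models x; exact: chart_hol_mul ch _ _ _ Ux. Qed.
Lemma hol_eq x f g : (\forall y \near x, f y = g y) -> hol_at x f -> hol_at x g.
Proof. by have [U [n [W [A [phi [Ux _ _ ch]]]]]] := local_models x; exact: chart_hol_eq ch _ _ _ Ux. Qed.
Lemma hol_cont x f : hol_at x f -> {for x, continuous f}.
Proof. by have [U [n [W [A [phi [Ux _ _ ch]]]]]] := local_models x; exact: chart_hol_cont ch _ _ Ux. Qed.
Lemma hol_sum x (I : Type) (r : seq I) (F : I -> X -> Cx R) : (forall i, hol_at x (F i)) ->
  hol_at x (fun y => \sum_(i <- r) F i y).
Proof.
move=> hF; elim: r => [|i r IH].
  by apply: (hol_eq _ (hol_cst x 0)); apply: nearW => y; rewrite big_nil.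
by apply: (hol_eq _ (hol_add (hF i) IH)); apply: nearW => y; rewrite big_cons.
Qed.

Section Derivations.
Variables (x : X) (D : (X -> Cx R) -> Cx R).
Hypothesis hD : derivation x D.

Lemma derivation_congr f g : hol_at x f -> (\forall y \near x, f y = g y) -> D f = D g.
Proof. by move=> hf fg; have [H _ _] := hD; apply: H => //; exact: hol_eq fg hf. Qed.

Lemma derivation_add f g : hol_at x f -> hol_at x g -> D (fun y => f y + g y) = D f + D g.
Proof.
move=> hf hg; have [_ H _] := hD; rewrite -[D f]mul1r -H//.
by congr D; apply/funext => y; rewrite mul1r.
Qed.

Lemma derivation_mul f g : hol_at x f -> hol_at x g ->
  D (fun y => f y * g y) = f x * D g + g x * D f.
Proof. by have [_ _ H] := hD; exact: H. Qed.

Lemma derivation_cst c : D (fun=> c) = 0.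
Proof.
have [_ HL HM] := hD.
have D1 : D (fun=> 1) = 0.
  have := HM _ _ (hol_cst x 1) (hol_cst x 1); rewrite !mul1r => /eqP.
  by rewrite -subr_eq0 opprD addrA subrr add0r oppr_eq0 => /eqP.
have D0 : D (fun=> 0) = 0.
  have := HM _ _ (hol_cst x 0) (hol_cst x 0); rewrite !mul0r addr0; apply.
have := HL c _ _ (hol_cst x 1) (hol_cst x 0); rewrite D1 D0 mulr0 addr0.
move=> H; transitivity (D (fun=> c * 1)); first by rewrite mulr1.
by rewrite H addr0.
Qed.

Lemma derivation_scale c f : hol_at x f -> D (fun y => c * f y) = c * D f.
Proof.
by move=> hf; rewrite derivation_mul ?derivation_cst ?mulr0 ?addr0//; exact: hol_cst.
Qed.

Lemma derivation_sum (I : Type) (r : seq I) (F : I -> X -> Cx R) :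
  (forall i, hol_at x (F i)) -> D (fun y => \sum_(i <- r) F i y) = \sum_(i <- r) D (F i).
Proof.
move=> hF; elim: r => [|i r IH].
  rewrite big_nil -[RHS](derivation_cst 0); congr D; apply/funext => y.
  by rewrite big_nil.
rewrite big_cons -IH -derivation_add; [|exact: hF|exact: hol_sum].
by congr D; apply/funext => y; rewrite big_cons.
Qed.

End Derivations.

(* By Hadamard's lemma, a derivation is determined by its values on the coordinates. *)
Lemma chart_derivation U n A (phi : X -> 'rV[Cx R]_n) x D :
  local_chart (@hol_at R X) U A phi -> open A -> U x -> derivation x D ->
  exists v, forall f, hol_at x f -> D f = chart_der phi v x f.
Proof.
move=> ch oA Ux hD; exists (\row_j D (fun y => phi y 0 j)) => f hf.
have /(chart_holP ch _ Ux)[W [F [oW Wx hF fF]]] := hf.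
rewrite (chart_derE ch oA _ Ux oW Wx hF fF).
have [B [G [oB Bx hG FG]]] := hadamard oW Wx hF.
have hGj j : hol_at x (fun y => G j (phi y)).
  exact: (chart_hol_comp ch Ux oB Bx (hG j).1).
have hphi j : hol_at x (fun y => phi y 0 j + - phi x 0 j).
  by apply: hol_add; [exact: chart_hol_phi ch _ j Ux|exact: hol_cst].
have fE : \forall y \near x,
    f y = F (phi x) + \sum_j (phi y 0 j + - phi x 0 j) * G j (phi y).
  have := chart_nbhs ch Ux oB Bx; apply: filterS2 fF => y -> [_ By].
  exact: FG.
rewrite (derivation_congr hD hf fE) (derivation_add hD); first last.
  by apply: hol_sum => j; apply: hol_mul.
  exact: hol_cst.
rewrite (derivation_cst hD) add0r (derivation_sum hD); last by move=> j; apply: hol_mul.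
rewrite (holomorphic_dird_sum _ oW hF Wx); apply: eq_bigr => j _.
(* The centred coordinate vanishes at x, so the Leibniz rule leaves only the value of [G j] times
   the derivative of the coordinate. *)
rewrite (derivation_mul hD)// subrr mul0r add0r mxE -(hG j).2 mulrC; congr (_ * _).
rewrite (derivation_add hD) ?(derivation_cst hD) ?addr0//; last exact: hol_cst.
exact: chart_hol_phi ch _ j Ux.
Qed.

Lemma manifold_chart_reg x d U (phi : X -> 'rV[Cx R]_d) :
  manifold_chart x U phi -> U `<=` reg X.
Proof. by move=> [Ux [A oA ch]] y Uy; exists d, U, phi; split => //; exists A. Qed.

Lemma open_reg : open (reg X).
Proof.
rewrite openE => x [d [U [phi mc]]]; have [Ux [A oA [oU _ _ _]]] := mc.
apply: (filterS (manifold_chart_reg mc)); exact: open_nbhs_nbhs.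
Qed.

(** This is the interface to charts used for the exterior derivative: commuting fields of
    derivations that preserve holomorphy and exhaust the derivations at each point. The index type V
    hides the dimension and the coordinates. *)
Lemma regular_frame x : reg X x -> exists (V : Type) (U : set X)
    (d : V -> X -> (X -> Cx R) -> Cx R),
  [/\ open U, U x, U `<=` reg X & forall y, U y ->
    [/\ forall v, derivation y (d v y),
        forall v f, hol_at y f -> hol_at y (fun z => d v z f),
        forall v w f, hol_at y f -> d v y (fun z => d w z f) = d w y (fun z => d v z f) &
        forall D, derivation y D -> exists v, forall f, hol_at y f -> D f = d v y f]].
Proof.
move=> [n [U [phi mc]]]; have [Ux [A oA ch]] := mc.
exists 'rV[Cx R]_n, U, (chart_der phi); split.
- by have [] := ch.
- exact: Ux.
- exact: manifold_chart_reg mc.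
move=> y Uy; split.
- by move=> v; exact: chart_der_derivation ch oA v _ Uy.
- by move=> v f; exact: chart_der_hol ch oA v _ _ Uy.
- by move=> v w f; exact: chart_derC ch oA _ _ _ _ Uy.
- by move=> D; exact: chart_derivation ch oA Uy.
Qed.

Lemma smooth_hol y f : reg X y -> hol_at y f -> smooth_at y f.
Proof.
move=> [n [U [phi mc]]]; have [Uy [A oA ch]] := mc.
move=> /(chart_holP ch _ Uy)[W [F [oW Wx [hF _] fF]]].
by exists n, U, phi, W, F; split.
Qed.

Lemma smooth_hol_mul y f g : hol_at y f -> smooth_at y g -> smooth_at y (fun z => f z * g z).
Proof.
move=> hf [n [U [phi [W [psi [mc oW Wy Cpsi gpsi]]]]]]; have [Uy [A oA ch]] := mc.
have /(chart_holP ch _ Uy)[W' [F [oW' Wx [hF _] fF]]] := hf.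
exists n, U, phi, (W' `&` W), (fun u => F u * psi u); split.
- exact: mc.
- exact: openI.
- by split.
- move=> k; apply: Ck_mul.
    by apply: Ck_sub (hF k) => ? [].
  by apply: Ck_sub (Cpsi k) => ? [].
- by apply: filterS2 fF gpsi => u -> ->.
Qed.

End Charts.

Lemma mulr_shuffle4 (K : comNzRingType) (c u a w b : K) :
  c * (u * a) * (w * b) = u * w * (c * a * b).
Proof. by ring. Qed.

Lemma mulr_shuffle3 (K : comNzRingType) (p c a b : K) : p * (c * a) * b = c * (p * a * b).
Proof. by ring. Qed.

Lemma mulr_shuffle_head (K : comNzRingType) (c p a b : K) : c * (p * a) * b = p * (c * a) * b.
Proof. by ring. Qed.

(** * Permutations and determinants *)

Section Determinants.
Variable K : comNzRingType.

Lemma det_colE n (M : 'M[K]_n) :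
  \det M = \sum_(p : 'S_n) (-1) ^+ p * \prod_j M (p j) j.
Proof.
rewrite -det_tr; apply: eq_bigr => p _; congr (_ * _).
by apply: eq_bigr => j _; rewrite mxE.
Qed.

Definition block_perm_fun r s (p : 'S_r) (q : 'S_s) (k : 'I_(r + s)) : 'I_(r + s) :=
  unsplit (match fintype.split k with inl i => inl (p i) | inr j => inr (q j) end).

Lemma block_perm_inj r s (p : 'S_r) (q : 'S_s) : injective (block_perm_fun p q).
Proof.
move=> k l /(can_inj (@unsplitK r s)).
case: (splitP k) => [i ki|i ki]; case: (splitP l) => [j lj|j lj] // [] /perm_inj ij;
  by apply: val_inj; rewrite /= ki lj ij.
Qed.

Definition block_perm r s (p : 'S_r) (q : 'S_s) : 'S_(r + s) := perm (@block_perm_inj r s p q).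

Lemma block_perm_lshift r s (p : 'S_r) (q : 'S_s) i : block_perm p q (lshift s i) = lshift s (p i).
Proof. by rewrite permE /block_perm_fun -[lshift s i]/(unsplit (inl i)) unsplitK. Qed.

Lemma block_perm_rshift r s (p : 'S_r) (q : 'S_s) i : block_perm p q (rshift r i) = rshift r (q i).
Proof. by rewrite permE /block_perm_fun -[rshift r i]/(unsplit (inr i)) unsplitK. Qed.

(** The sign is the determinant of a permutation matrix, which is block diagonal here. *)
Lemma block_perm_sign r s (p : 'S_r) (q : 'S_s) :
  (-1) ^+ block_perm p q = (-1) ^+ p * (-1) ^+ q :> K.
Proof.
rewrite -!det_perm -(det_ublock _ (0 : 'M[K]_(r, s)) _); congr (\det _).
apply/matrixP => k l; rewrite -[k]splitK -[l]splitK.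
case: (fintype.split k) => i; case: (fintype.split l) => j; rewrite /= !(block_mxEul, block_mxEur, block_mxEdl, block_mxEdr) !mxE.
- by rewrite block_perm_lshift (inj_eq (@lshift_inj _ _)).
- by rewrite block_perm_lshift; case: eqP => // /eqP; rewrite eq_lrshift.
- by rewrite block_perm_rshift; case: eqP => // /eqP; rewrite eq_rlshift.
- by rewrite block_perm_rshift (inj_eq (@rshift_inj _ _)).
Qed.

(** This is the Laplace expansion along the first r columns, summed over all permutations instead of
    shuffles. Expanding the two minors multiplies p by an element of S_r x S_s, which reindexing
    absorbs; hence the factor r! s!, the one that [wedge] divides by. *)
Lemma shuffle_det r s (M : 'M[K]_(r + s)) :
  \sum_(p : 'S_(r + s)) (-1) ^+ p
    * \det (\matrix_(i < r, j < r) M (p (lshift s i)) (lshift s j))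
    * \det (\matrix_(i < s, j < s) M (p (rshift r i)) (rshift r j))
  = (r`! * s`!)%:R * \det M.
Proof.
transitivity (\sum_(p : 'S_(r + s)) \sum_(a : 'S_r) \sum_(b : 'S_s)
   (-1) ^+ (block_perm a b * p)%g * \prod_k M ((block_perm a b * p)%g k) k).
  apply: eq_bigr => p _; rewrite !det_colE -mulrA big_distrlr /= mulr_sumr.
  apply: eq_bigr => a _; rewrite mulr_sumr; apply: eq_bigr => b _.
  rewrite odd_permM signr_addb block_perm_sign big_split_ord /=.
  rewrite (_ : \prod_i _ = \prod_j M (p (lshift s (a j))) (lshift s j)); last first.
    by apply: eq_bigr => j _; rewrite mxE.
  rewrite (_ : \prod_j (\matrix_(_, _) _) _ _ = \prod_j M (p (rshift r (b j))) (rshift r j)); last first.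
    by apply: eq_bigr => j _; rewrite mxE.
  rewrite (_ : \prod_(i < r) M ((block_perm a b * p)%g _) _ = \prod_j M (p (lshift s (a j))) (lshift s j)); last first.
    by apply: eq_bigr => j _; rewrite permM block_perm_lshift.
  rewrite (_ : \prod_(i < s) M ((block_perm a b * p)%g _) _ = \prod_j M (p (rshift r (b j))) (rshift r j)); last first.
    by apply: eq_bigr => j _; rewrite permM block_perm_rshift.
  set P1 := \prod_j _; set P2 := \prod_j _.
  by rewrite [_ * (-1) ^+ p]mulrC -!mulrA; congr (_ * (_ * _)); rewrite mulrCA.
rewrite exchange_big /=.
transitivity (\sum_(a : 'S_r) \sum_(b : 'S_s) \det M).
  apply: eq_bigr => a _; rewrite exchange_big /=; apply: eq_bigr => b _.
  by rewrite det_colE [RHS](reindex_inj (mulgI (block_perm a b))).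
by rewrite !sumr_const !card_Sn -mulrnA mulr_natl mulnC.
Qed.

Lemma det_col_perm n (M : 'M[K]_n) (s : 'S_n) :
  \det (\matrix_(i, j) M i (s j)) = (-1) ^+ s * \det M.
Proof.
have -> : \matrix_(i, j) M i (s j) = col_perm s M by apply/matrixP => i j; rewrite !mxE.
by rewrite col_permE det_mulmx det_perm odd_permV mulrC.
Qed.

End Determinants.

Section Cycle.
Local Open Scope nat_scope.

(** The cycle that brings position r to the front and shifts the positions before it by one: it
    rearranges g ++ f :: h into f :: g ++ h when g has size r. *)
Definition cycle_nat (r k : nat) : nat := if k < r then k.+1 else if k == r then 0 else k.

Lemma cycle_ord_subproof q r (k : 'I_q.+1) : (r <= q)%N -> (cycle_nat r k < q.+1)%N.
Proof. move=> rq; have := ltn_ord k; rewrite /cycle_nat; case: (ltnP (k : nat) r) => [kr _|rk].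
  exact: leq_trans kr rq.
by case: eqP. Qed.

Definition cycle_ord q r (k : 'I_q.+1) : 'I_q.+1 := inord (cycle_nat r k).

Lemma cycle_ordE q r (k : 'I_q.+1) : (r <= q)%N -> cycle_ord r k = cycle_nat r k :> nat.
Proof. by move=> rq; rewrite inordK//; exact: cycle_ord_subproof. Qed.

Lemma cycle_ord_inj q r : (r <= q)%N -> injective (@cycle_ord q r).
Proof.
move=> rq k l /(congr1 val); rewrite /= !cycle_ordE// /cycle_nat => H; apply: val_inj => /=.
move: H; case: (ltnP (k : nat) r) => kr; case: (ltnP (l : nat) r) => lr;
  case: (eqVneq (k : nat) r) => kr'; case: (eqVneq (l : nat) r) => lr'; lia.
Qed.

Lemma nth_cycle (T : Type) (x0 f : T) (g h : seq T) k :
  nth x0 (g ++ f :: h) k = nth x0 (f :: g ++ h) (cycle_nat (size g) k).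
Proof.
rewrite nth_cat /cycle_nat; case: ltnP => kg /=; first by rewrite nth_cat kg.
case: eqP => [->|nk]; first by rewrite subnn.
have -> : k = (size g + (k - size g).-1).+1 by lia.
rewrite /= nth_cat ifN; last by rewrite -leqNgt leq_addr.
by rewrite addKn -addnS addKn.
Qed.
End Cycle.

(** * Kaehler expressions and their differentials *)

Section KahlerExpressions.
Variables (R : realType) (X : complexSpace R).
Local Notation fct := (X -> Cx R).
Local Notation form := (Defs.form X).
Implicit Types (x y : X) (f g h : X -> Cx R).

(** The value of dg_1 /\ .. /\ dg_q on the vectors D, where t lists the functions g_j. *)
Definition kdet q (t : q.-tuple fct) (D : 'I_q -> fct -> Cx R) : Cx R :=
  \det (\matrix_(i < q, j < q) D i (tnth t j)).

Definition kmul r s q (E : (r + s)%N = q) (e1 : kexpr X r) (e2 : kexpr X s) : kexpr X q :=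
  [seq ((fun y => u.1 y * w.1 y), tcast E (cat_tuple u.2 w.2)) | u <- e1, w <- e2].

Definition kscale q h (e : kexpr X q) : kexpr X q := [seq ((fun y => h y * u.1 y), u.2) | u <- e].

(** This expression stands for dh /\ e. *)
Definition kcons q h (e : kexpr X q) : kexpr X q.+1 := [seq (u.1, cons_tuple h u.2) | u <- e].

Definition kfun f : kexpr X 0 := [:: (f, [tuple])].

Lemma kformE q (e : kexpr X q) x D : kform e x D = \sum_(u <- e) u.1 x * kdet u.2 D.
Proof. by []. Qed.

Lemma kform_cat q (e1 e2 : kexpr X q) x D : kform (e1 ++ e2) x D = kform e1 x D + kform e2 x D.
Proof. by rewrite !kformE big_cat. Qed.

Lemma kform_kscale q h (e : kexpr X q) x D : kform (kscale h e) x D = h x * kform e x D.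
Proof.
rewrite !kformE big_map mulr_sumr; apply: eq_bigr => u _ /=; by rewrite mulrA.
Qed.

Lemma kform_kmul r s q (E : (r + s)%N = q) (e1 : kexpr X r) (e2 : kexpr X s) x D :
  kform (kmul E e1 e2) x D =
  \sum_(u <- e1) \sum_(w <- e2) u.1 x * w.1 x * kdet (tcast E (cat_tuple u.2 w.2)) D.
Proof. by rewrite kformE big_allpairs_dep. Qed.

Lemma kdet0 (t : 0.-tuple fct) D : kdet t D = 1.
Proof. by rewrite /kdet det_mx00. Qed.

(** By [shuffle_det] the alternating sum over permutations becomes concatenation of tuples.
    Associativity and commutation with functions then reduce to equalities of lists. *)
Lemma wedge_kform r s q (E : (r + s)%N = q) (e1 : kexpr X r) (e2 : kexpr X s) x D :
  wedge E (kform e1) (kform e2) x D = kform (kmul E e1 e2) x D.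
Proof.
case: q / E D => D; rewrite kform_kmul /wedge.
have unit_rs : (r`! * s`!)%:R != 0 :> Cx R.
  by rewrite pnatr_eq0 -lt0n muln_gt0 !fact_gt0.
apply: (mulfI unit_rs); rewrite mulVKf//.
transitivity (\sum_(u <- e1) \sum_(w <- e2) \sum_(p : 'S_(r + s)) (-1) ^+ p *
   (u.1 x * kdet u.2 (fun i => D (cast_ord erefl (p (lshift s i))))) *
   (w.1 x * kdet w.2 (fun j => D (cast_ord erefl (p (rshift r j)))))).
  rewrite [RHS](eq_bigr (fun u => \sum_(p : 'S_(r + s)) \sum_(w <- e2) (-1) ^+ p *
   (u.1 x * kdet u.2 (fun i => D (cast_ord erefl (p (lshift s i))))) *
   (w.1 x * kdet w.2 (fun j => D (cast_ord erefl (p (rshift r j))))))); last first.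
    by move=> u _; rewrite exchange_big.
  rewrite [RHS]exchange_big /=; apply: eq_bigr => p _.
  rewrite !kformE -mulrA big_distrlr /= mulr_sumr; apply: eq_bigr => u _.
  by rewrite mulr_sumr; apply: eq_bigr => w _; rewrite mulrA.
rewrite mulr_sumr; apply: eq_bigr => u _; rewrite mulr_sumr; apply: eq_bigr => w _.
rewrite tcast_id.
have := shuffle_det (\matrix_(i, j) D i (tnth (cat_tuple u.2 w.2) j)).
rewrite -/(kdet _ _) => H; rewrite mulrCA -H mulr_sumr; apply: eq_bigr => p _.
have -> : kdet u.2 (fun i => D (cast_ord erefl (p (lshift s i)))) =
   \det (\matrix_(i, j) (\matrix_(i, j) D i (tnth (cat_tuple u.2 w.2) j)) (p (lshift s i)) (lshift s j)).
  by congr (\det _); apply/matrixP => i j; rewrite !mxE cast_ord_id tnth_lshift.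
have -> : kdet w.2 (fun i => D (cast_ord erefl (p (rshift r i)))) =
   \det (\matrix_(i, j) (\matrix_(i, j) D i (tnth (cat_tuple u.2 w.2) j)) (p (rshift r i)) (rshift r j)).
  by congr (\det _); apply/matrixP => i j; rewrite !mxE cast_ord_id tnth_rshift.
set a := \det _; set b := \det _; set c := (-1) ^+ p.
exact: mulr_shuffle4.
Qed.

Lemma kform_kmulA r s t a b q (E1 : (r + a)%N = q) (E2 : (s + t)%N = a)
    (E3 : (b + t)%N = q) (E4 : (r + s)%N = b) e1 e2 e3 x D :
  kform (kmul E1 e1 (kmul E2 e2 e3)) x D = kform (kmul E3 (kmul E4 e1 e2) e3) x D.
Proof.
rewrite !kform_kmul big_allpairs_dep; apply: eq_bigr => u _ /=.
rewrite big_allpairs_dep /=; apply: eq_bigr => v _; apply: eq_bigr => w _.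
congr (_ * _); first by rewrite mulrA.
by congr (kdet _ D); apply: val_inj => /=; rewrite !val_tcast /= !val_tcast /= catA.
Qed.

Lemma kform_kmul0C r q (E1 : (r + 0)%N = q) (E2 : (0 + r)%N = q) (e1 : kexpr X r)
    (e2 : kexpr X 0) x D : kform (kmul E1 e1 e2) x D = kform (kmul E2 e2 e1) x D.
Proof.
rewrite !kform_kmul exchange_big /=; apply: eq_bigr => u _; apply: eq_bigr => w _.
rewrite [u.1 x * _]mulrC; congr (_ * kdet _ D).
by apply: val_inj => /=; rewrite !val_tcast /= (tuple0 u.2) cats0.
Qed.

Lemma kform_kmul0 r q (E : (r + 0)%N = q) (E' : r = q) (e1 : kexpr X r) (e2 : kexpr X 0) x D D0 :
  kform (kmul E e1 e2) x D = kform e2 x D0 * kform e1 x (fun i => D (cast_ord E' i)).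
Proof.
case: q / E' in E D *; rewrite kform_kmul mulrC !kformE big_distrlr /=.
apply: eq_bigr => u _; apply: eq_bigr => w _.
rewrite kdet0 mulr1 -mulrA [w.1 x * _]mulrC mulrA; congr (_ * _ * _).
have -> : tcast E (cat_tuple u.2 w.2) = u.2.
  by apply: val_inj => /=; rewrite val_tcast /= (tuple0 w.2) cats0.
by congr (\det _); apply/matrixP => i j; rewrite !mxE cast_ord_id.
Qed.

Lemma wedgeE_congr r s q (E : (r + s)%N = q) (a a' : form r) (b b' : form s) x :
  eqform_at x a a' -> eqform_at x b b' -> eqform_at x (wedge E a b) (wedge E a' b').
Proof.
move=> aa bb rx D hD; rewrite /wedge; congr (_ * _); apply: eq_bigr => p _.
by rewrite aa// bb.
Qed.

Lemma wedge_suml r s q (E : (r + s)%N = q) (I : Type) (l : seq I) (c : I -> X -> Cx R)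
  (a : I -> form r) (b : form s) x D :
  wedge E (fun x D => \sum_(i <- l) c i x * a i x D) b x D =
  \sum_(i <- l) c i x * wedge E (a i) b x D.
Proof.
rewrite /wedge; under [RHS]eq_bigr do rewrite mulrCA mulr_sumr.
rewrite -mulr_sumr exchange_big /=; congr (_ * _); apply: eq_bigr => p _.
rewrite mulr_sumr mulr_suml; apply: eq_bigr => i _.
exact: mulr_shuffle3.
Qed.

Lemma wedge_sumr r s q (E : (r + s)%N = q) (I : Type) (l : seq I) (c : I -> X -> Cx R)
  (a : form r) (b : I -> form s) x D :
  wedge E a (fun x D => \sum_(i <- l) c i x * b i x D) x D =
  \sum_(i <- l) c i x * wedge E a (b i) x D.
Proof.
rewrite /wedge; under [RHS]eq_bigr do rewrite mulrCA mulr_sumr.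
rewrite -mulr_sumr exchange_big /=; congr (_ * _); apply: eq_bigr => p _.
by rewrite mulr_sumr; apply: eq_bigr => i _; rewrite mulrCA.
Qed.

Definition kminor q (t : q.-tuple fct) (i : 'I_q.+1) (D : 'I_q.+1 -> fct -> Cx R) : Cx R :=
  (-1) ^+ i * kdet t (fun k => D (lift i k)).

Lemma kdet_cons q f (t : q.-tuple fct) D :
  kdet (cons_tuple f t) D = \sum_i D i f * kminor t i D.
Proof.
rewrite /kdet (expand_det_col _ ord0); apply: eq_bigr => i _.
rewrite mxE tnth0 /kminor /cofactor addn0; congr (_ * (_ * \det _)).
by apply/matrixP => k l; rewrite !mxE tnthS.
Qed.

Lemma kform_kcons q h (e : kexpr X q) x D :
  kform (kcons h e) x D = \sum_i D i h * ((-1) ^+ i * kform e x (fun k => D (lift i k))).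
Proof.
rewrite kformE big_map /=.
under eq_bigr do rewrite kdet_cons mulr_sumr.
rewrite exchange_big /=; apply: eq_bigr => i _.
rewrite kformE !mulr_sumr; apply: eq_bigr => u _.
by rewrite /kminor mulrCA; congr (_ * _); rewrite mulrCA.
Qed.

Lemma kform_kdiff q (e : kexpr X q) x D :
  kform (kdiff e) x D = \sum_(u <- e) kdet (cons_tuple u.1 u.2) D.
Proof. by rewrite kformE big_map; apply: eq_bigr => u _; rewrite mul1r. Qed.

Lemma kholo_cat q x (e1 e2 : kexpr X q) : kholo_at x e1 -> kholo_at x e2 -> kholo_at x (e1 ++ e2).
Proof. by move=> h1 h2 u; rewrite mem_cat => /orP[/h1|/h2]. Qed.

Lemma kholo_kscale q x h (e : kexpr X q) : hol_at x h -> kholo_at x e -> kholo_at x (kscale h e).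
Proof.
move=> hh he u /mapP[w /he[h1 h2] ->] /=; split => //; exact: hol_mul.
Qed.

Lemma kholo_kcons q x h (e : kexpr X q) : hol_at x h -> kholo_at x e -> kholo_at x (kcons h e).
Proof.
move=> hh he u /mapP[w /he[h1 h2] ->] /=; split => // j.
by case: (unliftP ord0 j) => [k ->|->]; rewrite ?tnthS ?tnth0.
Qed.

Lemma kholo_kdiff q x (e : kexpr X q) : kholo_at x e -> kholo_at x (kdiff e).
Proof.
move=> he u /mapP[w /he[h1 h2] ->] /=; split => [|j]; first exact: hol_cst.
by case: (unliftP ord0 j) => [k ->|->]; rewrite ?tnthS ?tnth0.
Qed.

Lemma kholo_kmul r s q (E : (r + s)%N = q) x e1 e2 : kholo_at x e1 -> kholo_at x e2 ->
  kholo_at x (kmul E e1 e2).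
Proof.
case: q / E => h1 h2 u /allpairsP[[v w] /= [/h1[a b] /h2[c d] ->]] /=; split; first exact: hol_mul.
move=> j; have := splitK j; case: (fintype.split j) => k <- /=.
  by rewrite tnth_lshift.
by rewrite tnth_rshift.
Qed.

Lemma kholo_kfun x f : hol_at x f -> kholo_at x (kfun f).
Proof. by move=> hf u; rewrite inE => /eqP -> /=; split => // -[]. Qed.

Lemma kholo_near q x (e : kexpr X q) : kholo_at x e -> \forall y \near x, kholo_at y e.
Proof.
elim: e => [|u e IH] he; first by near=> y.
have hu := he u (mem_head _ _).
have {}IH : \forall y \near x, kholo_at y e.
  by apply: IH => w we; apply: he; rewrite inE we orbT.
have h1 := hol_near hu.1.
have h2 : \forall y \near x, forall j, hol_at y (tnth u.2 j).
  by apply: filter_forall => j; exact: hol_near (hu.2 j).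
near=> y.
have hy : kholo_at y e by near: y.
have h1y : hol_at y u.1 by near: y.
have h2y : forall j, hol_at y (tnth u.2 j) by near: y.
by move=> w; rewrite inE => /predU1P[->|]; [split|exact: hy].
Unshelve. all: by end_near. Qed.

Section AtPoint.
Variables (x : X) (q : nat) (D : 'I_q.+1 -> fct -> Cx R).
Hypothesis hD : forall i, derivation x (D i).

Lemma kform_kdiff_kscale h (e : kexpr X q) : hol_at x h -> kholo_at x e ->
  kform (kdiff (kscale h e)) x D = h x * kform (kdiff e) x D + kform (kcons h e) x D.
Proof.
move=> hh he; rewrite !kform_kdiff kformE !big_map mulr_sumr -big_split /=.
rewrite !big_seq; apply: eq_bigr => u /he[h1 _].
rewrite !kdet_cons !mulr_sumr -big_split /=; apply: eq_bigr => i _.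
by rewrite (derivation_mul (hD i))// mulrDl !mulrA.
Qed.

Lemma kform_kdiff_kfun f (e : kexpr X q) E : kform (kmul E (kdiff (kfun f)) e) x D = kform (kcons f e) x D.
Proof.
rewrite kform_kmul big_seq1 kformE big_map /=; apply: eq_bigr => u _.
rewrite mul1r; congr (_ * kdet _ D); apply: val_inj => /=.
by rewrite val_tcast.
Qed.

End AtPoint.

(* This is (-1)^r, and a junk 0 for r > q; only the fact that its square is 1 matters. *)
Definition leibniz_sign (q r : nat) : Cx R :=
  match pselect (r <= q)%N with
  | left rq => (-1) ^+ perm (@cycle_ord_inj q r rq)
  | right _ => 0
  end.

Lemma kdet_move r s q (E : (r + s.+1)%N = q.+1) (E' : (r + s)%N = q) f
    (g : r.-tuple fct) (h : s.-tuple fct) D :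
  kdet (tcast E (cat_tuple g (cons_tuple f h))) D =
  leibniz_sign q r * kdet (cons_tuple f (tcast E' (cat_tuple g h))) D.
Proof.
have rq : (r <= q)%N by rewrite -E' leq_addr.
rewrite /leibniz_sign; case: pselect => // rq'.
rewrite /kdet -det_col_perm; congr (\det _); apply/matrixP => i j; rewrite !mxE permE.
congr (D i _); rewrite !(tnth_nth f) val_tcast /= nth_cycle size_tuple.
by rewrite [in RHS]cycle_ordE// val_tcast.
Qed.

(** The differential of a product of coefficients splits in two. In the second part the new
    differential has to pass the r differentials of the first factor, hence the sign. *)
Lemma kform_kdiff_kmul r s q (E : (r + s)%N = q) (E1 : (r.+1 + s)%N = q.+1)
    (E2 : (r + s.+1)%N = q.+1) (e1 : kexpr X r) (e2 : kexpr X s) x D :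
  (forall i, derivation x (D i)) -> kholo_at x e1 -> kholo_at x e2 ->
  kform (kdiff (kmul E e1 e2)) x D =
  kform (kmul E1 (kdiff e1) e2) x D + leibniz_sign q r * kform (kmul E2 e1 (kdiff e2)) x D.
Proof.
move=> hD h1 h2; rewrite kform_kdiff big_allpairs_dep !kform_kmul big_map mulr_sumr -big_split /=.
rewrite !big_seq; apply: eq_bigr => u /h1[hu _].
rewrite big_map mulr_sumr -big_split /= !big_seq; apply: eq_bigr => w /h2[hw _].
have Hs : leibniz_sign q r * leibniz_sign q r = 1.
  rewrite /leibniz_sign; case: pselect => [rq|]; first by rewrite -expr2 sqrr_sign.
  by case; rewrite -E leq_addr.
rewrite (kdet_move E2 E) mulr1 mul1r; set t := tcast E _.
have -> : tcast E1 (cat_tuple (cons_tuple u.1 u.2) w.2) = cons_tuple u.1 t.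
  by apply: val_inj => /=; rewrite val_tcast /= val_tcast.
rewrite [leibniz_sign q r * (_ * _)]mulrCA [leibniz_sign q r * (_ * _)]mulrA Hs mul1r !kdet_cons !mulr_sumr -big_split /=.
apply: eq_bigr => i _; rewrite (derivation_mul (hD i))// addrC mulrDl !mulrA.
exact: erefl.
Qed.

End KahlerExpressions.

(** * Independence of the exterior derivative from the representation *)

Section AlternatingSums.
Variable K : numFieldType.

(** Reindexing by a transposition shows that the sum is its own opposite, and 2 is invertible in
    K. *)
Lemma alternating_sum_sym n (F : 'S_n.+1 -> K) (b : 'I_n.+1) : b != ord0 ->
  (forall p, F (tperm ord0 b * p)%g = F p) -> \sum_(p : 'S_n.+1) (-1) ^+ p * F p = 0.
Proof.
move=> b0 HF; set S := \sum_(p : 'S_n.+1) _.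
have : S = - S.
  rewrite {1}/S (reindex_inj (mulgI (tperm ord0 b))) /= -sumrN; apply: eq_bigr => p _.
  by rewrite HF odd_permM odd_tperm eq_sym b0 signr_addb /= expr1 mulN1r mulNr.
by move=> /eqP; rewrite -addr_eq0 -mulr2n mulrn_eq0 /= => /eqP.
Qed.

(** Each permutation fixing 0 is absorbed into p, so an alternation over all arguments may be
    preceded by one over all but the first. The n! repetitions are harmless in characteristic
    zero. *)
Lemma alternating_sum_lift n (T : 'S_n.+1 -> K) :
  \sum_(p : 'S_n.+1) (-1) ^+ p * (\sum_(s : 'S_n) (-1) ^+ s * T (lift_perm ord0 ord0 s * p)%g)
  = (\sum_(p : 'S_n.+1) (-1) ^+ p * T p) *+ n`!.
Proof.
under eq_bigr do rewrite mulr_sumr.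
rewrite exchange_big /= -card_Sn -sumr_const; apply: eq_bigr => s _.
rewrite [RHS](reindex_inj (mulgI (lift_perm ord0 ord0 s))) /=; apply: eq_bigr => p _.
by rewrite odd_permM odd_lift_perm /= signr_addb mulrCA mulrA.
Qed.
End AlternatingSums.

Section ExteriorDerivative.
Variables (R : realType) (X : complexSpace R).
Local Notation fct := (X -> Cx R).
Local Notation form := (Defs.form X).
Implicit Types (x y : X) (f g h : X -> Cx R).

Lemma hol_prod x (I : Type) (r : seq I) (F : I -> fct) : (forall i, hol_at x (F i)) ->
  hol_at x (fun y => \prod_(i <- r) F i y).
Proof.
move=> hF; elim: r => [|i r IH].
  by apply: (hol_eq _ (hol_cst x 1)); apply: nearW => y; rewrite big_nil.
by apply: (hol_eq _ (hol_mul (hF i) IH)); apply: nearW => y; rewrite big_cons.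
Qed.

Lemma hol_sum_in x (I : eqType) (r : seq I) (F : I -> fct) :
  (forall i, i \in r -> hol_at x (F i)) -> hol_at x (fun y => \sum_(i <- r) F i y).
Proof.
elim: r => [|i r IH] hF.
  by apply: (hol_eq _ (hol_cst x 0)); apply: nearW => y; rewrite big_nil.
have hr : hol_at x (fun y => \sum_(i <- r) F i y).
  by apply: IH => j jr; apply: hF; rewrite inE jr orbT.
by apply: (hol_eq _ (hol_add (hF i (mem_head _ _)) hr)); apply: nearW => y; rewrite big_cons.
Qed.

Lemma derivation_sum_in x D (I : eqType) (r : seq I) (F : I -> fct) : derivation x D ->
  (forall i, i \in r -> hol_at x (F i)) ->
  D (fun y => \sum_(i <- r) F i y) = \sum_(i <- r) D (F i).
Proof.
move=> hD; elim: r => [|i r IH] hF.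
  rewrite big_nil -[RHS](derivation_cst hD 0); congr D; apply/funext => y.
  by rewrite big_nil.
have hF' j : j \in r -> hol_at x (F j) by move=> jr; apply: hF; rewrite inE jr orbT.
rewrite big_cons -IH// -(derivation_add hD); [|exact/hF/mem_head|exact: hol_sum_in].
by congr D; apply/funext => y; rewrite big_cons.
Qed.

Lemma derivation_prod x D (I : eqType) (r : seq I) (F : I -> fct) : derivation x D ->
  (forall i, hol_at x (F i)) -> uniq r ->
  D (fun y => \prod_(i <- r) F i y) = \sum_(i <- r) D (F i) * \prod_(j <- r | j != i) F j x.
Proof.
move=> hD hF; elim: r => [_|i r IH /= /andP[ir ur]].
  rewrite big_nil -[RHS](derivation_cst hD 1); congr D; apply/funext => y.
  by rewrite big_nil.
have -> : (fun y => \prod_(i <- i :: r) F i y) = (fun y => F i y * \prod_(i <- r) F i y).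
  by apply/funext => y; rewrite big_cons.
rewrite (derivation_mul hD)//; last exact: hol_prod.
rewrite IH// big_cons addrC mulrC; congr (_ + _).
  rewrite big_cons eqxx /= big_seq_cond [in RHS]big_seq_cond; congr (_ * _).
  rewrite -big_seq_cond -big_seq_cond [RHS]big_seq_cond big_seq; apply: eq_bigl => j.
  by case jr: (j \in r) => //=; apply/esym; apply: contraNneq ir => <-.
rewrite mulr_sumr !big_seq; apply: eq_bigr => k kr.
rewrite big_cons ifT; last by apply: contraNneq ir => ->.
by rewrite mulrCA.
Qed.

(* Expand both determinants over permutations in a commuting frame d.  The terms in which the
   extra derivation hits an argument of d cancel by symmetry of second derivatives; what remains
   is a derivative of the values of the form itself, which vanish near x. *)
Lemma kform_kdiff_eq0 q x (e : kexpr X q) : reg X x -> kholo_at x e ->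
  (\forall y \near x, eqform_at y (kform e) (fun _ _ => 0)) ->
  eqform_at x (kform (kdiff e)) (fun _ _ => 0).
Proof.
move=> rx he e0 _ D hD.
have [V [U [d [oU Ux Ureg dP]]]] := regular_frame rx.
have [dD dhol dC dall] := dP x Ux.
have /fin_all_exists[v' Dv] : forall i, exists v, forall f, hol_at x f -> D i f = d v x f.
  by move=> i; exact: dall (hD i).
pose G (u : fct * q.-tuple fct) (w : 'I_q -> V) : fct :=
  fun y => u.1 y * \prod_b d (w b) y (tnth u.2 b).
have hG u w : u \in e -> hol_at x (G u w).
  move=> /he[h1 h2]; apply: hol_mul => //; apply: hol_prod => b; exact: dhol.
(* The sum over s without [d v] is the value of the form on the frame vectors [w]. It vanishes near
   x, hence so does its derivative. *)
have vanish v w : \sum_(s : 'S_q) (-1) ^+ s * \sum_(u <- e) d v x (G u (fun b => w (s b))) = 0.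
  pose H : fct := fun y => \sum_(s : 'S_q) (-1) ^+ s * \sum_(u <- e) G u (fun b => w (s b)) y.
  have hsum (s : 'S_q) : hol_at x (fun y => \sum_(u <- e) G u (fun b => w (s b)) y).
    by apply: hol_sum_in => u ue; exact: hG.
  have hterm (s : 'S_q) : hol_at x (fun y => (-1) ^+ s * \sum_(u <- e) G u (fun b => w (s b)) y).
    by apply: hol_mul => //; exact: hol_cst.
  have hH : hol_at x H by exact: hol_sum.
  have H0 : \forall y \near x, H y = 0.
    have nU : \forall y \near x, U y by exact: open_nbhs_nbhs.
    near=> y.
    have Uy : U y by near: y.
    have ey : eqform_at y (kform e) (fun _ _ => 0) by near: y.
    have [dDy _ _ _] := dP y Uy.
    rewrite -[RHS](ey (Ureg _ Uy) (fun i => d (w i) y)); last by move=> i; exact: dDy.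
    rewrite kformE /H; under eq_bigr do rewrite mulr_sumr.
    rewrite exchange_big /=; apply: eq_bigr => u _.
    rewrite /kdet det_colE mulr_sumr; apply: eq_bigr => s _; rewrite /G mulrCA.
    by congr (_ * (_ * _)); apply: eq_bigr => b _; rewrite mxE.
  have := derivation_congr (dD v) hH H0; rewrite (derivation_cst (dD v)) => dH.
  rewrite -[RHS]dH (derivation_sum (dD v))//; apply: eq_bigr => s _.
  rewrite (derivation_scale (dD v))//; congr (_ * _).
  symmetry; apply: (derivation_sum_in (dD v)) => u ue; exact: hG.
pose T (p : 'S_q.+1) := \sum_(u <- e) d (v' (p ord0)) x (G u (fun b => v' (p (lift ord0 b)))).
(* Alternating first over the last q arguments brings in the sums that vanish; this multiplies the
   total by q!, which is not zero. *)
have T0 : \sum_(p : 'S_q.+1) (-1) ^+ p * T p = 0.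
  have := alternating_sum_lift T; rewrite big1.
    move/esym/eqP; rewrite mulrn_eq0 => /orP[|/eqP//].
    by rewrite eqn0Ngt fact_gt0.
  move=> p _; have := vanish (v' (p ord0)) (fun b => v' (p (lift ord0 b))).
  move=> V0; rewrite [X in _ * X](_ : _ = 0) ?mulr0// -[RHS]V0.
  apply: eq_bigr => s _; congr (_ * _); rewrite /T; apply: eq_bigr => u _.
  rewrite permM lift_perm_id; congr (d _ x (G u _)); apply/funext => b.
  by rewrite permM lift_perm_lift.
rewrite kform_kdiff -[RHS]T0.
transitivity (\sum_(u <- e) \sum_(p : 'S_q.+1) (-1) ^+ p *
   d (v' (p ord0)) x (G u (fun b => v' (p (lift ord0 b))))); last first.
  by rewrite exchange_big /=; apply: eq_bigr => p _; rewrite /T mulr_sumr.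
rewrite !big_seq; apply: eq_bigr => u ue; have [hu1 hu2] := he u ue.
have hd w b : hol_at x (fun y => d (w b) y (tnth u.2 b)) by exact: dhol.
have dG (p : 'S_q.+1) : d (v' (p ord0)) x (G u (fun b => v' (p (lift ord0 b)))) =
   u.1 x * (\sum_b d (v' (p ord0)) x (fun y => d (v' (p (lift ord0 b))) y (tnth u.2 b)) *
       \prod_(c | c != b) d (v' (p (lift ord0 c))) x (tnth u.2 c)) +
   d (v' (p ord0)) x u.1 * \prod_b d (v' (p (lift ord0 b))) x (tnth u.2 b).
  rewrite (derivation_mul (dD _))//; last by apply: hol_prod => b; exact: dhol.
  rewrite (derivation_prod (dD _)) ?index_enum_uniq//; last by move=> b; exact: dhol.
  by congr (_ + _); rewrite mulrC.
under [RHS]eq_bigr do rewrite dG mulrDr.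
rewrite big_split /= [X in X + _](_ : _ = 0) ?add0r; last first.
  under eq_bigr do rewrite mulrCA mulr_sumr.
  rewrite -mulr_sumr exchange_big /= big1 ?mulr0// => b _.
  apply: (@alternating_sum_sym _ q _ (lift ord0 b)) => // p.
  rewrite !permM tpermL tpermR dC//; congr (_ * _); apply: eq_bigr => c cb.
  by rewrite permM tpermD// (inj_eq (@lift_inj _ _)) eq_sym.
rewrite /kdet det_colE; apply: eq_bigr => p _; rewrite big_ord_recl !mxE tnth0 Dv//.
by congr (_ * (_ * _)); apply: eq_bigr => b _; rewrite mxE tnthS Dv.
Unshelve. all: by end_near. Qed.

End ExteriorDerivative.

(** * Products and differentials of forms on the regular locus *)

Section DifferentialForms.
Variables (R : realType) (X : complexSpace R).
Local Notation fct := (X -> Cx R).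
Local Notation form := (Defs.form X).
Implicit Types (x y : X) (f g h : X -> Cx R).

Lemma eqform_at_refl q x (s : form q) : eqform_at x s s. Proof. by []. Qed.
Lemma eqform_at_sym q x (s t : form q) : eqform_at x s t -> eqform_at x t s.
Proof. by move=> H rx D hD; rewrite H. Qed.
Lemma eqform_at_trans q x (s t u : form q) : eqform_at x s t -> eqform_at x t u -> eqform_at x s u.
Proof. by move=> H1 H2 rx D hD; rewrite H1// H2. Qed.

Lemma kform_kdiff_congr q x (e e' : kexpr X q) : reg X x -> kholo_at x e -> kholo_at x e' ->
  (\forall y \near x, eqform_at y (kform e) (kform e')) ->
  eqform_at x (kform (kdiff e)) (kform (kdiff e')).
Proof.
move=> rx he he' ee' _ D hD.
have hN : hol_at x (fun _ : X => -1 : Cx R) by exact: hol_cst.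
have := @kform_kdiff_eq0 R X q x (e ++ kscale (fun=> -1) e') rx.
move=> /(_ (kholo_cat he (kholo_kscale hN he'))).
have H : \forall y \near x, eqform_at y (kform (e ++ kscale (fun=> -1) e')) (fun _ _ => 0).
  near=> y.
  have ey : eqform_at y (kform e) (kform e') by near: y.
  by move=> ry D' hD'; rewrite kform_cat kform_kscale ey// mulN1r subrr.
move=> /(_ H rx D hD).
rewrite /kdiff map_cat kform_cat -!/(kdiff _) (kform_kdiff_kscale hD hN he').
rewrite kform_kcons big1 ?addr0; last by move=> i _; rewrite (derivation_cst (hD i)) mul0r.
by rewrite mulN1r => /eqP; rewrite subr_eq0 => /eqP.
Unshelve. all: by end_near. Qed.

Lemma represents_near q x (s : form q) e : represents_at x s e ->
  \forall y \near x, represents_at y s e.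
Proof.
move=> [he se]; have h1 := kholo_near he; have h2 := near_join se.
by near=> y; split; near: y.
Unshelve. all: by end_near. Qed.

Lemma represents_congr q x (s t : form q) e : (\forall y \near x, eqform_at y s t) ->
  represents_at x s e -> represents_at x t e.
Proof.
move=> st [he se]; split => //; near=> y.
have a : eqform_at y s t by near: y.
have b : eqform_at y s (kform e) by near: y.
exact: eqform_at_trans (eqform_at_sym a) b.
Unshelve. all: by end_near. Qed.

Lemma represents_at_point q x (s : form q) e : represents_at x s e -> eqform_at x s (kform e).
Proof. by case=> _ /nbhs_singleton. Qed.

Lemma represents_kform q x (e : kexpr X q) : kholo_at x e -> represents_at x (kform e) e.
Proof. by move=> he; split => //; exact: nearW. Qed.

Lemma dR_represents q x (s : form q) e : reg X x -> represents_at x s e ->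
  eqform_at x (dR s) (kform (kdiff e)).
Proof.
move=> rx se _ D hD; rewrite /dR; case: xgetP => [e' _ [he' se']|/(_ e)//].
have [he se0] := se; apply: kform_kdiff_congr => //.
near=> y.
have a : eqform_at y s (kform e') by near: y.
have b : eqform_at y s (kform e) by near: y.
exact: eqform_at_trans (eqform_at_sym a) b.
Unshelve. all: by end_near. Qed.

(** A genuine equality at x, not merely one on derivations: the two forms have the same
    representations at x, so the same one is chosen for both. *)
Lemma dR_congr q x (s t : form q) : (\forall y \near x, eqform_at y s t) -> dR s x = dR t x.
Proof.
move=> st; rewrite /dR; congr (kform (kdiff (xget _ _)) x); apply/seteqP; split => e /=.
  exact: represents_congr.
apply: represents_congr; apply: filterS st => y; exact: eqform_at_sym.
Qed.

Lemma represents_wedge r s q (E : (r + s)%N = q) x (a : form r) (b : form s) e1 e2 :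
  represents_at x a e1 -> represents_at x b e2 -> represents_at x (wedge E a b) (kmul E e1 e2).
Proof.
move=> [h1 a1] [h2 b2]; split; first exact: kholo_kmul.
near=> y.
have ay : eqform_at y a (kform e1) by near: y.
have b_y : eqform_at y b (kform e2) by near: y.
move=> ry D hD; rewrite -wedge_kform; exact: wedgeE_congr.
Unshelve. all: by end_near. Qed.

Lemma represents_dR q x (s : form q) e : represents_at x s e -> represents_at x (dR s) (kdiff e).
Proof.
move=> se; split; first by have [he _] := se; exact: kholo_kdiff.
have := represents_near se; apply: filterS => y sey ry; exact: (dR_represents ry sey ry).
Qed.

Lemma represents_scale q x h (s : form q) e : hol_at x h -> represents_at x s e ->
  represents_at x (fun y D => h y * s y D : Cx R) (kscale h e).
Proof.
move=> hh [he se]; split; first exact: kholo_kscale.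
by apply: filterS se => y sy ry D hD; rewrite kform_kscale sy.
Qed.

Lemma represents_add q x (s t : form q) e e' : represents_at x s e -> represents_at x t e' ->
  represents_at x (fun y D => s y D + t y D : Cx R) (e ++ e').
Proof.
move=> [he se] [he' te]; split; first exact: kholo_cat.
by apply: filterS2 se te => y sy ty ry D hD; rewrite kform_cat sy// ty.
Qed.

Lemma represents0 q x : represents_at x ((fun _ _ => 0) : form q) [::].
Proof. by split=> //; apply: nearW => y ry D hD; rewrite kformE big_nil. Qed.

Lemma kahler_at_sum q x (I : Type) (l : seq I) (c : I -> fct) (s : I -> form q) :
  (forall i, hol_at x (c i)) -> (forall i, kahler_at x (s i)) ->
  kahler_at x ((fun y D => \sum_(i <- l) c i y * s i y D) : form q).
Proof.
move=> hc hs; elim: l => [|i l [e IH]].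
  exists [::]; apply: represents_congr (represents0 _ _).
  by apply: nearW => y ry D hD; rewrite big_nil.
have [ei hei] := hs i; exists (kscale (c i) ei ++ e).
apply: represents_congr (represents_add (represents_scale (hc i) hei) IH).
by apply: nearW => y ry D hD; rewrite big_cons.
Qed.

Lemma kahler_at_wedge r s q (E : (r + s)%N = q) x (a : form r) (b : form s) :
  kahler_at x a -> kahler_at x b -> kahler_at x (wedge E a b).
Proof. by move=> [e1 H1] [e2 H2]; exists (kmul E e1 e2); exact: represents_wedge. Qed.

Lemma kahler_at_dR q x (s : form q) : kahler_at x s -> kahler_at x (dR s).
Proof. by move=> [e He]; exists (kdiff e); exact: represents_dR. Qed.

Lemma kahler_at_congr q x (s t : form q) : (\forall y \near x, eqform_at y s t) ->
  kahler_at x s -> kahler_at x t.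
Proof. by move=> st [e He]; exists e; exact: represents_congr He. Qed.

Section Pointwise.
Variable x : X.

Lemma wedge_assoc r s t a b q (E1 : (r + a)%N = q) (E2 : (s + t)%N = a)
    (E3 : (b + t)%N = q) (E4 : (r + s)%N = b) (w1 : form r) (w2 : form s) (w3 : form t) :
  kahler_at x w1 -> kahler_at x w2 -> kahler_at x w3 ->
  eqform_at x (wedge E1 w1 (wedge E2 w2 w3)) (wedge E3 (wedge E4 w1 w2) w3).
Proof.
move=> [e1 H1] [e2 H2] [e3 H3].
have L := represents_at_point (represents_wedge E1 H1 (represents_wedge E2 H2 H3)).
have L' := represents_at_point (represents_wedge E3 (represents_wedge E4 H1 H2) H3).
by move=> rx D hD; rewrite L// L'//; exact: kform_kmulA.
Qed.

Lemma wedge0C r q (E1 : (r + 0)%N = q) (E2 : (0 + r)%N = q) (a : form r) (b : form 0) :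
  kahler_at x a -> kahler_at x b -> eqform_at x (wedge E1 a b) (wedge E2 b a).
Proof.
move=> [e1 H1] [e2 H2].
have L := represents_at_point (represents_wedge E1 H1 H2).
have L' := represents_at_point (represents_wedge E2 H2 H1).
by move=> rx D hD; rewrite L// L'//; exact: kform_kmul0C.
Qed.

Lemma wedge0_scale r (E : (r + 0)%N = r) (a : form r) (b : form 0) D0 :
  kahler_at x a -> kahler_at x b ->
  (forall i, derivation x (D0 i)) ->
  eqform_at x (wedge E a b) (fun y D => b y D0 * a y D).
Proof.
move=> [e1 H1] [e2 H2] hD0.
have L := represents_at_point (represents_wedge E H1 H2).
have L1 := represents_at_point H1; have L2 := represents_at_point H2.
move=> rx D hD; rewrite L// L1// L2// (kform_kmul0 E erefl _ _ _ _ D0).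
by congr (_ * kform _ _ _); apply/funext => i; rewrite cast_ord_id.
Qed.

Lemma wedge1 r (E : (r + 0)%N = r) (a : form r) : kahler_at x a ->
  eqform_at x (wedge E a (kform (kfun (fun=> 1)))) a.
Proof.
move=> ka rx D hD.
have k1 : kahler_at x (kform (kfun (fun _ : X => 1))).
  by exists (kfun (fun=> 1)); apply: represents_kform; apply: kholo_kfun; exact: hol_cst.
have D0 : 'I_0 -> fct -> Cx R by case.
rewrite (wedge0_scale E (D0 := D0) ka k1)//; last by case.
by rewrite kformE big_seq1 kdet0 mulr1 mul1r.
Qed.

Lemma dR_add q (s t : form q) : kahler_at x s -> kahler_at x t ->
  eqform_at x (dR (fun y D => s y D + t y D)) (fun y D => dR s y D + dR t y D).
Proof.
move=> [e He] [e' He'] rx D hD.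
rewrite (dR_represents rx (represents_add He He'))// (dR_represents rx He)// (dR_represents rx He')//.
by rewrite /kdiff map_cat kform_cat.
Qed.

Lemma dR_scale q E h (s : form q) : hol_at x h -> kahler_at x s ->
  eqform_at x (dR (fun y D => h y * s y D))
     (fun y D => h y * dR s y D + wedge E (kform (kdiff (kfun h))) s y D : Cx R).
Proof.
move=> hh [e He] rx D hD; have [he _] := He.
rewrite (dR_represents rx (represents_scale hh He))// (dR_represents rx He)//.
rewrite (kform_kdiff_kscale hD)//; congr (_ + _).
have Hh : represents_at x (kform (kdiff (kfun h))) (kdiff (kfun h)).
  by apply: represents_kform; apply: kholo_kdiff; exact: kholo_kfun.
rewrite (represents_at_point (represents_wedge E Hh He))//.
by rewrite kform_kdiff_kfun.
Qed.

Lemma dR_wedge r s q (E : (r + s)%N = q) (E1 : (r.+1 + s)%N = q.+1)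
    (E2 : (r + s.+1)%N = q.+1) (a : form r) (b : form s) : kahler_at x a -> kahler_at x b ->
  eqform_at x (dR (wedge E a b))
    (fun y D => wedge E1 (dR a) b y D + leibniz_sign R q r * wedge E2 a (dR b) y D : Cx R).
Proof.
move=> [e1 H1] [e2 H2] rx D hD; have [he1 _] := H1; have [he2 _] := H2.
rewrite (dR_represents rx (represents_wedge E H1 H2))// (kform_kdiff_kmul E E1 E2)//.
by rewrite (represents_at_point (represents_wedge E1 (represents_dR H1) H2))//
           (represents_at_point (represents_wedge E2 H1 (represents_dR H2))).
Qed.

Lemma dR_dR q (a : form q) : kahler_at x a -> eqform_at x (dR (dR a)) (fun _ _ => 0).
Proof.
move=> [e H] rx D hD; rewrite (dR_represents rx (represents_dR H))//.
rewrite kform_kdiff big_map big1// => u _; rewrite kdet_cons big1// => i _.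
by rewrite (derivation_cst (hD i)) mul0r.
Qed.

End Pointwise.

Lemma dR_sum q x (I : Type) (l : seq I) (s : I -> form q) : (forall i, kahler_at x (s i)) ->
  eqform_at x (dR (fun y D => \sum_(i <- l) s i y D)) (fun y D => \sum_(i <- l) dR (s i) y D).
Proof.
move=> ks; elim: l => [|i l IH] rx D hD.
  have r0 : represents_at x ((fun y D => \sum_(i <- [::]) s i y D) : form q) [::].
    by apply: represents_congr (represents0 q x); apply: nearW => y ry D' _; rewrite big_nil.
  by rewrite (dR_represents rx r0)// kformE !big_nil.
have kl : kahler_at x ((fun y D => \sum_(i <- l) s i y D) : form q).
  have := @kahler_at_sum q x I l (fun _ _ => 1) s (fun i => hol_cst x 1) ks.
  by apply: kahler_at_congr; apply: nearW => y ry D' _; apply: eq_bigr => j _; rewrite mul1r.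
rewrite big_cons -IH// -(dR_add (ks i) kl)//; congr (_ D).
by apply: dR_congr; apply: nearW => y ry D' _; rewrite big_cons.
Qed.

End DifferentialForms.

(** * Pullback along holomorphic maps *)

Section Pullback.
Variables (R : realType) (Y X : complexSpace R) (tau : Y -> X).

Lemma derivation_push y D : holomorphic_map_at tau y -> derivation y D ->
  derivation (tau y) (fun f => D (f \o tau)).
Proof.
move=> [ctau htau] [D1 D2 D3]; split.
- move=> f g hf hg fg; apply: D1; [exact: htau|exact: htau|].
  exact: (ctau _ fg).
- by move=> c f g hf hg; apply: D2; exact: htau.
- by move=> f g hf hg; apply: D3; exact: htau.
Qed.

Definition kpull q (e : kexpr X q) : kexpr Y q :=
  [seq ((fun y => u.1 (tau y)), map_tuple (fun (f : X -> Cx R) y => f (tau y)) u.2) | u <- e].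

Lemma kform_kpull q (e : kexpr X q) y D :
  kform (kpull e) y D = kform e (tau y) (fun i f => D i (f \o tau)).
Proof.
rewrite !kformE big_map; apply: eq_bigr => u _ /=; congr (_ * _).
by congr (\det _); apply/matrixP => i j; rewrite !mxE tnth_map.
Qed.

Lemma kholo_kpull q (e : kexpr X q) y : holomorphic_map_at tau y -> kholo_at (tau y) e ->
  kholo_at y (kpull e).
Proof.
move=> [_ htau] he u /mapP[w /he[h1 h2] ->] /=; split; first exact: htau.
by move=> j; rewrite tnth_map; exact: htau.
Qed.

Lemma pullback_eqform q y (s t : Defs.form X q) : holomorphic_map_at tau y -> reg X (tau y) ->
  eqform_at (tau y) s t -> eqform_at y (pullback tau s) (pullback tau t).
Proof.
move=> htau rt st _ D hD; rewrite /pullback st// => i.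
exact: derivation_push.
Qed.

Lemma represents_pullback q y (s : Defs.form X q) e :
  (forall z, holomorphic_map_at tau z) -> reg X (tau y) ->
  represents_at (tau y) s e -> represents_at y (pullback tau s) (kpull e).
Proof.
move=> htau rt [he se]; split; first exact: kholo_kpull.
have [ctau _] := htau y.
have nr : \forall z \near y, reg X (tau z).
  by apply: (ctau _ (open_nbhs_nbhs (conj (open_reg X) rt))).
have ns : \forall z \near y, eqform_at (tau z) s (kform e) by exact: (ctau _ se).
near=> z.
have rz : reg X (tau z) by near: z.
have sz : eqform_at (tau z) s (kform e) by near: z.
move=> rYz D hD; rewrite kform_kpull.
exact: (pullback_eqform (htau z) rz sz rYz).
Unshelve. all: by end_near. Qed.

End Pullback.

(** * Stability of L under products and differentials *)

Section MeromorphicForms.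
Variables (R : realType) (X : complexSpace R).
Local Notation fct := (X -> Cx R).
Local Notation form := (Defs.form X).
Implicit Types (x y : X) (f g h : X -> Cx R).

Definition generic_at x h : Prop := \forall y \near x, ~ (\forall z \near y, h z = 0).

(** If h k vanishes near y, then k vanishes near each nearby point where h is nonzero, as h is
    continuous. Genericity of k excludes such points, so h vanishes near y, against its own
    genericity. *)
Lemma generic_mul x h k : hol_at x h -> generic_at x h -> generic_at x k ->
  generic_at x (fun y => h y * k y).
Proof.
move=> hh gh gk.
have n1 := hol_near hh; have n2 := near_join gk.
near=> y.
have hy : hol_at y h by near: y.
have gy : ~ (\forall z \near y, h z = 0) by near: y.
have ky : \forall z \near y, ~ (\forall w \near z, k w = 0) by near: y.
move=> hk0; apply: gy.
have hk1 := near_join hk0; have hy1 := hol_near hy.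
near=> z; apply: contrapT => hz.
have hkz : \forall w \near z, h w * k w = 0 by near: z.
have hhz : hol_at z h by near: z.
have kz : ~ (\forall w \near z, k w = 0) by near: z.
apply: kz.
have hn : \forall w \near z, h w != 0.
  have nb : nbhs (h z) [set w | w != 0].
    apply/nbhs_ballP; exists `|h z|; first by rewrite /= normr_gt0; exact/eqP.
    move=> w; rewrite -ball_normE /=; apply: contraTneq => ->.
    by rewrite subr0 ltxx.
  exact: (hol_cont hhz nb).
by apply: filterS2 hkz hn => w /eqP; rewrite mulf_eq0 => /orP[->//|/eqP].
Unshelve. all: by end_near. Qed.

Lemma meromorphic_wedge r s q (E : (r + s)%N = q) x (a : form r) (b : form s) :
  meromorphic_at x a -> meromorphic_at x b -> meromorphic_at x (wedge E a b).
Proof.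
move=> [h [hh gh [e1 H1]]] [k [hk gk [e2 H2]]].
exists (fun y => h y * k y); split; [exact: hol_mul|exact: generic_mul|].
exists (kmul E e1 e2); apply: represents_congr (represents_wedge E H1 H2).
apply: nearW => y ry D hD; rewrite /wedge [RHS]mulrCA; congr (_ * _).
rewrite mulr_sumr; apply: eq_bigr => p _.
exact: mulr_shuffle4.
Qed.

(** The square of the denominator h is a denominator for ds, because h^2 ds = h d(h s) - dh /\ (h s)
    and h s is represented by an expression across the singular locus. The identity itself is
    checked at regular points, where s has representations. *)
Lemma meromorphic_dR q x (s : form q) :
  (\forall y \near x, reg X y -> kahler_at y s) ->
  meromorphic_at x s -> meromorphic_at x (dR s).
Proof.
move=> ks [h [hh gh [e [he He]]]].
exists (fun y => h y * h y); split; [exact: hol_mul|exact: generic_mul|].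
exists (kscale h (kdiff e) ++ kscale (fun=> -1) (kcons h e)).
have hN : hol_at x (fun _ : X => -1 : Cx R) by exact: hol_cst.
split.
  apply: kholo_cat; apply: kholo_kscale => //; [exact: kholo_kdiff|exact: kholo_kcons].
have n1 := near_join He; have n2 := hol_near hh; have n3 := kholo_near he.
near=> y.
have Hy : \forall z \near y, eqform_at z (fun y D => h y * s y D) (kform e) by near: y.
have hy : hol_at y h by near: y.
have hey : kholo_at y e by near: y.
have ky : reg X y -> kahler_at y s by near: y.
move=> ry D hD; have [es Hs] := ky ry; have [hes _] := Hs.
have H1 := represents_scale hy Hs.
have H2 : represents_at y (fun y D => h y * s y D : Cx R) e by split.
have dE : kform (kdiff e) y D = kform (kdiff (kscale h es)) y D.
  by rewrite -(dR_represents ry H1)// -(dR_represents ry H2).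
rewrite kform_cat !kform_kscale dE (kform_kdiff_kscale hD hy hes) -(dR_represents ry Hs)//.
rewrite mulrDr mulrA mulN1r -[LHS]addr0 -addrA; congr (_ + _).
apply/esym/eqP; rewrite subr_eq0; apply/eqP.
rewrite !kform_kcons mulr_sumr; apply: eq_bigr => i _.
have hDi k : derivation y (D (lift i k)) by exact: hD.
rewrite -(represents_at_point H2 ry hDi) (represents_at_point Hs ry hDi).
by rewrite mulrCA; congr (_ * _); rewrite mulrCA.
Unshelve. all: by end_near. Qed.

Lemma Lsheaf_kahler q U (s : form q) x : Lsheaf X q U s -> U x -> reg X x -> kahler_at x s.
Proof. by move=> [_ ks _] Ux rx; apply: ks. Qed.

Lemma Lsheaf_wedge r s q (E : (r + s)%N = q) U (a : form r) (b : form s) :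
  Lsheaf X r U a -> Lsheaf X s U b -> Lsheaf X q U (wedge E a b).
Proof.
move=> [ma ka pa] [mb kb pb]; split.
- by move=> x Ux; apply: meromorphic_wedge; [exact: ma|exact: mb].
- by move=> x Ux; apply: kahler_at_wedge; [exact: ka|exact: kb].
- move=> Y tau dtau; have [eta ke etaE] := pa Y tau dtau; have [zeta kz zetaE] := pb Y tau dtau.
  exists (wedge E eta zeta).
    by move=> y Uy; apply: kahler_at_wedge; [exact: ke|exact: kz].
  move=> y Uy ry D hD; rewrite (wedgeE_congr E (etaE y Uy) (zetaE y Uy))//.
Qed.

(** If eta extends the pullback of s, then [dR eta] extends that of [dR s]: over the regular locus
    both are computed from the same pulled back expression [kpull tau e]. *)
Lemma Lsheaf_dR q U (s : form q) : open U -> Lsheaf X q U s -> Lsheaf X q.+1 U (dR s).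
Proof.
move=> oU [ms ks ps]; split.
- move=> x Ux; apply: meromorphic_dR; last exact: ms.
  have nU : \forall y \near x, U y by exact: open_nbhs_nbhs.
  by apply: filterS nU => y Uy ry; exact: ks.
- by move=> x Ux; apply: kahler_at_dR; exact: ks.
- move=> Y tau dtau; have [eta ke etaE] := ps Y tau dtau.
  exists (dR eta); first by move=> y Uy; apply: kahler_at_dR; exact: ke.
  have [_ htau _ _ _] := dtau.
  move=> y [Uy rty] ry D hD; have [e He] := ks _ (conj Uy rty).
  have Hp := represents_pullback htau rty He.
  have He' : represents_at y eta (kpull tau e).
    apply: represents_congr Hp.
    have [ctau _] := htau y.
    have n1 : \forall z \near y, (U `&` reg X) (tau z).
      apply: (ctau); apply: open_nbhs_nbhs; split => //; apply: openI => //; exact: open_reg.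
    by apply: filterS n1 => z Uz; apply: eqform_at_sym; exact: etaE.
  rewrite (dR_represents ry He')// /pullback (dR_represents rty He rty); last first.
    by move=> i; exact: derivation_push.
  rewrite -kform_kpull /kdiff /kpull -!map_comp; congr (kform _ y D).
  by apply: eq_map => u /=; congr (_, _); apply: val_inj.
Qed.

Lemma Lsheaf_kform q U (e : kexpr X q) : (forall x, U x -> kholo_at x e) ->
  Lsheaf X q U (kform e).
Proof.
move=> he; split.
- move=> x Ux; exists (fun=> 1); split; first exact: hol_cst.
    by apply: nearW => y /nbhs_singleton/eqP; rewrite oner_eq0.
  exists e; apply: represents_congr (represents_kform (he x Ux)).
  by apply: nearW => y ry D hD; rewrite mul1r.
- by move=> x [Ux _]; exists e; apply: represents_kform; exact: he.
- move=> Y tau [_ htau _ _ _]; exists (kform (kpull tau e)).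
    move=> y Uy; exists (kpull tau e); apply: represents_kform.
    by apply: kholo_kpull; [exact: htau|exact: he].
  by move=> y _ ry D hD; rewrite kform_kpull.
Qed.

End MeromorphicForms.

(** * Locally generated subsheaves *)

Section Subsheaves.
Variables (R : realType) (X : complexSpace R).
Local Notation fct := (X -> Cx R).
Local Notation form := (Defs.form X).
Implicit Types (x y : X) (f g h : fct) (U V W : set X).

Definition zero_form q : form q := fun _ _ => 0.
Arguments zero_form : clear implicits.

Section Submodule.
Variables (q : nat) (F : subsheaf X q).
Hypothesis sF : is_submodule F.

Lemma submodule_eq U s t : open U -> eqform U s t -> F U s -> F U t.
Proof. by have [H _ _ _ _] := sF; exact: H. Qed.

Lemma submodule_restrict U V s : open U -> open V -> V `<=` U -> F U s -> F V s.
Proof. by have [_ H _ _ _] := sF; exact: H. Qed.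

Lemma submodule_glue U s : open U ->
  (forall x, U x -> exists V, [/\ open V, V x, V `<=` U & F V s]) -> F U s.
Proof. by have [_ _ H _ _] := sF; exact: H. Qed.

Lemma submodule_linear U c s t : open U -> holo U c -> F U s -> F U t ->
  F U (fun x D => c x * s x D + t x D : Cx R).
Proof. by have [_ _ _ _ H] := sF; exact: H. Qed.

Lemma submodule0 U : open U -> F U (zero_form q).
Proof. by have [_ _ _ H _] := sF; exact: H. Qed.

Lemma submodule_scale U c s : open U -> holo U c -> F U s -> F U (fun x D => c x * s x D : Cx R).
Proof.
move=> oU hc Fs; apply: submodule_eq (submodule_linear oU hc Fs (submodule0 oU)) => //.
by move=> x Ux rx D hD; rewrite /zero_form addr0.
Qed.

Lemma submodule_add U s t : open U -> F U s -> F U t -> F U (fun x D => s x D + t x D : Cx R).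
Proof.
move=> oU Fs Ft.
have h1 : holo U (fun=> 1) by move=> x _; exact: hol_cst.
apply: submodule_eq (submodule_linear oU h1 Fs Ft) => //.
by move=> x Ux rx D hD; rewrite mul1r.
Qed.

Lemma submodule_sum U (I : Type) (l : seq I) (s : I -> form q) : open U ->
  (forall i, F U (s i)) -> F U (fun x D => \sum_(i <- l) s i x D : Cx R).
Proof.
move=> oU Fs; elim: l => [|i l IH].
  by apply: submodule_eq (submodule0 oU) => // x Ux rx D hD; rewrite big_nil.
apply: submodule_eq (submodule_add oU (Fs i) IH) => // x Ux rx D hD.
by rewrite big_cons.
Qed.

End Submodule.

(** This has the shape of [next_step], so the stages of [alpha_iter] and of [words] both unfold to
    it. *)
Definition locsum q (E : set X -> form q -> Prop) : subsheaf X q := fun U s =>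
  forall x, U x -> exists V m (t : 'I_m -> form q),
    [/\ open V, V x, V `<=` U, forall j, E V (t j) &
        eqform V s (fun y D => \sum_(j < m) t j y D)].

Lemma locsum_intro q (E : set X -> form q -> Prop) U s : open U -> E U s -> locsum E U s.
Proof.
move=> oU EU x Ux; exists U, 1%N, (fun=> s); split => //.
by move=> y Uy ry D hD; rewrite big_ord1.
Qed.

Lemma locsum_congr q (E : set X -> form q -> Prop) U s t : eqform U s t ->
  locsum E U t -> locsum E U s.
Proof.
move=> st Et x Ux; have [V [m [u [oV Vx VU Eu tu]]]] := Et x Ux.
exists V, m, u; split => // y Vy; exact: eqform_at_trans (st y (VU _ Vy)) (tu y Vy).
Qed.

Lemma locsum_mono q (E E' : set X -> form q -> Prop) U s :
  (forall V t, open V -> E V t -> E' V t) -> locsum E U s -> locsum E' U s.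
Proof.
move=> EE Es x Ux; have [V [m [u [oV Vx VU Eu tu]]]] := Es x Ux.
by exists V, m, u; split => // j; exact: EE.
Qed.

Section Transport.
Variables (q r : nat) (P : subsheaf X q) (E : set X -> form r -> Prop) (T : form r -> form q).
Hypothesis sP : is_submodule P.

(** One gluing argument serves products on either side and the differential. Additivity of T is
    asked only for decompositions into sections of E, since additivity of [dR] is known only for
    forms with Kaehler representations. *)
Lemma locsum_transport U s : open U ->
  (forall V m (t : 'I_m -> form r), open V -> V `<=` U -> (forall j, E V (t j)) ->
     eqform V s (fun y D => \sum_(j < m) t j y D) ->
     eqform V (T s) (fun y D => \sum_(j < m) T (t j) y D)) ->
  (forall V t, open V -> V `<=` U -> E V t -> P V (T t)) ->
  locsum E U s -> P U (T s).
Proof.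
move=> oU Tadd TE Es; apply: (submodule_glue sP) => // x Ux.
have [V [m [u [oV Vx VU Eu tu]]]] := Es x Ux.
exists V; split => //.
apply: (submodule_eq sP oV) (_ : P V (fun y D => \sum_(j < m) T (u j) y D)) => //.
  by move=> y Vy; apply: eqform_at_sym; exact: (Tadd V m u oV VU Eu tu y Vy).
by apply: (submodule_sum sP) => // j; exact: TE.
Qed.

End Transport.

Lemma locsum_sub q (P : subsheaf X q) (E : set X -> form q -> Prop) U s :
  is_submodule P -> open U -> (forall V t, open V -> V `<=` U -> E V t -> P V t) ->
  locsum E U s -> P U s.
Proof. by move=> sP oU EP; apply: (@locsum_transport _ _ P E id). Qed.

Lemma wedge_suml1 r s q (E : (r + s)%N = q) m (a : 'I_m -> form r) (b : form s) x D :
  wedge E (fun x D => \sum_(i < m) a i x D) b x D = \sum_(i < m) wedge E (a i) b x D.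
Proof.
have := wedge_suml E (index_enum 'I_m) (fun _ _ => 1) a b x D.
rewrite (_ : (fun x D => \sum_i 1 * a i x D) = (fun x D => \sum_i a i x D)).
  by move=> ->; apply: eq_bigr => i _; rewrite mul1r.
by apply/funext => y; apply/funext => D'; apply: eq_bigr => i _; rewrite mul1r.
Qed.

Lemma wedge_sumr1 r s q (E : (r + s)%N = q) m (a : form r) (b : 'I_m -> form s) x D :
  wedge E a (fun x D => \sum_(i < m) b i x D) x D = \sum_(i < m) wedge E a (b i) x D.
Proof.
have := wedge_sumr E (index_enum 'I_m) (fun _ _ => 1) a b x D.
rewrite (_ : (fun x D => \sum_i 1 * b i x D) = (fun x D => \sum_i b i x D)).
  by move=> ->; apply: eq_bigr => i _; rewrite mul1r.
by apply/funext => y; apply/funext => D'; apply: eq_bigr => i _; rewrite mul1r.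
Qed.

Lemma locsum_wedgel r s q (E : (r + s)%N = q) (P : subsheaf X q) (G : set X -> form r -> Prop)
    U a (b : form s) : is_submodule P -> open U ->
  (forall V t, open V -> V `<=` U -> G V t -> P V (wedge E t b)) ->
  locsum G U a -> P U (wedge E a b).
Proof.
move=> sP oU; apply: (@locsum_transport _ _ P G (fun a => wedge E a b)) => //.
move=> V m t oV VU Gt at_ y Vy ry D hD.
by rewrite (wedgeE_congr E (at_ y Vy) (eqform_at_refl b) ry hD) wedge_suml1.
Qed.

Lemma locsum_wedger r s q (E : (r + s)%N = q) (P : subsheaf X q) (G : set X -> form s -> Prop)
    U (a : form r) b : is_submodule P -> open U ->
  (forall V t, open V -> V `<=` U -> G V t -> P V (wedge E a t)) ->
  locsum G U b -> P U (wedge E a b).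
Proof.
move=> sP oU; apply: (@locsum_transport _ _ P G (fun b => wedge E a b)) => //.
move=> V m t oV VU Gt bt y Vy ry D hD.
by rewrite (wedgeE_congr E (eqform_at_refl a) (bt y Vy) ry hD) wedge_sumr1.
Qed.

Lemma locsum_dR q (P : subsheaf X q.+1) (G : set X -> form q -> Prop) U a :
  is_submodule P -> open U ->
  (forall V t, open V -> V `<=` U -> G V t -> Lsheaf X q V t /\ P V (dR t)) ->
  locsum G U a -> P U (dR a).
Proof.
move=> sP oU GP; apply: (@locsum_transport _ _ P G (@dR R X q)) => //; last first.
  by move=> V t oV VU /(GP V t oV VU)[].
move=> V m t oV VU Gt at_ y Vy ry D hD.
have nV : \forall z \near y, eqform_at z a (fun y D => \sum_(j < m) t j y D).
  have nV : \forall z \near y, V z by exact: open_nbhs_nbhs.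
  by apply: filterS nV => z; exact: at_.
rewrite (dR_congr nV) dR_sum// => j.
by have [Lt _] := GP V _ oV VU (Gt j); exact: Lsheaf_kahler Lt Vy ry.
Qed.

(** Sums are obtained by concatenating families over an intersection, so E itself need only be
    stable under restriction and under multiplication by holomorphic functions. *)
Lemma locsum_submodule q (E : set X -> form q -> Prop) :
  (forall U V t, open U -> open V -> V `<=` U -> E U t -> E V t) ->
  (forall V c t, open V -> holo V c -> E V t ->
     exists2 t', E V t' & eqform V (fun y D => c y * t y D) t') ->
  is_submodule (locsum E).
Proof.
move=> Er Es; split.
- move=> U s t oU st; apply: locsum_congr => x Ux; exact: eqform_at_sym (st x Ux).
- move=> U V s oU oV VU EU x Vx; have [W [m [t [oW Wx WU Et st]]]] := EU x (VU x Vx).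
  exists (W `&` V), m, t; split => //.
  + exact: openI.
  + by move=> j; exact: (Er W _ _ oW (openI oW oV) (@subIsetl _ _ _) (Et j)).
  + by move=> y [Wy _]; exact: st.
- move=> U s oU H x Ux; have [V [oV Vx VU EV]] := H x Ux.
  have [W [m [t [oW Wx WV Et st]]]] := EV x Vx.
  by exists W, m, t; split => // y /WV/VU.
- move=> U oU x Ux; exists U, 0%N, (fun=> zero_form q); split => //; first by case.
  by move=> y Uy ry D hD; rewrite big_ord0.
- move=> U c s t oU hc EUs EUt x Ux.
  have [W [m [u [oW Wx WU Eu su]]]] := EUs x Ux.
  have [W' [m' [u' [oW' Wx' WU' Eu' tu']]]] := EUt x Ux.
  have oI := openI oW oW'.
  have EuI i : E (W `&` W') (u i) := Er W _ _ oW oI (@subIsetl _ _ _) (Eu i).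
  have Eu'I i : E (W `&` W') (u' i) := Er W' _ _ oW' oI (@subIsetr _ _ _) (Eu' i).
  have hcI : holo (W `&` W') c by move=> y [/WU Uy _]; exact: hc.
  have /fin_all_exists2[v Ev cv] i : exists2 t', E (W `&` W') t' &
      eqform (W `&` W') (fun y D => c y * u i y D) t' by exact: Es.
  exists (W `&` W'), (m + m')%N, (fun k => match fintype.split k with inl i => v i | inr j => u' j end).
  split => //; first by move=> y [/WU].
    by move=> j; case: fintype.split => k.
  move=> y [Wy W'y] ry D hD; rewrite big_split_ord /= su// tu'// mulr_sumr.
  congr (_ + _); apply: eq_bigr => i _.
    rewrite -[lshift _ i]/(unsplit (inl i)) unsplitK; exact: cv.
  by rewrite -[rshift _ i]/(unsplit (inr i)) unsplitK.
Qed.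

End Subsheaves.

(** * Bounded coefficients and sections of alpha *)

Section Alpha.
Variables (R : realType) (X : complexSpace R).
Local Notation fct := (X -> Cx R).
Local Notation form := (Defs.form X).
Implicit Types (x y : X) (f g h : fct) (U V W : set X).

Lemma ofR_bound (c : Cx R) : exists2 M : R, 0 <= M & `|c| <= ofR M.
Proof.
exists (`|re c| + `|im c|); [exact: addr_ge0|exact: norm_le_reim].
Qed.

(** The bound is taken nonnegative so that bounds can be multiplied. *)
Definition regular_bounded x f : Prop :=
  exists2 M : R, 0 <= M & \forall y \near x, reg X y -> `|f y| <= ofR M.

Lemma regular_bounded_hol x f : hol_at x f -> regular_bounded x f.
Proof.
move=> hf; have [M M0 fM] := ofR_bound (f x).
exists (M + 1); first by rewrite addr_ge0.
have /cvgrPdist_lt/(_ 1 ltr01) : f @ x --> f x := hol_cont hf.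
apply: filterS => y fy _; rewrite -[f y](subKr (f x)) ofRD ofR1.
apply: le_trans (ler_normB _ _) _; apply: lerD => //; exact: ltW.
Qed.

Lemma regular_boundedM x f g : regular_bounded x f -> regular_bounded x g ->
  regular_bounded x (fun y => f y * g y).
Proof.
move=> [M M0 fM] [N N0 gN]; exists (M * N); first exact: mulr_ge0.
apply: filterS2 fM gN => y fM gN ry; rewrite normrM ofRM.
by apply: ler_pM => //; [exact: fM|exact: gN].
Qed.

Lemma regular_bounded_sum x (I : Type) (l : seq I) (F : I -> fct) :
  (forall i, regular_bounded x (F i)) -> regular_bounded x (fun y => \sum_(i <- l) F i y).
Proof.
move=> bF; elim: l => [|i l [N N0 IH]].
  by exists 0 => //; apply: nearW => y _; rewrite big_nil normr0 ofR0.
have [M M0 FM] := bF i; exists (M + N); first exact: addr_ge0.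
apply: filterS2 FM IH => y FM IH ry; rewrite big_cons ofRD.
by apply: le_trans (ler_normD _ _) _; apply: lerD; [exact: FM|exact: IH].
Qed.

Lemma regular_bounded_congr x f g : (\forall y \near x, reg X y -> f y = g y) ->
  regular_bounded x f -> regular_bounded x g.
Proof.
move=> fg [M M0 fM]; exists M => //.
by apply: filterS2 fg fM => y fg fM ry; rewrite -fg//; exact: fM.
Qed.

(* A 0-form is a function: its tuples of tangent vectors are all equal to this one. *)
Definition no_derivation : 'I_0 -> fct -> Cx R := fun _ _ => 0.
Definition value (s : form 0) : fct := fun y => s y no_derivation.

Lemma value_eqform x (s t : form 0) : eqform_at x s t -> reg X x -> value s x = value t x.
Proof. by move=> st rx; apply: st => // -[]. Qed.

Lemma hol_value x (s : form 0) : kahler_at x s -> reg X x -> hol_at x (value s).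
Proof.
move=> [e [he se]] rx.
have nr : \forall y \near x, reg X y by apply: open_nbhs_nbhs; split => //; exact: open_reg.
apply: (hol_eq (f := fun y => \sum_(u <- e) u.1 y)); last first.
  by apply: hol_sum_in => u /he[].
near=> y.
have sy : eqform_at y s (kform e) by near: y.
have ry : reg X y by near: y.
by rewrite (value_eqform sy ry) /value kformE; apply: eq_bigr => u _; rewrite kdet0 mulr1.
Unshelve. all: by end_near. Qed.

Lemma kahler_value_bounded x (s : form 0) : kahler_at x s -> regular_bounded x (value s).
Proof.
move=> [e [he se]].
have : regular_bounded x (fun y => \sum_(u <- e) u.1 y).
  by apply: regular_bounded_hol; apply: hol_sum_in => u /he[].
apply: regular_bounded_congr; apply: filterS se => y sy ry.
by rewrite (value_eqform sy ry) /value kformE; apply: eq_bigr => u _; rewrite kdet0 mulr1.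
Qed.

Lemma bounded_near_singP V rho :
  bounded_near_sing V rho <-> forall x, (V `&` sing X) x -> regular_bounded x rho.
Proof.
split=> H x Vx; last by have [M _ HM] := H x Vx; exists M.
have [M HM] := H x Vx; exists `|M| => //; apply: filterS HM => y HM ry.
by apply: le_trans (HM ry) _; rewrite ofR_le ler_norm.
Qed.

Lemma alpha_Lsheaf q U s : alpha X q U s -> Lsheaf X q U s. Proof. by case. Qed.

Lemma alpha_kform q U (e : kexpr X q) : open U -> (forall x, U x -> kholo_at x e) ->
  alpha X q U (kform e).
Proof.
move=> oU he; split; first exact: Lsheaf_kform.
move=> x Ux; exists U, 1%N, (fun _ _ => 1), (fun=> kform e); split => //.
  move=> _; split; first by move=> y Uy; exists e; apply: represents_kform; exact: he.
  split; last by move=> y [_ ry]; apply: smooth_hol => //; exact: hol_cst.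
  by apply/bounded_near_singP => y _; apply: regular_bounded_hol; exact: hol_cst.
by move=> y Uy ry D hD; rewrite /lincomb big_ord1 mul1r.
Qed.

Lemma alpha_wedge0 r q (E : (r + 0)%N = q) U (t : form r) (s : form 0) : open U ->
  alpha X r U t -> alpha X 0 U s -> alpha X q U (wedge E t s).
Proof.
move=> oU [Lt Ht] [Ls Hs]; split; first exact: Lsheaf_wedge.
have Er : r = q by rewrite -E addn0.
case: q / Er in E *.
move=> x Ux; have [V [m [rho [omega [oV Vx VU Hj tE]]]]] := Ht x Ux.
exists V, m, (fun j y => value s y * rho j y), omega; split => //.
  move=> j; have [kj [bj sj]] := Hj j; split; first exact: kj.
  split; last first.
    move=> y [Vy ry]; apply: smooth_hol_mul; last exact: sj.
    by apply: hol_value => //; exact: Lsheaf_kahler Ls (VU _ Vy) ry.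
  apply/bounded_near_singP => y [Vy sy]; apply: regular_boundedM; last first.
    by apply: (iffLR (bounded_near_singP _ _) bj).
  (* Boundedness of the value of s at y comes from a decomposition of s around y: bounded
     coefficients times values of Kaehler 0-forms, which agree on the regular part with continuous
     functions. *)
  have [V' [m' [rho' [omega' [oV' V'y V'U Hj' sE']]]]] := Hs y (VU _ Vy).
  have : regular_bounded y (fun z => \sum_(i < m') rho' i z * value (omega' i) z).
    apply: regular_bounded_sum => i; have [ki [bi _]] := Hj' i.
    apply: regular_boundedM; first by apply: (iffLR (bounded_near_singP _ _) bi).
    by apply: kahler_value_bounded; exact: ki.
  apply: regular_bounded_congr.
  have nV : \forall z \near y, V' z by exact: open_nbhs_nbhs.
  apply: filterS nV => z V'z rz.
  by rewrite (value_eqform (sE' z V'z) rz).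
move=> y Vy ry D hD.
have kt := Lsheaf_kahler Lt (VU _ Vy) ry; have ks := Lsheaf_kahler Ls (VU _ Vy) ry.
rewrite (wedge0_scale E (D0 := no_derivation) kt ks)//; last by case.
rewrite tE// /lincomb mulr_sumr; apply: eq_bigr => j _.
by rewrite -mulrA.
Qed.

(** The holomorphic form dh is absorbed into the forms omega_j, leaving the bounded coefficients
    unchanged. *)
Lemma alpha_kahler1 q (E : (1 + q)%N = q.+1) U h (g : form q) : open U -> holo U h ->
  alpha X q U g -> alpha X q.+1 U (wedge E (kform (kdiff (kfun h))) g).
Proof.
move=> oU hh [Lg Hg].
have he x : U x -> kholo_at x (kdiff (kfun h)).
  by move=> Ux; apply: kholo_kdiff; apply: kholo_kfun; exact: hh.
split; first by apply: Lsheaf_wedge => //; exact: Lsheaf_kform.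
move=> x Ux; have [V [m [rho [omega [oV Vx VU Hj gE]]]]] := Hg x Ux.
exists V, m, rho, (fun j => wedge E (kform (kdiff (kfun h))) (omega j)); split => //.
  move=> j; have [kj bsj] := Hj j; split => //.
  move=> y Vy; apply: kahler_at_wedge; last exact: kj.
  by exists (kdiff (kfun h)); apply: represents_kform; exact: he (VU _ Vy).
move=> y Vy ry D hD.
rewrite (wedgeE_congr E (eqform_at_refl _) (gE y Vy) ry hD) /lincomb.
exact: wedge_sumr.
Qed.

End Alpha.

(** * The filtration of beta by word length *)

Section Words.
Variables (R : realType) (X : complexSpace R).
Hypothesis hL : forall q : nat, coherent (Lsheaf X q).
Hypothesis halpha : forall q : nat, coherent (alpha X q).
Local Notation fct := (X -> Cx R).
Local Notation form := (Defs.form X).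
Implicit Types (x y : X) (f g h : fct) (U V W : set X).

(* Unlike [next_step], the second factor stays in alpha, so that [words k] consists of the local
   sums of words with k + 1 letters, the first of them in alpha. *)
Definition letter_step (F : graded_subsheaf X) q V (t : form q) : Prop :=
  (exists r s (E : (r + s)%N = q) (a : form r) (b : form s),
     [/\ F r V a, alpha X s V b & t = wedge E a b]) \/
  (exists r s (E : (r + s.+1)%N = q) (a : form r) (b : form s),
     [/\ F r V a, alpha X s V b & t = wedge E a (dR b)]).

Fixpoint words (k : nat) : graded_subsheaf X :=
  if k is k'.+1 then fun q => locsum (letter_step (words k') (q := q)) else alpha X.

Let sL q : is_submodule (Lsheaf X q). Proof. by have [] := hL q. Qed.
Let salpha q : is_submodule (alpha X q). Proof. by have [] := halpha q. Qed.

Arguments words k [q] U s.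

Definition graded_submodule (F : graded_subsheaf X) : Prop :=
  (forall q, is_submodule (F q)) /\ (forall q U s, open U -> F q U s -> Lsheaf X q U s).

(** A coefficient is always absorbed into the first factor; it could not be moved inside [dR b],
    since d is not linear over functions. *)
Lemma words_graded_submodule k : graded_submodule (@words k).
Proof.
elim: k => [|k [sF FL]]; first by split => // q U s _; exact: alpha_Lsheaf.
have Lstep q V t : open V -> letter_step (@words k) V t -> Lsheaf X q V t.
  move=> oV [[r [s [E [a [b [Fa Fb ->]]]]]]|[r [s [E [a [b [Fa Fb ->]]]]]]].
    by apply: Lsheaf_wedge; [exact: FL|exact: alpha_Lsheaf].
  by apply: Lsheaf_wedge; [exact: FL|apply: Lsheaf_dR => //; exact: alpha_Lsheaf].
split=> q; last first.
  by move=> U s oU; apply: (locsum_sub (sL q) oU) => V t oV _; exact: Lstep.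
apply: locsum_submodule => [U V t oU oV VU|V c t oV hc].
  move=> [[r [s [E [a [b [Fa Fb tE]]]]]]|[r [s [E [a [b [Fa Fb tE]]]]]]]; [left|right];
    exists r, s, E, a, b; split => //;
    by [exact: (submodule_restrict (sF r) oU)|exact: (submodule_restrict (salpha s) oU)].
have cw r s (E : (r + s)%N = q) (a : form r) (b : form s) :
    (fun y D => c y * wedge E a b y D) = wedge E (fun y D => c y * a y D : Cx R) b.
  apply/funext => y; apply/funext => D; rewrite /wedge mulrCA mulr_sumr; congr (_ * _).
  by apply: eq_bigr => p _; rewrite -mulr_shuffle_head !mulrA.
move=> [[r [s [E [a [b [Fa Fb ->]]]]]]|[r [s [E [a [b [Fa Fb ->]]]]]]].
  exists (wedge E (fun y D => c y * a y D : Cx R) b); last by rewrite cw.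
  left; exists r, s, E, (fun y D => c y * a y D : Cx R), b; split => //.
  exact: (submodule_scale (sF r)).
exists (wedge E (fun y D => c y * a y D : Cx R) (dR b)); last by rewrite cw.
right; exists r, s, E, (fun y D => c y * a y D : Cx R), b; split => //.
exact: (submodule_scale (sF r)).
Qed.

Lemma words_submodule k q : is_submodule (@words k q).
Proof. by have [] := words_graded_submodule k. Qed.

Lemma words_Lsheaf k q U s : open U -> words k U s -> Lsheaf X q U s.
Proof. by have [_] := words_graded_submodule k; exact. Qed.

Lemma words_kahler k q U (s : form q) y : open U -> words k U s -> U y -> reg X y -> kahler_at y s.
Proof. by move=> oU ws; exact: Lsheaf_kahler (words_Lsheaf oU ws). Qed.

Lemma alpha_kahler q U (s : form q) y : alpha X q U s -> U y -> reg X y -> kahler_at y s.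
Proof. by move=> /alpha_Lsheaf; exact: Lsheaf_kahler. Qed.

Lemma words_wedge k r s q (E : (r + s)%N = q) U (a : form r) (b : form s) : open U ->
  words k U a -> alpha X s U b -> words k.+1 U (wedge E a b).
Proof.
by move=> oU wa ab; apply: locsum_intro => //; left; exists r, s, E, a, b.
Qed.

Lemma words_wedge_dR k r s q (E : (r + s.+1)%N = q) U (a : form r) (b : form s) : open U ->
  words k U a -> alpha X s U b -> words k.+1 U (wedge E a (dR b)).
Proof.
by move=> oU wa ab; apply: locsum_intro => //; right; exists r, s, E, a, b.
Qed.

Definition one_form : form 0 := kform (kfun (fun=> 1)).

Lemma kholo_one x : kholo_at x (kfun (fun _ : X => 1 : Cx R)).
Proof. by apply: kholo_kfun; exact: hol_cst. Qed.

Lemma alpha_one U : open U -> alpha X 0 U one_form.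
Proof. by move=> oU; apply: alpha_kform => // x _; exact: kholo_one. Qed.

Lemma kahler_one x : kahler_at x one_form.
Proof. by exists (kfun (fun=> 1)); apply: represents_kform; exact: kholo_one. Qed.

(** Words are padded with the letter 1, a section of alpha in degree 0. *)
Lemma wordsS k q U (s : form q) : open U -> words k U s -> words k.+1 U s.
Proof.
move=> oU ws; apply: (submodule_eq (words_submodule k.+1 q) oU) (words_wedge (addn0 q) oU ws (alpha_one oU)).
by move=> y Uy ry; exact: (wedge1 (addn0 q) (words_kahler oU ws Uy ry) ry).
Qed.

Lemma words_le k l q U (s : form q) : (k <= l)%N -> open U -> words k U s -> words l U s.
Proof.
move=> /subnK <- oU ws; elim: (l - k)%N => // n IH; exact: wordsS.
Qed.

(* The factor of degree 0 commutes with the last letter until it reaches a letter in alpha. *)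
Lemma words_wedge0 k r q (E : (r + 0)%N = q) U (a : form r) (b : form 0) : open U ->
  words k U a -> alpha X 0 U b -> words k U (wedge E a b).
Proof.
elim: k r q E U a b => [|k IH] r q E U a b oU.
  by move=> aa ab; exact: alpha_wedge0.
move=> wa ab; apply: (locsum_wedgel (words_submodule k.+1 q) oU _ wa).
move=> V t oV VU.
have abV := submodule_restrict (salpha 0) oU oV VU ab.
move=> [[u [v [E1 [c [d [wc ad ->]]]]]]|[u [v [E1 [c [d [wc ad ->]]]]]]].
  have E2 : (u + v)%N = q by rewrite E1 -E addn0.
  have E3 : (v + 0)%N = v by rewrite addn0.
  apply: (submodule_eq (words_submodule k.+1 q) oV)
    (words_wedge E2 oV wc (alpha_wedge0 E3 oV ad abV)).
  move=> y Vy ry; have kc := words_kahler oV wc Vy ry.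
  have kd := alpha_kahler ad Vy ry; have kb := alpha_kahler abV Vy ry.
  exact: (wedge_assoc E2 E3 E E1 kc kd kb ry).
have E2 : (u + v.+1)%N = q by rewrite E1 -E addn0.
have E3 : (u + 0)%N = u by rewrite addn0.
apply: (submodule_eq (words_submodule k.+1 q) oV)
  (words_wedge_dR E2 oV (IH u u E3 V c b oV wc abV) ad).
move=> y Vy ry.
have kc := words_kahler oV wc Vy ry; have kd := kahler_at_dR (alpha_kahler ad Vy ry).
have kb := alpha_kahler abV Vy ry.
have E4 : (v.+1 + 0)%N = v.+1 by rewrite addn0.
have E5 : (0 + v.+1)%N = v.+1 by [].
have A1 := wedge_assoc E2 E4 E E1 kc kd kb.
have A2 := wedgeE_congr E2 (eqform_at_refl c) (wedge0C E4 E5 kd kb).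
have A3 := wedge_assoc E2 E5 E2 E3 kc kb kd.
exact: (eqform_at_trans (eqform_at_sym A3) (eqform_at_trans (eqform_at_sym A2) A1)) ry.
Qed.

(* A word with more than q + 1 letters contains a letter of degree 0 that is not the first one. *)
Lemma words_degreeS k q U (s : form q) : (q <= k)%N -> open U -> words k.+1 U s -> words k U s.
Proof.
elim: k q U s => [|k IH] q U s qk oU ws;
  apply: (locsum_sub (words_submodule _ q) oU _ ws) => V t oV VU.
  move=> [[u [v [E [c [d [wc ad ->]]]]]]|[u [v [E [c [d [wc ad ->]]]]]]]; last by lia.
  have v0 : v = 0%N by lia.
  by subst v; exact: words_wedge0.
(* A last letter of degree 0 is absorbed by the rest. Otherwise the rest has degree at most k, and
   the induction hypothesis shortens it. *)
move=> [[u [v [E [c [d [wc ad ->]]]]]]|[u [v [E [c [d [wc ad ->]]]]]]].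
  case: v E d ad => [|v] E d ad; first exact: words_wedge0.
  by apply: words_wedge => //; apply: IH => //; lia.
by apply: words_wedge_dR => //; apply: IH => //; lia.
Qed.

Lemma words_degree k q U (s : form q) : open U -> words k U s -> words q U s.
Proof.
move=> oU ws; have [kq|qk] := leqP k q; first exact: words_le ws.
have : (q <= k)%N by exact: ltnW.
move=> /subnK; move: (k - q)%N => n kE; move: ws; rewrite -kE.
by elim: n {kE} => // n IH ws; apply: IH; apply: words_degreeS ws => //; exact: leq_addl.
Qed.

(** Level k means k + 1 letters, so the product has k + l + 2 letters, which is level [(k + l).+1].
    The letters of b are detached from the right by associativity. *)
Lemma words_mul k l r s q (E : (r + s)%N = q) U (a : form r) (b : form s) : open U ->
  words k U a -> words l U b -> words (k + l).+1 U (wedge E a b).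
Proof.
elim: l s q E U a b => [|l IH] s q E U a b oU wa.
  by rewrite addn0 => ab; exact: words_wedge.
move=> wb; rewrite addnS; apply: (locsum_wedger (words_submodule _ q) oU _ wb).
move=> V t oV VU; have waV := submodule_restrict (words_submodule k r) oU oV VU wa.
move=> [[u [v [E1 [c [d [wc ad ->]]]]]]|[u [v [E1 [c [d [wc ad ->]]]]]]].
  have E2 : (r + u + v)%N = q by rewrite -addnA E1.
  apply: (submodule_eq (words_submodule _ q) oV)
    (words_wedge E2 oV (IH u _ erefl V a c oV waV wc) ad).
  move=> y Vy; apply: eqform_at_sym => ry; have ka := words_kahler oV waV Vy ry.
  have kc := words_kahler oV wc Vy ry; have kd := alpha_kahler ad Vy ry.
  exact: (wedge_assoc E E1 E2 erefl ka kc kd ry).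
have E2 : (r + u + v.+1)%N = q by rewrite -addnA E1.
apply: (submodule_eq (words_submodule _ q) oV)
  (words_wedge_dR E2 oV (IH u _ erefl V a c oV waV wc) ad).
move=> y Vy; apply: eqform_at_sym => ry; have ka := words_kahler oV waV Vy ry.
have kc := words_kahler oV wc Vy ry; have kd := kahler_at_dR (alpha_kahler ad Vy ry).
exact: (wedge_assoc E E1 E2 erefl ka kc kd ry).
Qed.

Lemma words_dR k q U (a : form q) : open U -> words k U a -> words k.+1 U (dR a).
Proof.
elim: k q U a => [|k IH] q U a oU wa.
  (* The first letter of a word lies in alpha, so the differential of a single letter is written 1
     /\ da; hence the extra level. *)
  have E1 : (0 + q.+1)%N = q.+1 by [].
  have E2 : (q.+1 + 0)%N = q.+1 by rewrite addn0.
  apply: (submodule_eq (words_submodule 1 q.+1) oU)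
    (words_wedge_dR (k := 0) E1 oU (alpha_one oU) wa).
  move=> y Uy ry; have kd := kahler_at_dR (alpha_kahler wa Uy ry).
  have C := wedge0C E2 E1 kd (kahler_one y).
  exact: (eqform_at_trans (eqform_at_sym C) (wedge1 E2 kd)) ry.
apply: (locsum_dR (words_submodule _ q.+1) oU _ wa) => V t oV VU tl; split.
  by apply: (words_Lsheaf (k := k.+1)) => //; exact: locsum_intro.
have sQ := words_submodule k.+2 q.+1.
move: tl => [[u [v [E [c [d [wc ad ->]]]]]]|[u [v [E [c [d [wc ad ->]]]]]]].
  have E1 : (u.+1 + v)%N = q.+1 by rewrite -E.
  have E2 : (u + v.+1)%N = q.+1 by rewrite -E addnS.
  have w1 : words k.+2 V (wedge E1 (dR c) d) by apply: words_wedge => //; exact: IH.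
  have w2 : words k.+2 V (wedge E2 c (dR d)) by apply: wordsS => //; exact: words_wedge_dR.
  have hs : holo V (fun=> leibniz_sign R q u) by move=> y _; exact: hol_cst.
  apply: (submodule_eq sQ oV) (submodule_linear sQ oV hs w2 w1).
  move=> y Vy ry D hD; rewrite (dR_wedge E E1 E2)//; first by rewrite addrC.
    exact: words_kahler wc Vy ry.
  exact: alpha_kahler ad Vy ry.
have E1 : (u.+1 + v.+1)%N = q.+1 by rewrite -E.
have E2 : (u + v.+2)%N = q.+1 by rewrite -E addnS.
have w1 : words k.+2 V (wedge E1 (dR c) (dR d)) by apply: words_wedge_dR => //; exact: IH.
apply: (submodule_eq sQ oV) w1 => y Vy ry D hD.
have kc := words_kahler oV wc Vy ry; have kd := alpha_kahler ad Vy ry.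
rewrite (dR_wedge E E1 E2 kc (kahler_at_dR kd))//.
rewrite (wedgeE_congr E2 (eqform_at_refl c) (dR_dR kd) ry hD).
have -> : wedge E2 c (fun _ _ => 0) y D = 0.
  by rewrite /wedge big1 ?mulr0// => p _; rewrite mulr0.
by rewrite mulr0 addr0.
Qed.

Lemma alpha_alpha_iter p q U (s : form q) : open U -> alpha X q U s -> @alpha_iter R X p q U s.
Proof.
elim: p q U s => // p IH q U s oU as_.
apply: (locsum_congr (t := wedge (addn0 q) s one_form)).
  move=> y Uy; apply: eqform_at_sym => ry.
  exact: (wedge1 (addn0 q) (alpha_kahler as_ Uy ry) ry).
apply: locsum_intro => //; left; exists q, 0%N, (addn0 q), s, one_form; split => //.
  exact: IH.
by apply: IH => //; exact: alpha_one.
Qed.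

Lemma words_alpha_iter k q U (s : form q) : open U -> words k U s -> @alpha_iter R X k q U s.
Proof.
elim: k q U s => // k IH q U s oU.
apply: locsum_mono => V t oV.
move=> [[u [v [E [c [d [wc ad ->]]]]]]|[u [v [E [c [d [wc ad ->]]]]]]]; [left|right];
  exists u, v, E, c, d; split => //; by [exact: IH|exact: alpha_alpha_iter].
Qed.

Lemma alpha_iter_words p : exists k, forall q U (s : form q), open U ->
  @alpha_iter R X p q U s -> words k U s.
Proof.
elim: p => [|p [k IH]]; first by exists 0%N.
(* The level is dictated by products a /\ db, where db has one letter more than b. It depends on p
   only, as the statement requires. *)
exists (k + k.+1).+1 => q U s oU; apply: (locsum_sub (words_submodule _ q) oU) => V t oV VU.
move=> [[u [v [E [c [d [Fc Fd ->]]]]]]|[u [v [E [c [d [Fc Fd ->]]]]]]].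
  apply: (words_le (k := (k + k).+1)) => //; first by rewrite ltnS leq_add2l.
  by apply: words_mul => //; exact: IH.
by apply: words_mul => //; [exact: IH|apply: words_dR => //; exact: IH].
Qed.

(** The stage p varies with the point, but [words_degree] replaces every local level by the degree
    q, after which the local pieces glue. *)
Lemma beta_words q U (s : form q) : open U -> beta X q U s <-> words q U s.
Proof.
move=> oU; split=> [bs|ws].
  apply: (submodule_glue (words_submodule q q)) => // x Ux.
  have [V [p [oV Vx VU ps]]] := bs x Ux; exists V; split => //.
  by have [k Hk] := alpha_iter_words p; exact: words_degree (Hk _ _ _ oV ps).
by move=> x Ux; exists U, q; split => //; exact: words_alpha_iter.
Qed.

End Words.

(** * Finite type *)

Section GermSpan.
Variables (R : realType) (X : complexSpace R).
Local Notation fct := (X -> Cx R).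
Local Notation form := (Defs.form X).
Implicit Types (x y : X) (U V W : set X).

(** Generators may be repeated in the family g, so sums of combinations are plain concatenations;
    repetitions are collected in [finite_typeP]. *)
Definition germ_span q y (G : seq (form q)) (t : form q) : Prop :=
  exists W (m : nat) (c : 'I_m -> fct) (g : 'I_m -> form q),
    [/\ open W, W y, forall i, holo W (c i), forall i, g i \in G & eqform W t (lincomb c g)].

Section Closure.
Variables (q : nat) (y : X) (G : seq (form q)).

Lemma germ_span_congr W s t : open W -> W y -> eqform W s t -> germ_span y G t -> germ_span y G s.
Proof.
move=> oW Wy st [W' [m [c [g [oW' Wy' hc gG tE]]]]].
exists (W `&` W'), m, c, g; split => //; first exact: openI.
  by move=> i z [_ Wz]; exact: hc.
by move=> z [Wz Wz']; exact: eqform_at_trans (st z Wz) (tE z Wz').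
Qed.

Lemma germ_span0 : germ_span y G (@zero_form R X q).
Proof.
exists setT, 0%N, (fun _ _ => 0), (fun=> @zero_form R X q); split => //; try by case.
  exact: openT.
by move=> z _ rz D hD; rewrite /lincomb big_ord0.
Qed.

Lemma germ_span_gen t : t \in G -> germ_span y G t.
Proof.
move=> tG; exists setT, 1%N, (fun _ _ => 1), (fun=> t); split => //.
- exact: openT.
- by move=> _ z _; exact: hol_cst.
- by move=> z _ rz D hD; rewrite /lincomb big_ord1 mul1r.
Qed.

Lemma germ_span_linear h s t : hol_at y h -> germ_span y G s -> germ_span y G t ->
  germ_span y G (fun z D => h z * s z D + t z D : Cx R).
Proof.
move=> hh [W [m [c [g [oW Wy hc gG sE]]]]] [W' [m' [c' [g' [oW' Wy' hc' gG' tE]]]]].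
pose H := interior [set z | hol_at z h].
have oH : open H by exact: open_interior.
have Hy : H y by exact: (hol_near hh).
exists (W `&` W' `&` H), (m + m')%N,
  (fun k => match fintype.split k with inl i => fun z => h z * c i z | inr j => c' j end),
  (fun k => match fintype.split k with inl i => g i | inr j => g' j end).
split.
- by apply: openI => //; exact: openI.
- by [].
- move=> k z [[Wz Wz'] Hz]; case: fintype.split => i; last exact: hc'.
  by apply: hol_mul; [exact: (interior_subset Hz)|exact: hc].
- by move=> k; case: fintype.split => i.
move=> z [[Wz Wz'] Hz] rz D hD; rewrite sE// tE// /lincomb big_split_ord /= mulr_sumr.
congr (_ + _); apply: eq_bigr => i _.
  by rewrite -[lshift _ i]/(unsplit (inl i)) unsplitK mulrA.
by rewrite -[rshift _ i]/(unsplit (inr i)) unsplitK.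
Qed.

Lemma germ_span_lincomb m W (c : 'I_m -> fct) (s : 'I_m -> form q) : W y ->
  (forall i, holo W (c i)) -> (forall i, germ_span y G (s i)) ->
  germ_span y G (lincomb c s).
Proof.
move=> Wy hc Gs; rewrite /lincomb; elim: (index_enum _) => [|i l IH].
  apply: (germ_span_congr openT _ _ germ_span0) => // z _ rz D hD.
  by rewrite big_nil.
apply: (germ_span_congr openT _ _ (germ_span_linear (hc i y Wy) (Gs i) IH)) => // z _ rz D hD.
by rewrite big_cons.
Qed.

End Closure.

Lemma germ_span_wedgel r s q (E : (r + s)%N = q) y (G : seq (form r)) (G' : seq (form q)) (a : form r) (b : form s) :
  (forall g, g \in G -> germ_span y G' (wedge E g b)) -> germ_span y G a ->
  germ_span y G' (wedge E a b).
Proof.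
move=> GG [W [m [c [g [oW Wy hc gG aE]]]]].
apply: (germ_span_congr oW Wy) (germ_span_lincomb Wy hc (fun i => GG _ (gG i))).
move=> z Wz rz D hD; rewrite (wedgeE_congr E (aE z Wz) (eqform_at_refl b) rz hD).
exact: wedge_suml.
Qed.

Lemma germ_span_wedger r s q (E : (r + s)%N = q) y (G : seq (form s)) (G' : seq (form q)) (a : form r) (b : form s) :
  (forall g, g \in G -> germ_span y G' (wedge E a g)) -> germ_span y G b ->
  germ_span y G' (wedge E a b).
Proof.
move=> GG [W [m [c [g [oW Wy hc gG bE]]]]].
apply: (germ_span_congr oW Wy) (germ_span_lincomb Wy hc (fun i => GG _ (gG i))).
move=> z Wz rz D hD; rewrite (wedgeE_congr E (eqform_at_refl a) (bE z Wz) rz hD).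
exact: wedge_sumr.
Qed.

Definition finitely_generated_at q (F : subsheaf X q) x : Prop :=
  exists V (G : seq (form q)), [/\ open V, V x, forall g, g \in G -> F V g &
    forall W t, open W -> W `<=` V -> F W t -> forall y, W y -> germ_span y G t].

Lemma finite_typeP q (F : subsheaf X q) :
  finite_type (@eqform R X q) (@lincomb R X q) F setT <-> forall x, finitely_generated_at F x.
Proof.
split=> [H x|H x _].
  have [V [m [s [oV Vx _ Fs gen]]]] := H x I.
  exists V, (codom s); split => //; first by move=> g /codomP[i ->].
  move=> W t oW WV Ft y Wy; have [W' [c [oW' Wy' WW hc tE]]] := gen W t oW WV Ft y Wy.
  by exists W', m, c, s; split => // i; exact: codom_f.
have [V [G [oV Vx GF gen]]] := H x.
exists V, (size G), (fun i => nth (@zero_form R X q) G i); split => //.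
  by move=> i; apply: GF; exact: mem_nth.
move=> W t oW WV Ft y Wy; have [W' [m [c [g [oW' Wy' hc gG tE]]]]] := gen W t oW WV Ft y Wy.
have /fin_all_exists[k kE] j : exists k : 'I_(size G), g j = nth (@zero_form R X q) G k.
  have lt_k : (index (g j) G < size G)%N by rewrite index_mem.
  by exists (Ordinal lt_k); rewrite /= nth_index.
(* Coefficients attached to the same generator are added up. *)
exists (W `&` W'), (fun i z => \sum_(j | k j == i) c j z); split => //; first exact: openI.
  move=> i z [_ Wz'].
  have hs : hol_at z (fun u => \sum_(j <- [seq j <- index_enum 'I_m | k j == i]) c j u).
    by apply: hol_sum => j; exact: hc.
  by apply: (hol_eq _ hs); apply: nearW => u; rewrite big_filter.
move=> z [_ Wz'] rz D hD; rewrite tE// /lincomb.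
rewrite (partition_big k xpredT) //=; apply: eq_bigr => i _.
by rewrite mulr_suml; apply: eq_bigr => j /eqP <-; rewrite kE.
Qed.

End GermSpan.

(** * Generators of the word sheaves and coherence *)

Section Coherence.
Variables (R : realType) (X : complexSpace R).
Hypothesis hL : forall q : nat, coherent (Lsheaf X q).
Hypothesis halpha : forall q : nat, coherent (alpha X q).
Local Notation fct := (X -> Cx R).
Local Notation form := (Defs.form X).
Local Notation words := (@words R X).
Implicit Types (x y : X) (U V W : set X).

Let salpha q : is_submodule (alpha X q). Proof. by have [] := halpha q. Qed.

Lemma wedgeDr r s q (E : (r + s)%N = q) (a : form r) (b b' : form s) x D :
  wedge E a (fun y D => b y D + b' y D : Cx R) x D = wedge E a b x D + wedge E a b' x D.
Proof.
rewrite /wedge -mulrDr -big_split /=; congr (_ * _); apply: eq_bigr => p _.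
by rewrite mulrDr.
Qed.

(** The coefficients c_i of b vary with b, so their differentials cannot be listed among finitely
    many generators. Instead dc_i /\ g_i is a section of alpha in degree s + 1 and is expanded
    again, in the generators [Gs1]. *)
Lemma germ_span_wedge_dR r s q (E : (r + s.+1)%N = q) y W (Gr : seq (form r)) (Gs : seq (form s))
   (Gs1 : seq (form s.+1)) (G : seq (form q)) (a : form r) (b : form s) :
  open W -> W y ->
  (forall g, g \in Gs -> alpha X s W g) ->
  (forall V t, open V -> V `<=` W -> alpha X s.+1 V t -> forall y, V y -> germ_span y Gs1 t) ->
  (forall g g', g \in Gr -> g' \in Gs -> wedge E g (dR g') \in G) ->
  (forall g g', g \in Gr -> g' \in Gs1 -> wedge E g g' \in G) ->
  germ_span y Gr a -> germ_span y Gs b -> germ_span y G (wedge E a (dR b)).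
Proof.
move=> oW Wy Gsa gen1 GG1 GG2 sa [W' [m [c [g [oW' Wy' hc gG bE]]]]].
have oI := openI oW oW'; have Iy : (W `&` W') y by [].
have E1 : (1 + s)%N = s.+1 by [].
pose dc i : form 1 := kform (kdiff (kfun (c i))).
have dbE : eqform (W `&` W') (dR b)
    (fun z D => lincomb c (fun i => dR (g i)) z D + \sum_(i < m) wedge E1 (dc i) (g i) z D).
  move=> z [Wz Wz'] rz D hD.
  have nb : \forall u \near z, eqform_at u b (lincomb c g).
    have nW : \forall u \near z, W' u by exact: open_nbhs_nbhs.
    by apply: filterS nW => u; exact: bE.
  have kg i : kahler_at z (g i) by exact: alpha_kahler (Gsa _ (gG i)) Wz rz.
  have kcg i : kahler_at z ((fun u D => c i u * g i u D) : form s).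
    by have [e He] := kg i; exists (kscale (c i) e); apply: represents_scale => //; exact: hc.
  rewrite (dR_congr nb) (dR_sum (index_enum 'I_m) kcg rz hD) /lincomb -big_split /=.
  by apply: eq_bigr => i _; exact: (dR_scale E1 (hc i z Wz') (kg i) rz hD).
have span1 i : germ_span y G (wedge E a (dR (g i))).
  apply: germ_span_wedgel sa => g' g'G; apply: germ_span_gen; exact: GG1.
have span2 i : germ_span y G (wedge E a (wedge E1 (dc i) (g i))).
  have : alpha X s.+1 (W `&` W') (wedge E1 (dc i) (g i)).
    apply: alpha_kahler1 => //; first by move=> z [_ Wz']; exact: hc.
    exact: (submodule_restrict (salpha s) oW oI (@subIsetl _ _ _) (Gsa _ (gG i))).
  move=> /(gen1 _ _ oI (@subIsetl _ _ _))/(_ y Iy).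
  apply: germ_span_wedger => g1 g1G; apply: germ_span_wedgel sa => g2 g2G.
  by apply: germ_span_gen; exact: GG2.
have h1 (i : 'I_m) : holo (W `&` W') (fun _ : X => 1 : Cx R) by move=> z _; exact: hol_cst.
have hcI i : holo (W `&` W') (c i) by move=> z [_ Wz']; exact: hc.
have S1 := germ_span_lincomb Iy hcI span1.
have S2 := germ_span_lincomb Iy h1 span2.
apply: (germ_span_congr oI Iy) (germ_span_linear (hol_cst y 1) S1 S2).
move=> z Iz rz D hD; rewrite (wedgeE_congr E (eqform_at_refl a) (dbE z Iz) rz hD) mul1r.
rewrite wedgeDr wedge_sumr1; congr (_ + _); first exact: wedge_sumr.
by apply: eq_bigr => i _; rewrite mul1r.
Qed.

(** The equality of degrees is tested, so that (r, s) can range over a plain list of pairs; those of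
    the wrong total degree contribute nothing. *)
Definition wedge_gens r s q (Gr : seq (form r)) (Gs : seq (form s)) : seq (form q) :=
  match (r + s)%N =P q with
  | ReflectT E => [seq wedge E a b | a <- Gr, b <- Gs]
  | ReflectF _ => [::]
  end.

Lemma mem_wedge_gens r s q (E : (r + s)%N = q) (Gr : seq (form r)) (Gs : seq (form s)) a b :
  a \in Gr -> b \in Gs -> wedge E a b \in wedge_gens q Gr Gs.
Proof.
move=> aG bG; rewrite /wedge_gens; case: eqP => // E'.
by rewrite (eq_irrelevance E' E); apply/allpairsP; exists (a, b).
Qed.

Lemma wedge_gensP r s q (Gr : seq (form r)) (Gs : seq (form s)) (t : form q) :
  t \in wedge_gens q Gr Gs -> exists (E : (r + s)%N = q) a b, [/\ a \in Gr, b \in Gs & t = wedge E a b].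
Proof.
by rewrite /wedge_gens; case: eqP => // E /allpairsP[[a b] [aG bG ->]]; exists E, a, b.
Qed.

Lemma words_finitely_generated k q x : finitely_generated_at (@words k q) x.
Proof.
elim: k q x => [|k IH] q x.
  by have [_ /finite_typeP ft _] := halpha q; exact: ft.
have fa s : finitely_generated_at (@alpha R X s) x.
  by have [_ /finite_typeP ft _] := halpha s; exact: ft.
have VQ s := cid (IH s x); have VA s := cid (fa s).
have GQ s := cid (projT2 (VQ s)); have GA s := cid (projT2 (VA s)).
(* Factors of a form of degree q have degree at most q, so finitely many neighbourhoods are
   intersected. *)
pose V := interior [set y | forall s : 'I_q.+1, projT1 (VQ s) y /\ projT1 (VA s) y].
have oV : open V by exact: open_interior.
have Vx : V x.
  apply: filter_forall => s; have [oQ Qx _ _] := projT2 (GQ s); have [oA Ax _ _] := projT2 (GA s).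
  by apply: filterI; exact: open_nbhs_nbhs.
have VVQ s : (s <= q)%N -> V `<=` projT1 (VQ s).
  move=> sq y /interior_subset H.
  by have [] := H (Ordinal (sq : (s < q.+1)%N)).
have VVA s : (s <= q)%N -> V `<=` projT1 (VA s).
  move=> sq y /interior_subset H.
  by have [] := H (Ordinal (sq : (s < q.+1)%N)).
have genQ s : (s <= q)%N -> forall W t, open W -> W `<=` V -> words k W t ->
    forall y, W y -> germ_span y (projT1 (GQ s)) t.
  move=> sq W t oW WV wt; have [_ _ _ gen] := projT2 (GQ s); apply: gen => //.
  by move=> y /WV; exact: VVQ.
have genA s : (s <= q)%N -> forall W t, open W -> W `<=` V -> alpha X s W t ->
    forall y, W y -> germ_span y (projT1 (GA s)) t.
  move=> sq W t oW WV wt; have [_ _ _ gen] := projT2 (GA s); apply: gen => //.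
  by move=> y /WV; exact: VVA.
have memQ s g : (s <= q)%N -> g \in projT1 (GQ s) -> words k V g.
  move=> sq gG; have [oQ _ H _] := projT2 (GQ s).
  by apply: (submodule_restrict (words_submodule hL halpha k s) oQ oV (VVQ s sq)); exact: H.
have memA s g : (s <= q)%N -> g \in projT1 (GA s) -> alpha X s V g.
  move=> sq gG; have [oA _ H _] := projT2 (GA s).
  by apply: (submodule_restrict (salpha s) oA oV (VVA s sq)); exact: H.
pose ws := [seq (r, s) | r <- iota 0 q.+1, s <- iota 0 q.+1].
(* Both kinds of last letter, b and db, are covered. The products with undifferentiated generators
   also span the terms a /\ (dc /\ g) that come from the Leibniz rule. *)
pose G : seq (form q) :=
  flatten [seq wedge_gens q (projT1 (GQ rs.1)) (projT1 (GA rs.2)) | rs <- ws] ++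
  flatten [seq wedge_gens q (projT1 (GQ rs.1)) (map (@dR R X rs.2) (projT1 (GA rs.2))) | rs <- ws].
have wsP r s : ((r, s) \in ws) = (r <= q)%N && (s <= q)%N.
  apply/allpairsP/andP => [[[r' s'] [r'q s'q [-> ->]]]|[rq sq]].
    by move: r'q s'q; rewrite !mem_iota.
  by exists (r, s); split => //; rewrite mem_iota.
have inG1 r s (E : (r + s)%N = q) a b : a \in projT1 (GQ r) -> b \in projT1 (GA s) ->
    wedge E a b \in G.
  move=> aG bG; rewrite mem_cat; apply/orP; left; apply/flattenP.
  exists (wedge_gens q (projT1 (GQ r)) (projT1 (GA s))); last exact: mem_wedge_gens.
  by apply/mapP; exists (r, s) => //; rewrite wsP -E leq_addr leq_addl.
have inG2 r s (E : (r + s.+1)%N = q) a b : a \in projT1 (GQ r) -> b \in projT1 (GA s) ->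
    wedge E a (dR b) \in G.
  move=> aG bG; rewrite mem_cat; apply/orP; right; apply/flattenP.
  exists (wedge_gens q (projT1 (GQ r)) (map (@dR R X s) (projT1 (GA s)))).
    by apply/mapP; exists (r, s) => //; rewrite wsP; lia.
  by apply: mem_wedge_gens => //; exact: map_f.
exists V, G; split => //.
  move=> t; rewrite mem_cat => /orP[] /flattenP[l /mapP[[r s] _ ->]] /wedge_gensP[E [a [b [aG bG ->]]]].
    by apply: words_wedge => //; [apply: memQ aG|apply: memA bG]; move: E => /=; lia.
  have /mapP[b' b'G bE] := bG; rewrite {}bE.
  by apply: words_wedge_dR => //; [apply: memQ aG|apply: memA b'G]; move: E => /=; lia.
move=> W t oW WV wt y Wy.
have [W1 [m [u [oW1 W1y W1W lu tE]]]] := wt y Wy.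
have W1V : W1 `<=` V by move=> z /W1W/WV.
apply: (germ_span_congr oW1 W1y (t := lincomb (fun (_ : 'I_m) _ => 1) u)).
  move=> z W1z rz D hD; rewrite tE// /lincomb.
  by apply: eq_bigr => j _; rewrite mul1r.
apply: (germ_span_lincomb W1y) => [j z _|j]; first exact: hol_cst.
have [[r [s [E [a [b [wa ab ->]]]]]]|[r [s [E [a [b [wa ab ->]]]]]]] := lu j.
  have rq : (r <= q)%N by lia.
  have sq : (s <= q)%N by lia.
  have sa := genQ r rq W1 a oW1 W1V wa y W1y.
  have sb := genA s sq W1 b oW1 W1V ab y W1y.
  apply: germ_span_wedgel sa => g gG; apply: germ_span_wedger sb => g' g'G.
  by apply: germ_span_gen; exact: inG1.
have rq : (r <= q)%N by lia.
have sq : (s <= q)%N by lia.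
have sq1 : (s.+1 <= q)%N by lia.
have sa := genQ r rq W1 a oW1 W1V wa y W1y.
have sb := genA s sq W1 b oW1 W1V ab y W1y.
refine (@germ_span_wedge_dR r s q E y V (projT1 (GQ r)) (projT1 (GA s)) (projT1 (GA s.+1)) G a b
  oV (W1V y W1y) _ _ _ _ sa sb).
- by move=> g; exact: memA.
- by move=> V' t' oV' V'V at'; exact: genA.
- by move=> g g'; exact: inG2.
- by move=> g g'; exact: inG1.
Qed.

Lemma words_coherent k q : coherent (@words k q).
Proof.
split; first exact: words_submodule.
  by apply/finite_typeP => x; exact: words_finitely_generated.
move=> U m s oU ws; have [_ _ rel] := hL q; apply: rel => // i.
exact: (words_Lsheaf hL halpha oU (ws i)).
Qed.

End Coherence.

Lemma eq_coherent (R : realType) (X : complexSpace R) q (F G : subsheaf X q) :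
  (forall U s, open U -> F U s <-> G U s) -> coherent F -> coherent G.
Proof.
move=> FG [[eqF resF glueF zF linF] ftF relF]; split.
- split.
  + move=> U s t oU st /(FG _ _ oU) Fs; apply/(FG _ _ oU); exact: eqF Fs.
  + move=> U V s oU oV VU /(FG _ _ oU) Fs; apply/(FG _ _ oV); exact: resF Fs.
  + move=> U s oU loc; apply/(FG _ _ oU); apply: glueF => // x Ux.
    have [V [oV Vx VU Gs]] := loc x Ux; exists V; split => //.
    exact/(FG _ _ oV).
  + by move=> U oU; apply/(FG _ _ oU); exact: zF.
  + move=> U c s t oU hc /(FG _ _ oU) Fs /(FG _ _ oU) Ft; apply/(FG _ _ oU).
    exact: linF.
- move=> x Xx; have [V [m [s [oV Vx VX Fs gen]]]] := ftF x Xx.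
  exists V, m, s; split => //; first by move=> i; apply/(FG _ _ oV).
  by move=> W t oW WV /(FG _ _ oW); exact: gen.
- by move=> U m s oU Gs; apply: relF => // i; apply/(FG _ _ oU).
Qed.

Theorem corollary2p1p4 (R : realType) (X : complexSpace R)
  (hX : pure_dimensional X)
  (hL : forall q : nat, coherent (Lsheaf X q))
  (halpha : forall q : nat, coherent (alpha X q)) :
  included (beta X) (Lsheaf X) /\
  (forall q : nat, coherent (beta X q)) /\
  wedge_stable (beta X) /\ d_stable (beta X).
Proof.
have bw q U s (oU : open U) := beta_words hL halpha (q := q) s oU.
split; first by move=> q U s oU /(bw _ _ _ oU); exact: words_Lsheaf.
split; [|split].
- move=> q; apply: (eq_coherent _ (words_coherent hL halpha q q)) => U s oU.
  exact: iff_sym (bw q U s oU).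
- move=> r s U a b oU /(bw _ _ _ oU) wa /(bw _ _ _ oU) wb; apply/(bw _ _ _ oU).
  apply: (words_degree hL halpha (k := (r + s).+1) oU).
  exact: (words_mul hL halpha (erefl (r + s)%N) oU wa wb).
- move=> q U s oU /(bw _ _ _ oU) ws; apply/(bw _ _ _ oU).
  apply: (words_degree hL halpha (k := q.+1) oU).
  exact: (words_dR hL halpha oU ws).
Qed.
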